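(* Let $\mathfrak{n}_1,\mathfrak{n}_2$ be an $\mathbb{A}^+_{\mathbb{Q}_p}$-basis of $\mathbb{N}(\mathcal{T})$ as in the context. Then $(1+\pi)\varphi(\mathfrak{n}_1),(1+\pi)\varphi(\mathfrak{n}_2)$ form a $\Lambda$-basis of $(\varphi^*\mathbb{N}(\mathcal{T}))^{\psi=0}$.
   Context: $p$ odd prime; $f=\sum a_nq^n$ a normalised new cuspidal eigenform of weight $k$ with $3\le k\le p$, level prime to $p$, nebentypus $\varepsilon$, non-ordinary at $p$; $E$ the completion at a prime above $p$ of its coefficient field, ring of integers $\mathcal{O}$. $T_f$ is Kato's canonical lattice in the cohomological Galois representation of $f$ (Hodge–Tate weights $0,1-k$) and $\mathcal{T}=T_f(k-1)$. $\Gamma=\mathrm{Gal}(\mathbb{Q}(\mu_{p^\infty})/\mathbb{Q})$, $\Lambda=\mathcal{O}[[\Gamma]]$, $\chi$ the cyclotomic character. $\mathbb{A}^+_{\mathbb{Q}_p}=\mathcal{O}[[\pi]]$ with $\varphi(\pi)=(1+\pi)^p-1$, $\sigma(\pi)=(1+\pi)^{\chi(\sigma)}-1$, and $\psi$ the left inverse of $\varphi$ with $\varphi\psi(F)(\pi)=\frac1p\sum_{\zeta^p=1}F(\zeta(1+\pi)-1)$; $\mathbb{B}^+_{\mathrm{rig},\mathbb{Q}_p}$ is the ring of power series over $E$ converging on the open unit disc. $\mathbb{N}(\mathcal{T})$ is the Wach module of $\mathcal{T}$ (free of rank 2 over $\mathbb{A}^+_{\mathbb{Q}_p}$ with semilinear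 $\varphi$ and $\Gamma$-action, $\psi$ extended to it), $\varphi^*\mathbb{N}(\mathcal{T})$ is the $\mathbb{A}^+_{\mathbb{Q}_p}$-submodule generated by $\varphi(\mathbb{N}(\mathcal{T}))$, and $\Lambda$ acts on $(\varphi^*\mathbb{N}(\mathcal{T}))^{\psi=0}$ through $\Gamma$. $\mathbb{D}_{\mathrm{cris}}(\mathcal{T})=\mathbb{N}(\mathcal{T})/\pi\mathbb{N}(\mathcal{T})$ has an $\mathcal{O}$-basis $\mathfrak{v}_1\in\mathrm{Fil}^0$, $\mathfrak{v}_2=\varphi(\mathfrak{v}_1)$; $\mathfrak{n}_1,\mathfrak{n}_2$ is a lift of it to an $\mathbb{A}^+_{\mathbb{Q}_p}$-basis of $\mathbb{N}(\mathcal{T})$ such that the matrix $M\in M_{2\times2}(\mathbb{B}^+_{\mathrm{rig},\mathbb{Q}_p})$ defined by $(\mathfrak{n}_1\ \mathfrak{n}_2)=(\mathfrak{v}_1\ \mathfrak{v}_2)M$ (inside $\mathbb{B}^+_{\mathrm{rig},\mathbb{Q}_p}\otimes\mathbb{D}_{\mathrm{cris}}(\mathcal{T})$, on which $\Gamma$ acts through the coefficients) satisfies $M\equiv I_2\bmod\pi^{k-1}$. *)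

(* Defs.v *)
From HB Require Import structures.
From mathcomp Require Import all_boot all_order all_algebra all_field.
From mathcomp Require Import all_classical all_reals all_analysis.
From mathcomp Require Import complex.
Set Implicit Arguments.
Unset Strict Implicit.
Unset Printing Implicit Defensive.
Import Order.TTheory GRing.Theory Num.Theory numFieldNormedType.Exports.
Local Open Scope ring_scope.

Section Newforms.
Variable R : realType.
Local Notation C := R[i].
Implicit Types (f : C -> C) (t : C).

Definition upper_half t : Prop := 0 < complex.Im t.

Definition slash (k : nat) f (a b c d : int) t : C :=
  (c%:~R * t + d%:~R) ^- k * f ((a%:~R * t + b%:~R) / (c%:~R * t + d%:~R)).

Definition holomorphic_H f : Prop :=
  forall t, upper_half t -> derivable (f : C^o -> C^o) (t : C^o) 1.

Definition vanishes_at_cusps k f : Prop :=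
  forall a b c d : int, a * d - b * c = 1 ->
  forall e : R, 0 < e -> exists Y : R, forall t,
    upper_half t -> Y < complex.Im t -> `|slash k f a b c d t| < e%:C%C.

Definition dirichlet_character (N : nat) (eps : int -> C) : Prop :=
  [/\ eps 1 = 1,
      forall m n, eps (m * n) = eps m * eps n,
      forall m n, (m = n %[mod N%:Z])%Z -> eps m = eps n
    & forall m, eps m != 0 <-> coprimez m N%:Z].

(* S_k(Gamma_0(N), eps) *)
Definition cusp_form_char (N k : nat) (eps : int -> C) f : Prop :=
  [/\ holomorphic_H f, vanishes_at_cusps k f
    & forall a b c d : int, a * d - b * c = 1 -> (N%:Z %| c)%Z ->
      forall t, upper_half t -> slash k f a b c d t = eps d * f t].

(* S_k(Gamma_1(N)) *)
Definition cusp_form_G1 (N k : nat) f : Prop :=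
  [/\ holomorphic_H f, vanishes_at_cusps k f
    & forall a b c d : int, a * d - b * c = 1 ->
      (N%:Z %| c)%Z -> (a = 1 %[mod N%:Z])%Z -> (d = 1 %[mod N%:Z])%Z ->
      forall t, upper_half t -> slash k f a b c d t = f t].

Definition hecke (k : nat) (eps : int -> C) (m : nat) f t : C :=
  m%:R ^+ k.-1 * \sum_(d <- divisors m) \sum_(b < d)
    eps (m %/ d)%N%:Z * d%:R ^- k * f (((m %/ d)%N%:R * t + b%:R) / d%:R).

Definition oldform (N k : nat) f : Prop :=
  exists (r : nat) (M d : 'I_r -> nat) (g : 'I_r -> C -> C),
    [/\ forall i, (M i * d i %| N)%N /\ (M i < N)%N,
        forall i, cusp_form_G1 (M i) k (g i)
      & forall t, upper_half t -> f t = \sum_(i < r) g i ((d i)%:R * t)].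

Definition qpow (n : nat) t : C :=
  let x := 2 * pi * n%:R * complex.Re t in
  let r := expR (- (2 * pi * n%:R * complex.Im t)) in
  (r * cos x +i* (r * sin x))%C.

Definition q_expansion f (a : nat -> C) : Prop :=
  forall t, upper_half t ->
    ((fun m => \sum_(n < m) a n * qpow n t : C^o) @ \oo --> (f t : C^o))%classic.

(* A Hecke eigenform is attached to a single primitive form, so it lies in the
   new subspace as soon as it is not in the old one. *)
Definition newform (N k : nat) (eps : int -> C) f (a : nat -> C) : Prop :=
  [/\ [/\ (0 < N)%N, dirichlet_character N eps & cusp_form_char N k eps f],
      q_expansion f a /\ a 1%N = 1,
      forall m, (0 < m)%N ->
        exists c, forall t, upper_half t -> hecke k eps m f t = c * f t
    & ~ oldform N k f].

Definition is_subfield (S : C -> Prop) : Prop :=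
  [/\ S 1, forall x y, S x -> S y -> S (x - y),
      forall x y, S x -> S y -> S (x * y) & forall x, S x -> S x^-1].

Definition coef_field (a : nat -> C) (x : C) : Prop :=
  forall S, is_subfield S -> (forall n, S (a n)) -> S x.

End Newforms.

(* A finite extension of Q_p, with its ring of integers as a predicate: a complete
   discrete valuation field of characteristic 0 with finite residue field of
   characteristic p *)
Record localField (p : nat) := LocalField {
  lf_sort :> fieldType;
  lf_int : lf_sort -> Prop;
  lf_int1 : lf_int 1;
  lf_intB : forall x y, lf_int x -> lf_int y -> lf_int (x - y);
  lf_intM : forall x y, lf_int x -> lf_int y -> lf_int (x * y);
  lf_char0 : forall n : nat, (n.+1)%:R != 0 :> lf_sort;
  lf_p_nonunit : ~ lf_int (p%:R^-1);
  lf_dvr : exists2 w : lf_sort, lf_int w /\ w != 0 &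
    forall x, x != 0 -> exists (z : int) (u : lf_sort),
      [/\ lf_int u, lf_int u^-1 & x = w ^ z * u];
  lf_residue_finite : exists2 w : lf_sort, lf_int w /\ ~ lf_int w^-1 &
    exists s : seq lf_sort, forall x, lf_int x ->
      exists2 y, y \in s & lf_int ((x - y) / w);
  lf_complete : forall u : nat -> lf_sort,
    (forall m, exists K, forall i j, (K <= i)%N -> (K <= j)%N ->
       lf_int ((u i - u j) / p%:R ^+ m)) ->
    exists l, forall m, exists K, forall i, (K <= i)%N ->
       lf_int ((u i - l) / p%:R ^+ m)
}.

Section LocalField.
Variables (p : nat) (E : localField p).

Definition is_Zp (x : E) : Prop :=
  forall m, exists n : nat, lf_int ((x - n%:R) / p%:R ^+ m).

Definition is_Zp_unit (x : E) : Prop := [/\ is_Zp x, x != 0 & lf_int x^-1].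

(* [iota] exhibits [E] as the completion of the coefficient field of [a] at a
   prime above [p]. *)
Definition is_completion (R : realType) (a : nat -> R[i]) (iota : R[i] -> E) :
    Prop :=
  [/\ iota 1 = 1,
      forall x y, coef_field a x -> coef_field a y ->
        iota (x - y) = iota x - iota y,
      forall x y, coef_field a x -> coef_field a y ->
        iota (x * y) = iota x * iota y
    & forall (x : E) m, exists2 y, coef_field a y &
        lf_int ((x - iota y) / p%:R ^+ m)].

Definition non_ordinary (R : realType) (a : nat -> R[i]) (iota : R[i] -> E) :
    Prop :=
  forall b : E, lf_int b -> iota (a p) * b <> 1.

End LocalField.

Definition fps (E : fieldType) : Type := nat -> E.

Section FpsRing.
Variable E : fieldType.
Implicit Types F G H : fps E.

HB.instance Definition _ := gen_eqMixin (fps E).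
HB.instance Definition _ := gen_choiceMixin (fps E).

Definition fps_zero : fps E := fun=> 0.
Definition fps_opp F : fps E := fun n => - F n.
Definition fps_add F G : fps E := fun n => F n + G n.
Definition fps_one : fps E := fun n => (n == 0%N)%:R.
Definition fps_mul F G : fps E := fun n => \sum_(i < n.+1) F i * G (n - i)%N.

Fact fps_addA : associative fps_add.
Proof. by move=> F G H; apply/funext => n; rewrite /fps_add addrA. Qed.
Fact fps_addC : commutative fps_add.
Proof. by move=> F G; apply/funext => n; rewrite /fps_add addrC. Qed.
Fact fps_add0 : left_id fps_zero fps_add.
Proof. by move=> F; apply/funext => n; rewrite /fps_add add0r. Qed.
Fact fps_addN : left_inverse fps_zero fps_opp fps_add.
Proof. by move=> F; apply/funext => n; rewrite /fps_add addNr. Qed.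

HB.instance Definition _ :=
  GRing.isZmodule.Build (fps E) fps_addA fps_addC fps_add0 fps_addN.

Let trunc K F : {poly E} := \poly_(i < K) F i.

Let mulE K F G n : (n < K)%N -> fps_mul F G n = (trunc K F * trunc K G)`_n.
Proof.
move=> ltnK; rewrite coefM; apply: eq_bigr => i _.
have lti : (i < K)%N := leq_trans (ltn_ord i) ltnK.
by rewrite !coef_poly lti (leq_ltn_trans (leq_subr i n) ltnK).
Qed.

Fact fps_mulC : commutative fps_mul.
Proof.
by move=> F G; apply/funext => n; rewrite !(@mulE n.+1) // mulrC.
Qed.
Fact fps_mulA : associative fps_mul.
Proof.
move=> F G H; apply/funext => n.
have tM A B i : (i < n.+1)%N -> (trunc n.+1 (fps_mul A B))`_i
    = (trunc n.+1 A * trunc n.+1 B)`_i.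
  by move=> lti; rewrite coef_poly lti (@mulE n.+1).
transitivity ((trunc n.+1 F * (trunc n.+1 G * trunc n.+1 H))`_n).
  rewrite (@mulE n.+1) // !coefM; apply: eq_bigr => i _.
  by rewrite tM // ltnS leq_subr.
rewrite mulrA (@mulE n.+1) // !coefM; apply: eq_bigr => i _.
by rewrite tM.
Qed.
Fact fps_mul1 : left_id fps_one fps_mul.
Proof.
move=> F; apply/funext => n; rewrite /fps_mul big_ord_recl /= mul1r subn0.
by rewrite big1 ?addr0 // => i _; rewrite /fps_one /= mul0r.
Qed.
Fact fps_mulDl : left_distributive fps_mul fps_add.
Proof.
move=> F G H; apply/funext => n; rewrite /fps_add /fps_mul -big_split /=.
by apply: eq_bigr => i _; rewrite mulrDl.
Qed.
Fact fps_one_neq0 : fps_one != fps_zero.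
Proof.
apply/eqP => /(congr1 (fun F : fps E => F 0%N)) /eqP.
by rewrite /fps_one /fps_zero /= oner_eq0.
Qed.

HB.instance Definition _ := GRing.Zmodule_isComNzRing.Build (fps E)
  fps_mulA fps_mulC fps_mul1 fps_mulDl fps_one_neq0.

Definition fps_const (c : E) : fps E := fun n => if n == 0%N then c else 0.
Definition fps_pi : fps E := fun n => (n == 1%N)%:R.

(* F(G), for G without constant term *)
Definition fps_comp F G : fps E := fun n => \sum_(m < n.+1) F m * (G ^+ m) n.

(* (1 + pi)^c, for c in Z_p *)
Definition fps_binom (c : E) : fps E :=
  fun n => (\prod_(i < n) (c - i%:R)) / n`!%:R.

Definition fps_phi (p : nat) F : fps E := fps_comp F ((1 + fps_pi) ^+ p - 1).
Definition fps_gamma (c : E) F : fps E := fps_comp F (fps_binom c - 1).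

(* q = phi(pi) / pi *)
Definition fps_q (p : nat) : fps E := \sum_(i < p) (1 + fps_pi) ^+ i.

End FpsRing.

Arguments fps_pi {E}.
Arguments fps_q {E}.

(* An algebraic closure of E, with the data attached to G_Qp: an embedding of
   the algebraic numbers, a compatible system of p-power roots of unity, the
   restriction map to G_Q, the cyclotomic character and, as Gamma is identified
   with Z_p^* by the latter, a choice of a lift to G_Qp of each element of Gamma.
   An endomorphism of an algebraic extension is an automorphism. *)
Record closureData (p : nat) (E : localField p) := ClosureData {
  cl_sort :> closedFieldType;
  cl_emb : {rmorphism E -> cl_sort};
  cl_algebraic : forall x : cl_sort, exists2 P : {poly E},
    P != 0 & root (map_poly cl_emb P) x;
  cl_algC : {rmorphism algC -> cl_sort};
  cl_zeta : nat -> cl_sort;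
  cl_zeta0 : cl_zeta 0%N = 1;
  cl_zeta1 : cl_zeta 1%N != 1;
  cl_zetaS : forall n, cl_zeta n.+1 ^+ p = cl_zeta n;
  cl_GQp : {rmorphism cl_sort -> cl_sort} -> Prop :=
    fun g => forall x, is_Zp x -> g (cl_emb x) = cl_emb x;
  cl_res : {rmorphism cl_sort -> cl_sort} -> {rmorphism algC -> algC};
  cl_resP : forall g x, cl_algC (cl_res g x) = g (cl_algC x);
  cl_chi : {rmorphism cl_sort -> cl_sort} -> E;
  cl_chi_unit : forall g, cl_GQp g -> is_Zp_unit (cl_chi g);
  cl_chiP : forall g, cl_GQp g -> forall n m : nat,
    lf_int ((cl_chi g - m%:R) / p%:R ^+ n) -> g (cl_zeta n) = cl_zeta n ^+ m;
  cl_lift : E -> {rmorphism cl_sort -> cl_sort};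
  cl_liftP : forall c, is_Zp_unit c ->
    cl_GQp (cl_lift c) /\ cl_chi (cl_lift c) = c
}.

Section Integers.
Variables (p : nat) (E : localField p) (K : closureData E).

(* integral over O *)
Definition cl_int (x : K) : Prop :=
  exists P : {poly E}, [/\ P \is monic, forall i, lf_int P`_i
                         & root (map_poly (@cl_emb _ _ K) P) x].

Definition cl_modp (x y : K) : Prop := cl_int ((x - y) / p%:R).

(* A^+ = O[[pi]] *)
Definition Aplus (F : fps E) : Prop := forall n, lf_int (F n).

(* B^+_rig: convergence at all points of the open unit disc *)
Definition Brig (F : fps E) : Prop :=
  forall z : K, (exists m, cl_int (z ^+ m / p%:R)) ->
  forall e : nat, exists n0, forall n, (n0 <= n)%N ->
    cl_int (cl_emb K (F n) * z ^+ n / p%:R ^+ e).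

(* psi F = G: coefficientwise, phi(G) is the p-adically convergent series
   p^-1 \sum_(zeta^p = 1) F (zeta (1 + pi) - 1). *)
Definition is_psi (F G : fps E) : Prop :=
  forall m e : nat, exists n0, forall l, (n0 <= l)%N ->
    cl_int ((cl_emb K (fps_phi p G m)
      - p%:R^-1 * \sum_(i < p) \sum_(n < l) cl_emb K (F n)
          * ((cl_zeta K 1 ^+ i *: (1 + 'X) - 1) ^+ n)`_m) / p%:R ^+ e).

End Integers.

Arguments cl_GQp {p E} _ _ : rename.

(* ~A = W(C_p^flat), with ~A^+ = W(O_Cp^flat) in it: [At] is the strict p-ring
   whose residue field is the fraction field of the perfect ring
   O_Cp^flat = lim_(x |-> x^p) O_Kbar / p, and [at_comp a] is the sequence of
   components (given up to p O_Kbar) of the residue class of [a] in ~A^+. *)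
Record witt_tilt (p : nat) (E : localField p) (K : closureData E) := WittTilt {
  At :> comNzRingType;
  at_plus : At -> Prop;
  at_comp : At -> nat -> K;
  at_plus1 : at_plus 1;
  at_plusB : forall a b, at_plus a -> at_plus b -> at_plus (a - b);
  at_plusM : forall a b, at_plus a -> at_plus b -> at_plus (a * b);
  at_comp_int : forall a n, at_plus a -> cl_int (at_comp a n);
  at_comp1 : forall n, cl_modp (at_comp 1 n) 1;
  at_compB : forall a b n, at_plus a -> at_plus b ->
    cl_modp (at_comp (a - b) n) (at_comp a n - at_comp b n);
  at_compM : forall a b n, at_plus a -> at_plus b ->
    cl_modp (at_comp (a * b) n) (at_comp a n * at_comp b n);
  at_compS : forall a n, at_plus a ->
    cl_modp (at_comp a n.+1 ^+ p) (at_comp a n);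
  at_comp_ker : forall a, at_plus a ->
    ((forall n, cl_modp (at_comp a n) 0) <->
     exists2 b, at_plus b & a = p%:R * b);
  at_comp_surj : forall u : nat -> K,
    (forall n, cl_int (u n) /\ cl_modp (u n.+1 ^+ p) (u n)) ->
    exists2 a, at_plus a & forall n, cl_modp (at_comp a n) (u n);
  at_torsion_free : forall a : At, p%:R * a = 0 -> a = 0;
  at_plus_saturated : forall a : At, at_plus (p%:R * a) -> at_plus a;
  at_separated : forall a : At,
    (forall m, exists b, a = p%:R ^+ m * b) -> a = 0;
  at_complete : forall u : nat -> At,
    (forall n, exists b, u n.+1 - u n = p%:R ^+ n * b) ->
    exists l, forall n, exists b, u n - l = p%:R ^+ n * b;
  at_plus_complete : forall u : nat -> At, (forall n, at_plus (u n)) ->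
    (forall n, exists b, u n.+1 - u n = p%:R ^+ n * b) ->
    exists2 l, at_plus l & forall n, exists b, u n - l = p%:R ^+ n * b;
  at_residue_field : forall a : At, (forall b, a <> p%:R * b) ->
    exists b c, a * b - 1 = p%:R * c;
  at_residue_frac : forall a : At, exists b s c,
    [/\ at_plus b, at_plus s, forall d, s <> p%:R * d & s * a - b = p%:R * c];
  at_frob : {rmorphism At -> At};
  at_frobP : forall a, exists b, at_frob a - a ^+ p = p%:R * b;
  at_gal : {rmorphism K -> K} -> {rmorphism At -> At};
  at_galP : forall g a, cl_GQp K g -> at_plus a ->
    at_plus (at_gal g a) /\
    forall n, cl_modp (at_comp (at_gal g a) n) (g (at_comp a n));
  (* the Teichmueller lift of epsilon = (1, zeta_p, zeta_(p^2), ...) *)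
  at_eps : At;
  at_eps_plus : at_plus at_eps;
  at_epsP : forall n, cl_modp (at_comp at_eps n) (cl_zeta K n);
  at_eps_teich : at_frob at_eps = at_eps ^+ p
}.

(* ~A_O = O (x)_(Z_p) ~A, with phi and G_Qp acting on the factor ~A, and with the
   embedding [ao_ev] of A^+ = O[[pi]] sending pi to [epsilon] - 1; mapping A^+
   into O (x) ~A^+ makes it the continuous one. *)
Record periodRing (p : nat) (E : localField p) (K : closureData E) :=
    PeriodRing {
  ao_tilt : witt_tilt K;
  ao_sort :> comNzRingType;
  ao_A : {rmorphism ao_tilt -> ao_sort};
  ao_O : E -> ao_sort;
  ao_O1 : ao_O 1 = 1;
  ao_OB : forall x y, lf_int x -> lf_int y -> ao_O (x - y) = ao_O x - ao_O y;
  ao_OM : forall x y, lf_int x -> lf_int y -> ao_O (x * y) = ao_O x * ao_O y;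
  ao_tensor : exists (d : nat) (e : 'I_d -> E), [/\ forall i, lf_int (e i),
    forall x, lf_int x -> exists! z : 'I_d -> E,
      (forall i, is_Zp (z i)) /\ x = \sum_i z i * e i
    & forall b, exists! a : 'I_d -> ao_tilt,
      b = \sum_i ao_A (a i) * ao_O (e i)];
  ao_frob : {rmorphism ao_sort -> ao_sort};
  ao_frobA : forall a, ao_frob (ao_A a) = ao_A (at_frob ao_tilt a);
  ao_frobO : forall x, lf_int x -> ao_frob (ao_O x) = ao_O x;
  ao_gal : {rmorphism K -> K} -> {rmorphism ao_sort -> ao_sort};
  ao_galA : forall g a, cl_GQp K g -> ao_gal g (ao_A a) = ao_A (at_gal _ g a);
  ao_galO : forall g x, cl_GQp K g -> lf_int x -> ao_gal g (ao_O x) = ao_O x;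
  ao_gal_frob : forall g b, cl_GQp K g ->
    ao_gal g (ao_frob b) = ao_frob (ao_gal g b);
  ao_ev : fps E -> ao_sort;
  ao_evB : forall F G, Aplus F -> Aplus G -> ao_ev (F - G) = ao_ev F - ao_ev G;
  ao_evM : forall F G, Aplus F -> Aplus G -> ao_ev (F * G) = ao_ev F * ao_ev G;
  ao_ev_const : forall c, lf_int c -> ao_ev (fps_const c) = ao_O c;
  ao_ev_pi : ao_ev fps_pi = ao_A (at_eps ao_tilt) - 1;
  ao_ev_plus : forall F, Aplus F ->
    exists (d : nat) (a : 'I_d -> ao_tilt) (x : 'I_d -> E),
      (forall i, at_plus (a i) /\ lf_int (x i)) /\
      ao_ev F = \sum_i ao_A (a i) * ao_O (x i);
  ao_ev_frob : forall F, Aplus F -> ao_frob (ao_ev F) = ao_ev (fps_phi p F);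
  ao_ev_gal : forall g F, cl_GQp K g -> Aplus F ->
    ao_gal g (ao_ev F) = ao_ev (fps_gamma (cl_chi g) F)
}.

Section GaloisRep.
Variables (p : nat) (E : localField p).
Implicit Type rho : {rmorphism algC -> algC} -> 'M[E]_2.

(* L is a prime ideal above l of the ring of algebraic integers *)
Definition prime_above (l : nat) (L : algC -> Prop) : Prop :=
  [/\ forall x, L x -> x \in Aint, L l%:R /\ ~ L 1,
      forall x y, L x -> L y -> L (x - y),
      forall x y, x \in Aint -> L y -> L (x * y)
    & forall x y, x \in Aint -> y \in Aint -> L (x * y) -> L x \/ L y].

Definition arith_frobenius (l : nat) (L : algC -> Prop)
    (s : {rmorphism algC -> algC}) : Prop :=
  forall x, x \in Aint -> L (s x - x ^+ l).

Definition in_inertia (L : algC -> Prop) (s : {rmorphism algC -> algC}) : Prop :=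
  forall x, x \in Aint -> L (s x - x).

(* The matrices of the action of G_Q on an O-basis of a stable lattice of a
   continuous two-dimensional representation over E *)
Definition lattice_rep rho : Prop :=
  [/\ rho idfun = 1%:M,
      forall s t : {rmorphism algC -> algC}, rho (s \o t) = rho s *m rho t,
      forall s t : {rmorphism algC -> algC}, s =1 t -> rho s = rho t,
      forall s i j, lf_int (rho s i j)
    & forall m, exists S : seq algC, forall s : {rmorphism algC -> algC},
        {in S, forall x, s x = x} ->
        forall i j, lf_int ((rho s i j - (i == j)%:R) / p%:R ^+ m)].

(* The cohomological representation V_f: unramified outside Np, and the geometric
   Frobenius at l has characteristic polynomial X^2 - a_l X + eps(l) l^(k-1).
   By irreducibility of V_f this determines it up to isomorphism. Under the
   hypotheses k <= p and f non-ordinary, the residual representation is irreducible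
   on G_Qp, so a stable lattice of V_f is Kato's up to homothety. *)
Definition attached_to (R : realType) (N k : nat) (eps : int -> R[i])
    (a : nat -> R[i]) (iota : R[i] -> E) rho : Prop :=
  forall (l : nat) L, prime l -> ~~ (l %| N * p)%N -> prime_above l L ->
  (forall s, in_inertia L s -> rho s = 1%:M) /\
  (forall s, arith_frobenius l L s -> char_poly (invmx (rho s)) =
     'X^2 - iota (a l) *: 'X + (iota (eps l%:Z) * l%:R ^+ k.-1)%:P).

End GaloisRep.

Section Wach.
Variables (p : nat) (E : localField p) (K : closureData E) (B : periodRing K).
Variables (k : nat) (rho : {rmorphism algC -> algC} -> 'M[E]_2).

(* ~A (x)_(Z_p) T for the lattice T = T_f(k-1), in the chosen basis of T *)
Local Notation X := 'cV[B]_2.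

Definition tA (x : X) : X := map_mx (ao_frob B) x.

Definition gact (g : {rmorphism K -> K}) (x : X) : X :=
  ao_O B (cl_chi g ^+ k.-1) *:
    (map_mx (ao_O B) (rho (cl_res g)) *m map_mx (ao_gal B g) x).

(* the action of the element of Gamma with cyclotomic character c *)
Definition Gact (c : E) : X -> X := gact (cl_lift K c).

Definition lin_comb (r : nat) (a : 'I_r -> fps E) (u : 'I_r -> X) : X :=
  \sum_(i < r) ao_ev B (a i) *: u i.

Definition is_Aplus_basis (N : X -> Prop) (n : 'I_2 -> X) : Prop :=
  (forall x, N x <-> exists a, (forall i, Aplus (a i)) /\ x = lin_comb a n) /\
  (forall a, (forall i, Aplus (a i)) -> lin_comb a n = 0 -> forall i, a i = 0).

Definition phi_pullback (N : X -> Prop) (x : X) : Prop :=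
  exists r (a : 'I_r -> fps E) (u : 'I_r -> X),
    (forall i, Aplus (a i) /\ N (u i)) /\ x = lin_comb a (fun i => tA (u i)).

Definition eq_mod_pi (N : X -> Prop) (x y : X) : Prop :=
  exists2 w, N w & x - y = ao_ev B fps_pi *: w.

(* The Wach module N(T). The Hodge-Tate weights of T are 0 and k-1, so N(T) is
   contained in phi^*N(T), itself contained in q^(1-k) N(T). That N is an
   A^+-lattice in the (phi, Gamma)-module of T amounts to its being fixed by the
   kernel of chi, and containing a basis of ~A (x) T. *)
Definition is_Wach_module (N : X -> Prop) : Prop :=
  [/\ exists2 n, is_Aplus_basis N n & exists D : 'M[B]_2,
        (\matrix_(i, j) n j i 0) *m D = 1%:M,
      forall g x, cl_GQp K g -> cl_chi g = 1 -> N x -> gact g x = x,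
      forall g x, cl_GQp K g -> N x -> N (gact g x) /\ eq_mod_pi N (gact g x) x,
      forall x, N x -> phi_pullback N x
    & forall x, N x -> N (ao_ev B (fps_q p ^+ k.-1) *: tA x)].

(* psi (\sum a_i phi(u_i)) = \sum psi(a_i) u_i *)
Definition is_psiN (N : X -> Prop) (x y : X) : Prop :=
  exists r (a b : 'I_r -> fps E) (u : 'I_r -> X),
    [/\ forall i, [/\ Aplus (a i), Aplus (b i), is_psi K (a i) (b i) & N (u i)],
        x = lin_comb a (fun i => tA (u i)) & y = lin_comb b u].

Definition pullback_psi0 (N : X -> Prop) (x : X) : Prop :=
  phi_pullback N x /\ is_psiN N x 0.

(* D_cris(T) = N / pi N. On it phi is induced by p^(1-k) q^(k-1) phi, as q = p
   modulo pi. *)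
Definition phi_cris (N : X -> Prop) (x y : X) : Prop :=
  eq_mod_pi N (ao_ev B (fps_q p ^+ k.-1) *: tA x) (p%:R ^+ k.-1 *: y).

(* Berger: the filtration of D_cris(V) is induced by that of N(V) = N[1/p], whose
   Fil^0 is made of the x with phi(x) in N[1/p]. *)
Definition Fil0_cris (N : X -> Prop) (x : X) : Prop :=
  exists (m : nat) (y : X),
    [/\ N y, N (tA y) & eq_mod_pi N y (p%:R ^+ m *: x)].

(* The embedding of N in B^+_rig (x) D_cris(T), the latter written in the basis
   v_1, v_2 of the classes of n_1, n_2, in which phi has matrix P. *)
Definition is_cris_embedding (N : X -> Prop) (n : 'I_2 -> X)
    (J : X -> 'cV[fps E]_2) : Prop :=
  exists P : 'M[E]_2,
  let h := k.-1 in
  [/\ (forall i j, lf_int (p%:R ^+ h * P i j)) /\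
      (forall j, eq_mod_pi N (ao_ev B (fps_q p ^+ h) *: tA (n j))
         (\sum_i ao_O B (p%:R ^+ h * P i j) *: n i)),
      forall x i, N x -> Brig K (J x i 0),
      (forall x y, N x -> N y -> J (x + y) = J x + J y) /\
      (forall F x, Aplus F -> N x -> J (ao_ev B F *: x) = F *: J x),
      (forall c x, is_Zp_unit c -> N x ->
         J (Gact c x) = map_mx (fps_gamma c) (J x)) /\
      (forall x, N x -> J (ao_ev B (fps_q p ^+ h) *: tA x) =
         fps_q p ^+ h *: (map_mx (@fps_const E) P *m map_mx (fps_phi p) (J x)))
    & forall i j, J (n j) i 0 0%N = (i == j)%:R].

(* An element of O[[Gamma]] = lim_n O[(Z/p^(n+1))^*] *)
Definition iwasawa_seq : Type := forall n, {ffun {unit 'Z_(p ^ n.+1)} -> E}.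

Definition is_Lambda (lam : iwasawa_seq) : Prop :=
  (forall n c, lf_int (lam n c)) /\
  (forall n (c : {unit 'Z_(p ^ n.+1)}),
     lam n c = \sum_(d : {unit 'Z_(p ^ n.+2)} |
       ((val d : nat) == (val c : nat) %[mod p ^ n.+1])%N) lam n.+1 d).

(* lam . x = y, that is, y = lim_n \sum_c lam_n(c) c.x for the (p, pi)-adic
   topology of phi^* N *)
Definition Lambda_act (N : X -> Prop) (lam : iwasawa_seq) (x y : X) : Prop :=
  forall m : nat, exists n0, forall n, (n0 <= n)%N ->
  exists u w : X, [/\ phi_pullback N u, phi_pullback N w
    & \sum_(c : {unit 'Z_(p ^ n.+1)})
        ao_O B (lam n c) *: Gact (val c : nat)%:R x - y
      = p%:R ^+ m *: u + ao_ev B (fps_pi ^+ m) *: w].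

Definition Lambda_comb (N : X -> Prop) (lam : 'I_2 -> iwasawa_seq)
    (b : 'I_2 -> X) (x : X) : Prop :=
  exists2 y : 'I_2 -> X,
    forall i, Lambda_act N (lam i) (b i) (y i) & x = \sum_i y i.

(* (lam_i) |-> \sum_i lam_i b_i is a well-defined bijection from Lambda^2 to
   (phi^* N)^(psi = 0) *)
Definition is_Lambda_basis (N : X -> Prop) (b : 'I_2 -> X) : Prop :=
  [/\ forall i, pullback_psi0 N (b i),
      forall lam, (forall i, is_Lambda (lam i)) ->
        exists! x, pullback_psi0 N x /\ Lambda_comb N lam b x
    & forall x, pullback_psi0 N x ->
        exists! lam, (forall i, is_Lambda (lam i)) /\ Lambda_comb N lam b x].

End Wach.

(* Main.v *)
(** Write G_c for the matrix of the element of Gamma of character c in the basis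
    n_1, n_2. Then M G_c = c(M), so that G_c = 1 mod pi^(k-1), and the coefficient of
    pi^t in G_(a+pz) is a polynomial in z of degree at most t.

    The elements of (phi^*N)^(psi=0) are uniquely sums of (1 + pi)^a phi(y_a) with
    0 < a < p, and the element a + pz of Gamma sends (1 + pi) phi(n_i) to
    (1 + pi)^a phi(V_a(z) n_i), where V_a(z) = (1 + pi)^z G_(a+pz). The component y_a of
    a Lambda-combination is hence the integral of V_a against a measure on Z_p. Expand
    V_a(z) = sum_t pi^t sum_(m <= t) C(z, m) v_(m,t). As measures are the same as
    arbitrary integral sequences of moments l_m (Mahler, Amice), the claim amounts to
    solving the triangular systems y_t = sum_(m <= t) v_(m,t) l_m, and it suffices that
    v_(t,t) be the identity modulo p.

    To see this, let gamma = 1 + p, u_0 = 0 and u_(i+1) = (1 + p) u_i + a. Then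
    V_a(u_(i+1)) = L(V_a(u_i)) with L = (1 + pi)^a G_gamma gamma. As k - 1 >= 2 and
    p >= 3, (L - 1)F = a pi F modulo (p, pi^(m+2)) for F in (p, pi^m), and likewise
    for (1 + pi)^(u_i) and (1 + pi)^a gamma. Comparing the t-th differences at i = 0 of
    both sequences gives a^t v_(t,t) = a^t modulo p. *)
Require Import Defs.
From HB Require Import structures.
From mathcomp Require Import all_boot all_order all_algebra all_field.
From mathcomp Require Import all_classical all_reals all_analysis.
From mathcomp Require Import complex zify ring.
Set Implicit Arguments.
Unset Strict Implicit.
Unset Printing Implicit Defensive.
Import Order.TTheory GRing.Theory Num.Theory.
Local Open Scope ring_scope.

(** * Arithmetic of the local field *)

Section LocalFieldArithmetic.
Variables (p : nat) (E : localField p).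
Implicit Types (x y : E) (e m n : nat).

(** The entries of M lie in B^+_rig and may have unbounded denominators. They yield the polynomial
    dependence of G_c on c but no congruence modulo p, while the integrality of G_c comes only from
    the action on N. The matrices v_(t,t) are therefore not computed from M: they are found
    dynamically, among integral series, from the single element gamma = 1 + p. This gamma preserves
    the residue a, and gamma (a + pz) = a + p((1 + p) z + a) is the origin of the recursion for u_i.
    The orbit stays in the natural numbers, so that ordinary powers of 1 + pi and finite differences
    suffice.

    Since the u_i are not consecutive, the t-th difference along them mixes all v_(m,t) with m <= t,
    the weight of v_(m,t) being the t-th difference of C(u_i, m). These weights are also the
    coefficients of pi^m in the t-th difference of (1 + pi)^(u_i). For this scalar sequence they are
    known modulo p: a^t for m = t and 0 for m < t. *)

Definition Oint : {pred E} := fun x => `[< lf_int x >].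

Lemma OintE x : (x \in Oint) <-> lf_int x.
Proof. by split=> /asboolP. Qed.

Fact Oint_subring_closed : subring_closed Oint.
Proof.
split=> [|x y /asboolP Ox /asboolP Oy|x y /asboolP Ox /asboolP Oy].
- exact/asboolP/lf_int1.
- exact/asboolP/lf_intB.
- exact/asboolP/lf_intM.
Qed.
HB.instance Definition _ := GRing.isSubringClosed.Build E Oint
  Oint_subring_closed.

Definition pideal e : {pred E} := fun x => x / p%:R ^+ e \in Oint.

Fact pideal_zmod_closed e : zmod_closed (pideal e).
Proof.
split=> [|x y]; rewrite !unfold_in; first by rewrite mul0r; exact: (rpred0 Oint).
by rewrite mulrBl => Ox Oy; exact: (@rpredB _ Oint).
Qed.
HB.instance Definition _ e := GRing.isZmodClosed.Build E (pideal e)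
  (pideal_zmod_closed e).

Lemma pidealE e x : (x \in pideal e) <-> lf_int (x / p%:R ^+ e).
Proof. exact: OintE. Qed.

Hypothesis p_prime : prime p.

Lemma pnat_neq0 n : (0 < n)%N -> n%:R != 0 :> E.
Proof. by case: n => // n _; exact: lf_char0. Qed.

Lemma p_neq0 : p%:R != 0 :> E.
Proof. exact/pnat_neq0/prime_gt0. Qed.

Lemma pX_neq0 e : p%:R ^+ e != 0 :> E.
Proof. by rewrite expf_neq0 // p_neq0. Qed.

Lemma pideal0 x : (x \in pideal 0) = (x \in Oint).
Proof. by rewrite [LHS]unfold_in expr0 divr1. Qed.

Lemma pidealM d e x y : x \in pideal d -> y \in pideal e ->
  x * y \in pideal (d + e).
Proof.
move=> dx ey; rewrite unfold_in exprD invfM mulrACA.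
exact: (@rpredM _ Oint).
Qed.

Lemma pidealMl e x y : x \in Oint -> y \in pideal e -> x * y \in pideal e.
Proof. by rewrite -pideal0 => /pidealM/[apply]. Qed.

Lemma pidealMr e x y : x \in pideal e -> y \in Oint -> x * y \in pideal e.
Proof. by rewrite mulrC => *; exact: pidealMl. Qed.

Lemma pideal_pX e : p%:R ^+ e \in pideal e.
Proof. by rewrite unfold_in divff ?pX_neq0 //; exact: (rpred1 Oint). Qed.

Lemma pideal_pXM e x : x \in Oint -> p%:R ^+ e * x \in pideal e.
Proof. by move=> Ox; apply: pidealMr Ox; exact: pideal_pX. Qed.

Lemma pideal_pXP e x : x \in pideal e -> exists2 y, y \in Oint & x = p%:R ^+ e * y.
Proof.
by exists (x / p%:R ^+ e) => //; rewrite mulrC divfK // pX_neq0.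
Qed.

Lemma pidealW d e x : (d <= e)%N -> x \in pideal e -> x \in pideal d.
Proof.
move=> le_de /pideal_pXP[y Oy ->]; rewrite -(subnKC le_de) exprD -mulrA.
by apply: pideal_pXM; rewrite rpredM ?rpredX ?rpred_nat.
Qed.

Lemma pideal_Oint e x : x \in pideal e -> x \in Oint.
Proof. by rewrite -pideal0; exact: pidealW. Qed.

Lemma pideal_shift d e x : (p%:R ^+ d * x \in pideal (d + e)) = (x \in pideal e).
Proof. by rewrite !unfold_in exprD invfM mulrACA divff ?pX_neq0 // mul1r. Qed.

(** The generator given by [lf_dvr] is not assumed to be a non-unit. As p is not invertible, p = w^z
    u forces z > 0, so w divides p and is not a unit. *)
Lemma uniformizer : exists2 w : E,
  [/\ w \in Oint, w != 0, w^-1 \notin Oint & p%:R / w \in Oint] &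
  forall x, x != 0 -> exists (z : int) u,
    [/\ u \in Oint, u^-1 \in Oint & x = w ^ z * u].
Proof.
have [w [/OintE Ow w0] wP] := lf_dvr E; exists w; last first.
  by move=> x /wP[z [u [/OintE Ou /OintE Ou' ->]]]; exists z, u.
have [z [u [/OintE Ou /OintE Ou' pE]]] := wP _ p_neq0.
have {wP} pV : (p%:R : E)^-1 \notin Oint by apply/negP => /OintE; exact: lf_p_nonunit.
case: z pE => [[|n]|n] pE; rewrite pE in pV *.
- by rewrite mul1r Ou' in pV.
- split=> //.
    apply: contra pV => Ow'; rewrite invfM -exprnP -exprVn.
    by rewrite rpredM ?rpredX.
  by rewrite -exprnP exprSr mulrAC mulfK // rpredM ?rpredX.
- by rewrite NegzE -exprnN invfM invrK rpredM ?rpredX in pV.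
Qed.

(** As w divides p, the power p^(n+1) clears the denominator w^(n+1). *)
Lemma pX_mul_Oint x : exists r, p%:R ^+ r * x \in Oint.
Proof.
have [->|x0] := eqVneq x 0; first by exists 0%N; rewrite mulr0 rpred0.
have [w [Ow w0 Ow' Opw] wP] := uniformizer.
have [[n|n] [u [Ou Ou' ->]]] := wP _ x0.
  by exists 0%N; rewrite mul1r -exprnP rpredM ?rpredX.
exists n.+1; rewrite NegzE -exprnN mulrA -expr_div_n.
by rewrite rpredM ?rpredX.
Qed.

(** For x nonzero, some p^r x^-1 / p is integral; if x / p^r were integral too, so would be their
    product 1/p, and then w^-1. *)
Lemma pideal_separated x : (forall e, x \in pideal e) -> x = 0.
Proof.
move=> xP; apply/eqP; apply: contraT => x0.
have [w [Ow w0 Ow' Opw] wP] := uniformizer.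
have [r] := pX_mul_Oint (x^-1 / p%:R).
rewrite mulrA => Or.
case/negP: (Ow'); have := xP r; rewrite unfold_in => Ox.
have: (p%:R : E)^-1 \in Oint.
  have := rpredM Ox Or; rewrite mulrA mulrA divfK ?pX_neq0 //.
  by rewrite divff // mul1r.
move=> Op'; have -> : w^-1 = (p%:R / w) * p%:R^-1.
  by rewrite mulrAC divff ?p_neq0 // mul1r.
exact: rpredM.
Qed.

(** y/w is not integral, since (y - 1)/w is and 1/w is not; hence the exponent of w in y is at most
    0. *)
Lemma inv_Oint_1Dp y : y - 1 \in pideal 1 -> y != 0 /\ y^-1 \in Oint.
Proof.
have [w [Ow w0 Ow' Opw] wP] := uniformizer.
move=> y1.
have wy1 : (y - 1) / w \in Oint.
  have -> : (y - 1) / w = (y - 1) / p%:R ^+ 1 * (p%:R / w).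
    by rewrite expr1 mulrA divfK // p_neq0.
  by apply: rpredM.
have key : y / w \notin Oint.
  apply: contra Ow' => Oyw; rewrite -[w^-1]mul1r.
  have -> : 1 / w = y / w - (y - 1) / w by rewrite -mulrBl subKr.
  exact: rpredB.
have y0 : y != 0 by apply: contraNneq key => ->; rewrite mul0r rpred0.
split=> //; have [[[|n]|n] [u [Ou Ou' yE]]] := wP _ y0.
- by rewrite yE mul1r.
- case/negP: key; rewrite yE -exprnP exprSr mulrAC mulfK //.
  by rewrite rpredM ?rpredX.
- by rewrite yE NegzE -exprnN invfM invrK rpredM ?rpredX.
Qed.

Lemma inv_Oint_coprime n : coprime p n -> n%:R != 0 :> E /\ n%:R^-1 \in Oint.
Proof.
move=> co_pn.
have n_gt0 : (0 < n)%N.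
  by case: n co_pn => //; rewrite /coprime gcdn0 => /eqP p1;
    have := prime_gt1 p_prime; rewrite p1.
have n0 : n%:R != 0 :> E by exact: pnat_neq0.
split=> //; have [u v uE _] := egcdnP p n_gt0.
rewrite gcdnC (eqP co_pn) in uE.
have /inv_Oint_1Dp[un0 Oun] : (u * n)%:R - 1 \in pideal 1.
  rewrite uE natrD addrK natrM mulrC -{1}[p%:R]expr1; apply: pideal_pXM;
    exact: rpred_nat.
have -> : n%:R^-1 = u%:R * (u * n)%:R^-1 :> E.
  rewrite natrM invfM mulrA divff ?mul1r //.
  by apply: contraNneq un0 => u0; rewrite natrM u0 mul0r.
by rewrite rpredM ?rpred_nat.
Qed.

Definition pconv (u : nat -> E) l :=
  forall e, exists K, forall i, (K <= i)%N -> u i - l \in pideal e.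

Lemma pconv_unique u l l' : pconv u l -> pconv u l' -> l = l'.
Proof.
move=> ul ul'; apply/eqP; rewrite -subr_eq0; apply/eqP/pideal_separated => e.
have [K1 h1] := ul e; have [K2 h2] := ul' e.
have -> : l - l' = (u (maxn K1 K2) - l') - (u (maxn K1 K2) - l).
  by rewrite opprB [RHS]addrC addrA subrK.
by apply: rpredB; [apply: h2|apply: h1]; rewrite ?leq_maxl ?leq_maxr.
Qed.

Lemma pconvD u v l l' : pconv u l -> pconv v l' ->
  pconv (fun i => u i + v i) (l + l').
Proof.
move=> ul vl e; have [K1 h1] := ul e; have [K2 h2] := vl e.
exists (maxn K1 K2) => i; rewrite geq_max => /andP[/h1 ? /h2 ?].
by rewrite opprD addrACA rpredD.
Qed.

Lemma pconv_cst l : pconv (fun=> l) l.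
Proof. by move=> e; exists 0%N => i _; rewrite subrr rpred0. Qed.

Lemma pconv_sum (I : Type) (s : seq I) (u : I -> nat -> E) l :
  (forall i, pconv (u i) (l i)) ->
  pconv (fun n => \sum_(i <- s) u i n) (\sum_(i <- s) l i).
Proof.
move=> ul; elim: s => [|i s IHs].
  move=> e; exists 0%N => n _; rewrite !big_nil subrr; exact: rpred0.
by move=> e; have [K h] := pconvD (ul i) IHs e; exists K => n /h; rewrite !big_cons.
Qed.

(** The factor c need not be integral: its denominator p^r is paid for by r more digits of u. *)
Lemma pconvZ u l c : pconv u l -> pconv (fun i => c * u i) (c * l).
Proof.
move=> ul e; have [r Or] := pX_mul_Oint c; have [K h] := ul (r + e)%N.
exists K => i /h; rewrite -mulrBr => hi; rewrite -(@pideal_shift r).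
by rewrite mulrA; exact: pidealMl.
Qed.

Lemma pconv_eq u v l : u =1 v -> pconv u l -> pconv v l.
Proof. by move=> /funext ->. Qed.

Lemma pconv_Oint u l : pconv u l -> (forall i, u i \in Oint) -> l \in Oint.
Proof.
move=> ul Ou; have [K /(_ K (leqnn K)) /pideal_Oint h] := ul 0%N.
by rewrite -(subKr (u K) l); exact: rpredB.
Qed.

Lemma pconv_pideal u l e K : pconv u l ->
  (forall i, (K <= i)%N -> u i \in pideal e) -> l \in pideal e.
Proof.
move=> ul Ou; have [K' h] := ul e.
have -> : l = u (maxn K K') - (u (maxn K K') - l) by rewrite subKr.
by rewrite rpredB ?h ?Ou ?leq_maxl ?leq_maxr.
Qed.

(** By the ultrametric inequality, consecutive differences control all differences. *)
Lemma pcauchy u :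
  (forall e, exists K, forall i, (K <= i)%N -> u i.+1 - u i \in pideal e) ->
  exists l, pconv u l.
Proof.
move=> uP; have [|l lP] := @lf_complete _ E u.
  move=> e; have [K h] := uP e; exists K => i j Ki Kj; apply/pidealE.
  have hK n : (K <= n)%N -> u n - u K \in pideal e.
    move=> /subnKC <-; elim: (n - K)%N => [|d IHd].
      by rewrite addn0 subrr rpred0.
    rewrite addnS -(subrK (u (K + d)%N) (u _.+1)) -addrA rpredD //.
    by apply: h; rewrite leq_addr.
  have -> : u i - u j = (u i - u K) - (u j - u K) by rewrite opprB addrA subrK.
    by rewrite rpredB ?hK.
by exists l => e; have [K h] := lP e; exists K => i /h/pidealE.
Qed.

Lemma pconv_series u : (forall e, exists K, forall i, (K <= i)%N -> u i \in pideal e) ->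
  exists l, pconv (fun n => \sum_(i < n) u i) l.
Proof.
move=> uP; apply: pcauchy => e; have [K h] := uP e; exists K => i Ki.
by rewrite big_ord_recr /= addrAC subrr add0r h.
Qed.

End LocalFieldArithmetic.

Arguments Oint {p} E.
Arguments pideal {p} E e.
Arguments pconv {p E} u l.

(** * Substitution in power series *)

Section FpsComposition.
Variable E : fieldType.
Implicit Types (F G H : fps E) (c : E).

Lemma fpsD F G n : (F + G) n = F n + G n. Proof. by []. Qed.
Lemma fpsN F n : (- F) n = - F n. Proof. by []. Qed.
Lemma fpsB F G n : (F - G) n = F n - G n. Proof. by []. Qed.
Lemma fps0 n : (0 : fps E) n = 0. Proof. by []. Qed.
Lemma fps1 n : (1 : fps E) n = (n == 0%N)%:R. Proof. by []. Qed.
Lemma fpsM F G n : (F * G) n = \sum_(i < n.+1) F i * G (n - i)%N.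
Proof. by []. Qed.

Lemma fps_sum (I : Type) (s : seq I) (P : pred I) (F : I -> fps E) n :
  (\sum_(i <- s | P i) F i) n = \sum_(i <- s | P i) F i n.
Proof. exact: (big_morph (fun G : fps E => G n)). Qed.

Lemma fps_constM c F n : (fps_const c * F) n = c * F n.
Proof.
rewrite fpsM big_ord_recl subn0 big1 ?addr0 // => i _.
by rewrite /fps_const /= mul0r.
Qed.

Lemma fps_const1 : fps_const 1 = 1 :> fps E.
Proof. by apply/funext => -[]. Qed.

Lemma fps_natE m n : (m%:R : fps E) n = if n == 0%N then m%:R else 0.
Proof.
elim: m => [|m IHm]; first by case: n.
rewrite [m.+1%:R in LHS]mulrS fpsD IHm fps1.
by case: n {IHm} => [|n] /=; rewrite ?addr0 // -mulrS.
Qed.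

Lemma fps_natM m F n : (m%:R * F) n = m%:R * F n.
Proof.
have -> : m%:R = fps_const m%:R :> fps E.
  by apply/funext => i; rewrite fps_natE.
exact: fps_constM.
Qed.

Lemma fps_piM F n : (fps_pi * F) n = if n is n'.+1 then F n' else 0.
Proof.
rewrite fpsM; case: n => [|n].
  by rewrite big_ord_recl big_ord0 /fps_pi /= mul0r addr0.
rewrite !big_ord_recl /fps_pi /= mul0r add0r mul1r subSS subn0 big1 ?addr0 //.
by move=> i _; rewrite mul0r.
Qed.

Lemma fps_piXM m F n : (fps_pi ^+ m * F) n = if (n < m)%N then 0 else F (n - m)%N.
Proof.
elim: m n => [|m IHm] [|n]; rewrite ?mul1r ?subn0 // exprS -mulrA fps_piM //.
Qed.

Lemma fps_piX m n : (fps_pi ^+ m : fps E) n = (n == m)%:R.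
Proof.
rewrite -[_ ^+ m]mulr1 fps_piXM fps1 subn_eq0.
by case: ltngtP.
Qed.

Lemma fps_split F : F = fps_const (F 0%N) + fps_pi * (fun n => F n.+1).
Proof.
by apply/funext => -[|n]; rewrite fpsD fps_piM /fps_const /= ?addr0 ?add0r.
Qed.

Lemma fpsX_low G : G 0%N = 0 -> forall m n, (n < m)%N -> (G ^+ m) n = 0.
Proof.
move=> G0; elim=> // m IHm n ltnm; rewrite exprS fpsM big1 // => -[[|i] lti] _.
  by rewrite G0 mul0r.
by rewrite IHm ?mulr0 //=; lia.
Qed.

Definition eq_upto K F G := forall n, (n < K)%N -> F n = G n.

Lemma eq_uptoP F G : (forall K, eq_upto K F G) -> F = G.
Proof. by move=> eqFG; apply/funext => n; exact: (eqFG n.+1). Qed.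

(** A factor without constant term gains one coefficient of precision; this is the inductive step
    for the identities on substitution. *)
Lemma eq_upto_mulS K F G H : H 0%N = 0 -> eq_upto K F G ->
  eq_upto K.+1 (H * F) (H * G).
Proof.
move=> H0 eqFG n ltn; rewrite !fpsM; apply: eq_bigr => -[[|i] lti] _ /=.
  by rewrite H0 !mul0r.
by rewrite eqFG //; lia.
Qed.

(** Powers G^m with m > n do not reach coefficient n, so one range K serves all coefficients below K
    and sums may be exchanged. *)
Lemma fps_compE K F G n : G 0%N = 0 -> (n < K)%N ->
  fps_comp F G n = \sum_(m < K) F m * (G ^+ m) n.
Proof.
move=> G0 ltnK; rewrite /fps_comp (big_ord_widen _ (fun m => F m * (G ^+ m) n) ltnK).
rewrite [RHS](bigID (fun m : 'I_K => m < n.+1)%N) /= [X in _ + X]big1 ?addr0 //.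
by move=> m; rewrite -leqNgt => ltnm; rewrite fpsX_low ?mulr0.
Qed.

Lemma fps_compD F F' G : fps_comp (F + F') G = fps_comp F G + fps_comp F' G.
Proof.
apply/funext => n; rewrite fpsD -big_split; apply: eq_bigr => m _.
by rewrite fpsD mulrDl.
Qed.

Lemma fps_compN F G : fps_comp (- F) G = - fps_comp F G.
Proof.
apply/funext => n; rewrite fpsN -sumrN; apply: eq_bigr => m _.
by rewrite fpsN mulNr.
Qed.

Lemma fps_comp_const c G : fps_comp (fps_const c) G = fps_const c.
Proof.
apply/funext => n; rewrite /fps_comp big_ord_recl big1 => [|i _].
  by rewrite expr0 fps1 /fps_const /=; case: n => [|n]; rewrite ?mulr1 ?mulr0 addr0.
by rewrite /fps_const mul0r.
Qed.

Lemma fps_comp_constM c F G :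
  fps_comp (fps_const c * F) G = fps_const c * fps_comp F G.
Proof.
apply/funext => n; rewrite fps_constM big_distrr /=; apply: eq_bigr => m _.
by rewrite fps_constM mulrA.
Qed.

Lemma fps_comp_piM F G : G 0%N = 0 ->
  fps_comp (fps_pi * F) G = G * fps_comp F G.
Proof.
move=> G0; apply/funext => n.
rewrite (@fps_compE n.+2) // big_ord_recl fps_piM mul0r add0r fpsM.
under [RHS]eq_bigr => i _.
  rewrite (@fps_compE n.+1) ?ltnS ?leq_subr // big_distrr /=; over.
rewrite exchange_big; apply: eq_bigr => m _ /=.
rewrite fps_piM exprS fpsM big_distrr /=; apply: eq_bigr => i _.
by rewrite mulrCA.
Qed.

Lemma fps_comp_pi G : G 0%N = 0 -> fps_comp fps_pi G = G.
Proof.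
move=> G0; rewrite -[fps_pi]mulr1 fps_comp_piM // -fps_const1 fps_comp_const.
by rewrite fps_const1 mulr1.
Qed.

(* Peel off F = F(0) + pi F1 and induct on the precision. *)
Lemma fps_compM F F' G : G 0%N = 0 ->
  fps_comp (F * F') G = fps_comp F G * fps_comp F' G.
Proof.
move=> G0; apply: eq_uptoP => K; elim: K F => // K IHK F.
rewrite (fps_split F) mulrDl -mulrA !fps_compD !fps_comp_piM //.
rewrite fps_comp_constM fps_comp_const mulrDl => n ltn; rewrite !fpsD.
by congr (_ + _); rewrite -mulrA; apply: eq_upto_mulS ltn.
Qed.

Lemma fps_comp0 F G : G 0%N = 0 -> fps_comp F G 0%N = F 0%N.
Proof. by move=> G0; rewrite /fps_comp big_ord_recl big_ord0 expr0 fps1 mulr1 addr0.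
  Qed.

Lemma fps_compA F G H : G 0%N = 0 -> H 0%N = 0 ->
  fps_comp (fps_comp F G) H = fps_comp F (fps_comp G H).
Proof.
move=> G0 H0; have GH0 : fps_comp G H 0%N = 0 by rewrite fps_comp0.
apply: eq_uptoP => K; elim: K F => // K IHK F.
rewrite (fps_split F) !fps_compD !fps_comp_const !fps_comp_piM // fps_compM //.
by move=> n ltn; rewrite !fpsD; congr (_ + _); apply: eq_upto_mulS ltn.
Qed.

Lemma fps_1pi0 e : ((1 + fps_pi : fps E) ^+ e - 1) 0%N = 0.
Proof.
rewrite fpsB; elim: e => [|e IHe]; first by rewrite subrr.
by rewrite exprS mulrDl mul1r fpsD fps_piM addr0.
Qed.

(* [fps_sub p] is phi, and [fps_sub c] is the element of Gamma with cyclotomic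
   character c. *)
Definition fps_sub e F : fps E := fps_comp F ((1 + fps_pi) ^+ e - 1).

Fact fps_sub_zmod_morphism e : zmod_morphism (fps_sub e).
Proof. by move=> F G; rewrite /fps_sub fps_compD fps_compN. Qed.
Fact fps_sub_monoid_morphism e : monoid_morphism (fps_sub e).
Proof.
split=> [|F G]; first by rewrite /fps_sub -fps_const1 fps_comp_const.
by rewrite /fps_sub fps_compM // fps_1pi0.
Qed.
HB.instance Definition _ e := GRing.isZmodMorphism.Build (fps E) (fps E)
  (fps_sub e) (fps_sub_zmod_morphism e).
HB.instance Definition _ e := GRing.isMonoidMorphism.Build (fps E) (fps E)
  (fps_sub e) (fps_sub_monoid_morphism e).

Lemma fps_sub_const e c : fps_sub e (fps_const c) = fps_const c.
Proof. exact: fps_comp_const. Qed.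

Lemma fps_sub_pi e : fps_sub e fps_pi = (1 + fps_pi) ^+ e - 1.
Proof. exact/fps_comp_pi/fps_1pi0. Qed.

Lemma fps_sub_1pi e : fps_sub e (1 + fps_pi) = (1 + fps_pi) ^+ e.
Proof. by rewrite rmorphD rmorph1 /= fps_sub_pi addrC subrK. Qed.

Lemma fps_sub_comp d e F : fps_sub d (fps_sub e F) = fps_sub (d * e) F.
Proof.
rewrite /fps_sub fps_compA ?fps_1pi0 //; congr fps_comp.
by rewrite -/(fps_sub d _) rmorphB rmorphXn rmorph1 /= fps_sub_1pi exprM.
Qed.

Lemma fps_sub1 F : fps_sub 1 F = F.
Proof.
apply/funext => n; rewrite /fps_sub expr1 addrC addKr.
rewrite /fps_comp (bigD1 (@ord_max n)) //= fps_piX eqxx mulr1 big1 ?addr0 //.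
move=> i ne_in; rewrite fps_piX; case: eqP => [nE|]; last by rewrite mulr0.
by case/eqP: ne_in; apply/val_inj.
Qed.

Lemma fps_1piX e n : ((1 + fps_pi : fps E) ^+ e) n = 'C(e, n)%:R.
Proof.
elim: e n => [|e IHe] n; first by rewrite expr0 fps1 bin0n.
rewrite exprS mulrDl mul1r fpsD fps_piM IHe.
by case: n => [|n]; rewrite ?bin0 ?addr0 // IHe binS natrD.
Qed.

Lemma fps_phiE p : @fps_phi E p = fps_sub p. Proof. by []. Qed.

Hypothesis char0 : forall n, (n.+1)%:R != 0 :> E.

Lemma natr_ffact m n : (m ^_ n)%:R = \prod_(i < n) (m%:R - i%:R) :> E.
Proof.
elim: n => [|n IHn]; first by rewrite ffactn0 big_ord0.
rewrite ffactnSr natrM IHn big_ord_recr /=; have [le_nm|lt_mn] := leqP n m.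
  by rewrite natrB.
by rewrite -IHn ffact_small ?mul0r.
Qed.

Lemma fps_binom_nat m : fps_binom m%:R = (1 + fps_pi) ^+ m :> fps E.
Proof.
apply/funext => n; rewrite fps_1piX /fps_binom -natr_ffact -bin_ffact natrM mulfK //.
by case: (n`!) (fact_gt0 n).
Qed.

(** [Lambda_act] involves only natural representatives of Gamma, so binomial series can be replaced
    by powers of 1 + pi. *)
Lemma fps_gamma_nat m : fps_gamma (m%:R : E) = fps_sub m.
Proof. by apply/funext => F; rewrite /fps_gamma fps_binom_nat. Qed.

(* The linear coefficient of (1 + pi)^e - 1 is e, hence its powers are triangular. *)
Lemma fps_sub_inj e : (0 < e)%N -> injective (fps_sub e).
Proof.
move=> e_gt0; apply: raddf_inj => F F0; apply/funext => n; rewrite fps0.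
elim/ltn_ind: n => n IHn.
have := congr1 (fun G : fps E => G n) F0; rewrite /= fps0 /fps_sub /fps_comp.
rewrite big_ord_recr big1 /= => [|i _]; last by rewrite IHn ?mul0r.
rewrite add0r => /eqP; rewrite mulf_eq0 => /orP[/eqP //|].
have pE : (1 + fps_pi : fps E) ^+ e - 1 =
    fps_pi * (fun n => ((1 + fps_pi : fps E) ^+ e - 1) n.+1).
  rewrite {1}[LHS]fps_split fps_1pi0.
  have -> : fps_const 0 = 0 :> fps E by apply/funext => -[].
  by rewrite add0r.
rewrite pE exprMn fps_piXM ltnn subnn.
have X0 G m : (G ^+ m : fps E) 0%N = G 0%N ^+ m.
  elim: m => // m IHm; rewrite !exprS fpsM big_ord_recl big_ord0 addr0.
  by rewrite subnn IHm.
rewrite X0 fpsB fps_1piX bin1 fps1 subr0 expf_eq0 => /andP[_].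
by rewrite -(prednK e_gt0) (negPf (char0 _)).
Qed.

End FpsComposition.

(** * Finite differences *)

Section FiniteDifferences.
Variable V : zmodType.
Implicit Types (f g : nat -> V).

Definition fdiff f : nat -> V := fun z => f z.+1 - f z.

(** Polynomial functions of degree at most d, in a form that makes sense in any abelian group: the
    d-th difference is constant. *)
Fixpoint fdeg d f : Prop :=
  if d is d'.+1 then fdeg d' (fdiff f) else forall z, f z = f 0%N.

Lemma fdiff_iterD n f g z : iter n fdiff (fun x => f x + g x) z =
  iter n fdiff f z + iter n fdiff g z.
Proof.
elim: n f g => // n IHn f g; rewrite !iterSr -IHn; congr (iter _ _ _ z).
by apply/funext => x; rewrite /fdiff opprD addrACA.
Qed.

(** Newton's interpolation formula; Pascal's rule combines the expansions of f and of its
    difference. *)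
Lemma newton_sum f K z : (z < K)%N ->
  f z = \sum_(j < K) iter j fdiff f 0%N *+ 'C(z, j).
Proof.
elim: K z f => // K IHK [|z] f ltzK.
  by rewrite big_ord_recl /= bin0 mulr1n big1 ?addr0.
have -> : f z.+1 = f z + fdiff f z by rewrite /fdiff addrC subrK.
have [ltz|lez] := ltnP z K; last by rewrite ltnS ltnNge lez in ltzK.
rewrite (IHK _ f) // (IHK _ (fdiff f)) //.
case: K {IHK ltzK} ltz => // K ltz.
rewrite big_ord_recl [in RHS]big_ord_recl !bin0 -addrA; congr (_ + _).
under [RHS]eq_bigr do rewrite binS mulrnDr.
rewrite [RHS]big_split /=; congr (_ + _); last first.
  by apply: eq_bigr => i _; rewrite -iterSr.
by rewrite [RHS]big_ord_recr /= bin_small ?mulr0n ?addr0.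
Qed.

Lemma fdeg_iter d f n z : fdeg d f -> (d < n)%N -> iter n fdiff f z = 0.
Proof.
elim: d f n => [|d IHd] f [|n] // fd ltdn; rewrite iterSr; last exact: IHd.
rewrite (_ : fdiff f = fun=> 0); last first.
  by apply/funext => x; rewrite /fdiff !fd subrr.
by elim: n z {ltdn} => // n IHn z; rewrite /= {1}/fdiff !IHn subrr.
Qed.

Lemma newton_fdeg d f z : fdeg d f ->
  f z = \sum_(j < d.+1) iter j fdiff f 0%N *+ 'C(z, j).
Proof.
move=> fd; rewrite (@newton_sum f (maxn d z).+1) ?ltnS ?leq_maxr //.
have le_d : (d.+1 <= (maxn d z).+1)%N by rewrite ltnS leq_maxl.
rewrite [RHS](big_ord_widen _ (fun j => iter j fdiff f 0%N *+ 'C(z, j)) le_d).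
rewrite [LHS](bigID (fun j : 'I_ _ => j < d.+1)%N) /= [X in _ + X]big1 ?addr0 //.
by move=> j; rewrite -leqNgt => ltdj; rewrite (fdeg_iter 0 fd) ?mul0rn.
Qed.

Lemma fdegS d f : fdeg d f -> fdeg d.+1 f.
Proof.
elim: d f => [|d IHd] f fd; last exact: IHd.
by move=> z; rewrite /fdiff !fd !subrr.
Qed.

Lemma fdegW d e f : (d <= e)%N -> fdeg d f -> fdeg e f.
Proof.
move=> /subnKC <-; elim: (e - d)%N => [|n IHn] fd; first by rewrite addn0.
by rewrite addnS; apply/fdegS/IHn.
Qed.

Lemma fdegD d f g : fdeg d f -> fdeg d g -> fdeg d (fun z => f z + g z).
Proof.
elim: d f g => [|d IHd] f g fd gd; first by move=> z /=; rewrite fd gd.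
rewrite /= (_ : fdiff _ = fun z => fdiff f z + fdiff g z); first exact: IHd.
by apply/funext => x; rewrite /fdiff opprD addrACA.
Qed.

Lemma fdeg0 d : fdeg d (fun=> 0).
Proof. by apply: (@fdegW 0). Qed.

Lemma fdegN d f : fdeg d f -> fdeg d (fun z => - f z).
Proof.
elim: d f => [|d IHd] f fd; first by move=> z /=; rewrite fd.
rewrite /= (_ : fdiff _ = fun z => - fdiff f z); first exact: IHd.
by apply/funext => x; rewrite /fdiff opprD.
Qed.

Lemma fdeg_sum d (I : Type) (s : seq I) (F : I -> nat -> V) :
  (forall i, fdeg d (F i)) -> fdeg d (fun z => \sum_(i <- s) F i z).
Proof.
move=> Fd; elim: s => [|i s IHs].
  rewrite (_ : (fun _ => _) = fun=> 0); first exact: fdeg0.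
  by apply/funext => z; rewrite big_nil.
rewrite (_ : (fun _ => _) = fun z => F i z + \sum_(j <- s) F j z).
  exact: fdegD.
by apply/funext => z; rewrite big_cons.
Qed.

Lemma fdeg_shift d f : fdeg d f -> fdeg d (fun z => f z.+1).
Proof.
elim: d f => [|d IHd] f fd; first by move=> z; rewrite fd [RHS]fd.
exact: (IHd (fdiff f)).
Qed.

(** Along an orbit of an additive map L, the difference operator acts as L - 1. *)
Lemma fdiff_iter_orbit (L : V -> V) (w : nat -> V) :
  {morph L : x y / x - y} -> (forall i, w i.+1 = L (w i)) ->
  forall n i, iter n fdiff w i = iter n (fun x => L x - x) (w i).
Proof.
move=> LB wS.
set D := fun x => L x - x.
have iterDB n : {morph iter n D : x y / x - y}.
  elim: n => // n IHn x y.
  by rewrite !iterS IHn /D LB !opprD addrACA.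
elim=> // n IHn i; by rewrite [RHS]iterSr /= {1}/fdiff !IHn wS -iterDB.
Qed.

End FiniteDifferences.

Arguments fdiff {V}.

Lemma fdiff_iter_comp (U V : zmodType) (h : U -> V) (f : nat -> U) n z :
  {morph h : x y / x - y} ->
  iter n fdiff (fun x => h (f x)) z = h (iter n fdiff f z).
Proof.
move=> hB; elim: n f => // n IHn f; rewrite !iterSr -IHn.
by congr (iter _ _ _ z); apply/funext => x; rewrite /fdiff hB.
Qed.

(** Induction on d + e through the discrete Leibniz rule, in which g is shifted by one next to the
    difference of f. *)
Lemma fdegM (R : pzRingType) d e (f g : nat -> R) :
  fdeg d f -> fdeg e g -> fdeg (d + e) (fun z => f z * g z).
Proof.
have cstl d' c h : @fdeg R d' h -> fdeg d' (fun z => c * h z).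
  elim: d' h => [|d' IH] h hd; first by move=> z; rewrite hd.
  rewrite /= (_ : fdiff _ = fun z => c * fdiff h z); first exact: IH.
  by apply/funext => x; rewrite /fdiff mulrBr.
have cstr d' c h : @fdeg R d' h -> fdeg d' (fun z => h z * c).
  elim: d' h => [|d' IH] h hd; first by move=> z; rewrite hd.
  rewrite /= (_ : fdiff _ = fun z => fdiff h z * c); first exact: IH.
  by apply/funext => x; rewrite /fdiff mulrBl.
elim: (d + e)%N {-2}d {-2}e f g (erefl (d + e)%N) => {d e} [|n IHn] d e f g.
  move=> /eqP; rewrite addn_eq0 => /andP[/eqP-> /eqP->] fd gd z.
  by rewrite fd gd.
case: d => [|d].
  rewrite add0n => -> fd gd; rewrite (_ : (fun _ => _) = fun z => f 0%N * g z).
    exact: cstl.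
  by apply/funext => z; rewrite fd.
case: e => [|e].
  rewrite addn0 => -> fd gd; rewrite (_ : (fun _ => _) = fun z => f z * g 0%N).
    exact: cstr.
  by apply/funext => z; rewrite gd.
rewrite addSn => -[nE] fd gd /=.
rewrite (_ : fdiff _ = fun z => fdiff f z * g z.+1 + f z * fdiff g z).
  apply: fdegD; first by apply: IHn => //; exact: fdeg_shift.
  by rewrite -addSnnS; apply: IHn; rewrite // addSnnS.
by apply/funext => z; rewrite /fdiff mulrBl mulrBr addrA subrK.
Qed.

(** By Vandermonde, passing from z to z + 1 adds terms C(b, j+1) C(a + bz, t - j - 1), which have
    smaller degree in z. *)
Lemma fdeg_bin (R : pzRingType) a b t :
  fdeg t (fun z => 'C(a + b * z, t)%:R : R).
Proof.
elim/ltn_ind: t a => -[|t] IHt a; first by move=> z; rewrite !bin0.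
rewrite /= (_ : fdiff _ = fun z =>
    \sum_(j < t.+1) 'C(b, j.+1)%:R * 'C(a + b * z, t - j)%:R).
  apply: fdeg_sum => j; apply: (@fdegW _ (0 + (t - j))); first by rewrite leq_subr.
  apply: (@fdegM _ 0 (t - j) (fun=> _)) => //.
  by apply: IHt; rewrite ltnS leq_subr.
apply/funext => z; rewrite /fdiff mulnS addnCA -binomial.Vandermonde.
rewrite big_ord_recl bin0 mul1n subn0 natrD addrC addKr natr_sum.
by apply: eq_bigr => j _; rewrite natrM subSS.
Qed.

Lemma fdiff_iter_sum (V : zmodType) (I : Type) (s : seq I) (F : I -> nat -> V) n z :
  iter n fdiff (fun x => \sum_(i <- s) F i x) z =
  \sum_(i <- s) iter n fdiff (F i) z.
Proof.
elim: s => [|i s IHs].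
  rewrite big_nil (_ : (fun _ => _) = fun=> 0).
    elim: n z => // n IHn z; rewrite /= {1}/fdiff !IHn; exact: subrr.
  by apply/funext => x; rewrite big_nil.
rewrite big_cons -IHs -fdiff_iterD; congr (iter _ _ _ z).
by apply/funext => x; rewrite big_cons.
Qed.

(** * The ideals (p, pi^m) *)

Section IntegralSeries.
Variables (p : nat) (E : localField p).
Implicit Types (F G : fps E) (m t : nat).

Definition Apl : {pred fps E} := fun F => `[< Aplus F >].

Lemma AplP F : reflect (forall n, F n \in Oint E) (F \in Apl).
Proof.
by apply: (iffP (asboolP _)) => AF n; apply/OintE/AF.
Qed.

Lemma AplE F : (F \in Apl) <-> Aplus F.
Proof. by split=> /asboolP. Qed.

Fact Apl_subring_closed : subring_closed Apl.
Proof.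
split=> [|F G /AplP AF /AplP AG|F G /AplP AF /AplP AG]; apply/AplP => n.
- by rewrite fps1 rpred_nat.
- by rewrite fpsB rpredB.
- by rewrite fpsM rpred_sum // => i _; rewrite rpredM.
Qed.
HB.instance Definition _ := GRing.isSubringClosed.Build (fps E) Apl
  Apl_subring_closed.

Lemma Apl_pi : fps_pi \in Apl.
Proof. by apply/AplP => n; rewrite rpred_nat. Qed.

Lemma Apl_const c : c \in Oint E -> fps_const c \in Apl.
Proof. by move=> Oc; apply/AplP => -[|n]; rewrite /fps_const ?rpred0. Qed.

Lemma Apl_sub e F : F \in Apl -> fps_sub e F \in Apl.
Proof.
move=> /AplP AF; apply/AplP => n; rewrite rpred_sum // => i _; rewrite rpredM //.
apply: (AplP _ _); rewrite rpredX // rpredB ?rpredX ?rpredD ?rpred1 //; exact: Apl_pi.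
Qed.

Lemma Apl_1pi : 1 + fps_pi \in Apl.
Proof. by rewrite rpredD ?rpred1 //; exact: Apl_pi. Qed.

Definition ppideal m : {pred fps E} :=
  fun F => `[< F \in Apl /\ forall t, (t < m)%N -> F t \in pideal E 1 >].

Lemma ppidealP m F :
  reflect (F \in Apl /\ forall t, (t < m)%N -> F t \in pideal E 1)
          (F \in ppideal m).
Proof. exact: asboolP. Qed.

Fact ppideal_zmod_closed m : zmod_closed (ppideal m).
Proof.
split=> [|F G /ppidealP[AF hF] /ppidealP[AG hG]]; apply/ppidealP.
  by split=> [|t _]; rewrite rpred0.
split=> [|t ltm]; first exact: rpredB.
by rewrite fpsB rpredB ?hF ?hG.
Qed.
HB.instance Definition _ m := GRing.isZmodClosed.Build (fps E) (ppideal m)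
  (ppideal_zmod_closed m).

Lemma ppidealW m m' F : (m <= m')%N -> F \in ppideal m' -> F \in ppideal m.
Proof.
move=> le_m /ppidealP[AF hF]; apply/ppidealP; split=> // t ltm.
by rewrite hF // (leq_trans ltm).
Qed.

Lemma ppideal0 F : F \in Apl -> F \in ppideal 0.
Proof. by move=> AF; apply/ppidealP. Qed.

Lemma ppideal_piX m : fps_pi ^+ m \in ppideal m.
Proof.
apply/ppidealP; split=> [|t ltm]; first by rewrite rpredX //; exact: Apl_pi.
by rewrite fps_piX ltn_eqF // rpred0.
Qed.

Hypothesis p_prime : prime p.

Lemma ppidealM m k F G : F \in ppideal m -> G \in ppideal k ->
  F * G \in ppideal (m + k).
Proof.
move=> /ppidealP[AF hF] /ppidealP[AG hG]; apply/ppidealP; split=> [|t ltt].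
  by rewrite rpredM.
rewrite fpsM rpred_sum // => i _; have [ltim|leim] := ltnP i m.
  by apply: pidealMr; rewrite ?hF //; apply: (AplP _ AG).
apply: pidealMl; first by apply: (AplP _ AF).
by apply: hG; have := ltn_ord i; lia.
Qed.

Lemma ppidealMl m F G : F \in Apl -> G \in ppideal m -> F * G \in ppideal m.
Proof. by move=> /ppideal0/ppidealM/[apply]. Qed.

(** The middle binomial coefficients are divisible by p. As m is arbitrary, this is a congruence
    modulo p. *)
Lemma ppideal_1piX_prime m :
  (1 + fps_pi) ^+ p - 1 - fps_pi ^+ p \in ppideal m.
Proof.
apply/ppidealP; split=> [|t _].
  by rewrite !rpredB ?rpredX ?rpred1 ?Apl_1pi ?Apl_pi.
rewrite !fpsB fps_1piX fps1 fps_piX.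
case: t => [|t]; first by rewrite bin0 subrr sub0r ltn_eqF ?prime_gt0 // oppr0 rpred0.
rewrite subr0; have [ltp|ltp|pE] := ltngtP t.+1 p.
- rewrite subr0; have /dvdnP[q ->] := prime_dvd_bin p_prime (ltp : 0 < t.+1 < p)%N.
  by rewrite natrM mulrC -{1}[p%:R]expr1 pideal_pXM ?rpred_nat.
- by rewrite bin_small // subrr rpred0.
- by rewrite pE binn subrr rpred0.
Qed.

Lemma ppideal_1piX a : (1 + fps_pi) ^+ a - 1 - a%:R * fps_pi \in ppideal 2.
Proof.
apply/ppidealP; split=> [|t].
  by rewrite !rpredB ?rpredX ?rpred1 ?Apl_1pi ?rpredM ?rpred_nat ?Apl_pi.
rewrite !fpsB fps_1piX fps1 fps_natM -[fps_pi]expr1 fps_piX.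
case: t => [|[|t]] // _; first by rewrite bin0 subrr mulr0 subrr rpred0.
by rewrite bin1 subr0 mulr1 subrr rpred0.
Qed.

Hypothesis p_odd : odd p.

Let p_ge3 : (3 <= p)%N.
Proof. exact: odd_prime_gt2. Qed.

(** For gamma = 1 + p, gamma(pi) - pi = (1 + pi)((1 + pi)^p - 1) is (1 + pi) pi^p modulo p, and p >=
    3. *)
Lemma ppideal_sub_pi : fps_sub p.+1 fps_pi - fps_pi \in ppideal 3.
Proof.
have -> : fps_sub p.+1 fps_pi - fps_pi =
    (1 + fps_pi) * (((1 + fps_pi) ^+ p - 1 - fps_pi ^+ p) + fps_pi ^+ p) :> fps E.
  by rewrite fps_sub_pi subrK mulrBr -exprS mulr1 opprD addrA.
apply: ppidealMl; first exact: Apl_1pi.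
rewrite rpredD //; first exact: ppideal_1piX_prime.
by apply: ppidealW (ppideal_piX p).
Qed.

Lemma ppideal_sub_piX j : fps_sub p.+1 fps_pi ^+ j - fps_pi ^+ j \in ppideal (j + 2).
Proof.
elim: j => [|j IHj]; first by rewrite subrr rpred0.
have -> : fps_sub p.+1 fps_pi ^+ j.+1 - fps_pi ^+ j.+1 =
    fps_pi * (fps_sub p.+1 fps_pi ^+ j - fps_pi ^+ j) +
    (fps_sub p.+1 fps_pi - fps_pi) * fps_sub p.+1 fps_pi ^+ j :> fps E.
  by rewrite !exprS mulrBr mulrBl [RHS]addrC addrA subrK.
apply: rpredD.
  have -> : (j.+1 + 2 = 1 + (j + 2))%N by lia.
  by apply: ppidealM IHj; exact: (ppideal_piX 1).
have -> : (j.+1 + 2 = 3 + j)%N by lia.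
apply: ppidealM; first exact: ppideal_sub_pi.
have -> : fps_sub p.+1 fps_pi ^+ j =
    (fps_sub p.+1 fps_pi ^+ j - fps_pi ^+ j) + fps_pi ^+ j :> fps E by rewrite subrK.
rewrite rpredD ?ppideal_piX //; apply: ppidealW IHj; exact: leq_addr.
Qed.

(** In F_j (gamma(pi)^j - pi^j), either j < m and F_j is divisible by p, or the second factor lies
    in (p, pi^(j+2)). So gamma - 1 raises the filtration by two. *)
Lemma ppideal_sub m F : F \in ppideal m -> fps_sub p.+1 F - F \in ppideal (m + 2).
Proof.
move=> /ppidealP[AF hF]; apply/ppidealP; split; first by rewrite rpredB ?Apl_sub.
(* Viewing F as [fps_sub 1 F] turns the difference into a single sum over the coefficients of F. *)
move=> t ltt; rewrite fpsB /fps_sub -(fps_sub1 F) {2}/fps_sub fps_sub1.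
rewrite /fps_comp -sumrB rpred_sum // => j _; rewrite -mulrBr.
have -> : ((1 + fps_pi) ^+ 1 - 1 : fps E) = fps_pi by rewrite expr1 addrC addKr.
rewrite -fps_sub_pi -fpsB; have /ppidealP[AX hX] := ppideal_sub_piX j.
have [ltj|lej] := ltnP j m.
  by apply: pidealMr; rewrite ?hF //; apply: (AplP _ AX).
by apply: pidealMl; [apply: (AplP _ AF)|apply: hX; lia].
Qed.

End IntegralSeries.

Arguments Apl {p} E.
Arguments ppideal {p} E m.

(** * The diagonal of the Newton expansion *)

Lemma eq_in (T : Type) (S : {pred T}) x y : x \in S -> x = y -> y \in S.
Proof. by move=> + <-. Qed.

Lemma fps_natXpi (F : fieldType) a t r :
  ((a%:R * fps_pi) ^+ t : fps F) r = (r == t)%:R * a%:R ^+ t.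
Proof.
transitivity (((a ^ t)%:R * fps_pi ^+ t : fps F) r).
  by rewrite exprMn natrX.
by rewrite fps_natM fps_piX natrX mulrC.
Qed.

Section NewtonDiagonal.
Variables (p : nat) (E : localField p).
Hypotheses (p_prime : prime p) (p_odd : odd p).

(** The operator L of the overview, on matrices of series. It is semilinear; additivity is what
    iterating L - 1 uses. *)
Definition twist d a (G W : 'M[fps E]_d) : 'M[fps E]_d :=
  (1 + fps_pi) ^+ a *: (G *m map_mx (fps_sub p.+1) W).

Lemma twistB d a (G : 'M[fps E]_d) : {morph twist a G : x y / x - y}.
Proof.
move=> x y; rewrite /twist -scalerBr -mulmxBr; congr (_ *: (_ *m _)).
by apply/matrixP => i j; rewrite !mxE rmorphB.
Qed.

(** Three errors separate L - 1 from multiplication by a pi: gamma - 1, G - 1, and (1 + pi)^a - 1 -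
    a pi. Each gains two powers of pi modulo p. *)
Lemma twist_step d a (G W : 'M[fps E]_d) m :
  (forall i j, (G - 1%:M) i j \in ppideal E 2) ->
  (forall i j, W i j \in ppideal E m) ->
  forall i j, (twist a G W - W - (a%:R * fps_pi) *: W) i j \in ppideal E (m + 2).
Proof.
move=> G1 WI i j.
set e := ((G - 1%:M) *m map_mx (fps_sub p.+1) W) i j.
have eI : e \in ppideal E (m + 2).
  rewrite /e mxE rpred_sum // => l _; rewrite addnC; apply: ppidealM => //.
  rewrite mxE -(subrK (W l j) (fps_sub _ _)) rpredD //.
  by apply: ppidealW (ppideal_sub _ _ _) => //; rewrite ?leq_addr.
have dI := ppideal_sub p_prime p_odd (WI i j).
have -> : (twist a G W - W - (a%:R * fps_pi) *: W) i j =
    (1 + fps_pi) ^+ a * ((fps_sub p.+1 (W i j) - W i j) + e) +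
    ((1 + fps_pi) ^+ a - 1 - a%:R * fps_pi) * W i j.
  rewrite /twist -[G in LHS](subrK 1%:M) mulmxDl mul1mx.
  have -> : ((1 + fps_pi) ^+ a *: ((G - 1%:M) *m map_mx (fps_sub p.+1) W +
      map_mx (fps_sub p.+1) W) - W - (a%:R * fps_pi) *: W) i j =
    (1 + fps_pi) ^+ a * (e + fps_sub p.+1 (W i j)) - W i j - a%:R * fps_pi * W i j.
    by rewrite /e !mxE.
  by ring.
rewrite rpredD //.
  by apply: ppidealMl; rewrite ?rpredX ?Apl_1pi // rpredD.
by rewrite addnC; apply: ppidealM => //; exact: ppideal_1piX.
Qed.

(** Each application of L - 1 multiplies the leading term by a pi, and the error of [twist_step]
    lies one power of pi further. *)
Lemma twist_iter d a (G W : 'M[fps E]_d) t :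
  (forall i j, (G - 1%:M) i j \in ppideal E 2) ->
  (forall i j, (W - 1%:M) i j \in ppideal E 1) ->
  forall i j, (iter t (fun x => twist a G x - x) W - ((a%:R * fps_pi) ^+ t)%:M) i j
    \in ppideal E t.+1.
Proof.
move=> G1 W1; elim: t => [|t IHt] i j; first by rewrite expr0.
set X := iter t _ W in IHt *.
have aXI n : (a%:R * fps_pi) ^+ n \in ppideal E n.
  by rewrite exprMn; apply: ppidealMl; rewrite ?rpredX ?rpred_nat ?ppideal_piX.
have XI i' j' : X i' j' \in ppideal E t.
  rewrite -(subrK (((a%:R * fps_pi) ^+ t)%:M i' j') (X i' j')) rpredD //.
    by have := IHt i' j'; rewrite !mxE; exact: ppidealW.
  by rewrite mxE; case: eqP => _; rewrite ?mulr1n ?mulr0n ?rpred0.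
rewrite iterS -/X.
have -> : (twist a G X - X - ((a%:R * fps_pi) ^+ t.+1)%:M) i j =
   (twist a G X - X - (a%:R * fps_pi) *: X) i j +
   (a%:R * fps_pi) * (X - ((a%:R * fps_pi) ^+ t)%:M) i j.
  rewrite !mxE exprS; case: eqP => _; rewrite ?mulr1n ?mulr0n; ring.
rewrite rpredD //.
  by apply: ppidealW (twist_step _ _ _ _ _) => //; lia.
by rewrite -add1n; apply: ppidealM => //; exact: (aXI 1%N).
Qed.

Variables (d a : nat) (G : 'M[fps E]_d) (V : nat -> 'M[fps E]_d).
Hypothesis a_coprime : coprime p a.
Hypothesis G_1 : forall i j, (G - 1%:M) i j \in ppideal E 2.
Hypothesis V_int : forall z i j, V z i j \in Apl E.
Hypothesis V0_1 : forall i j, (V 0 - 1%:M) i j \in ppideal E 1.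
Hypothesis V_deg : forall i j t, fdeg t (fun z => V z i j t).
Hypothesis V_twist : forall z, V (p.+1 * z + a)%N = twist a G (V z).

(** The (i, j) entry of the v_(m,t) of the overview, with the power of pi as first argument. *)
Definition newton_coef t m i j : E := iter m fdiff (fun z => V z i j t) 0%N.

Lemma fdiff_iter_Oint (f : nat -> E) m z :
  (forall x, f x \in Oint E) -> iter m fdiff f z \in Oint E.
Proof.
by move=> Of; elim: m z => [|m IHm] z //=; rewrite rpredB.
Qed.

Lemma newton_coef_Oint t m i j : newton_coef t m i j \in Oint E.
Proof. by apply: fdiff_iter_Oint => z; apply: (AplP _ (V_int z i j)). Qed.

Lemma newton_coefE z i j t :
  V z i j t = \sum_(m < t.+1) newton_coef t m i j * 'C(z, m)%:R.
Proof.
rewrite (newton_fdeg z (V_deg i j t)).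
by apply: eq_bigr => m _; rewrite mulr_natr.
Qed.

(* Compare the t-th differences at 0 of i |-> V (u i) and i |-> (1 + pi)^(u i) along
   u (i+1) = (p+1) u i + a: both are (a pi)^t modulo (p, pi^(t+1)). *)
Lemma newton_coef_diag t i j : newton_coef t t i j - (i == j)%:R \in pideal E 1.
Proof.
pose u n := iter n (fun z => p.+1 * z + a)%N 0%N.
have uS n : u n.+1 = (p.+1 * u n + a)%N by [].
pose f n := fun r => iter n fdiff (fun s => 'C(u s, r)%:R : E) 0%N.
have fI r : (r <= t)%N -> f t r - (r == t)%:R * a%:R ^+ t \in pideal E 1.
  (* The scalars (1 + pi)^(u s) form an orbit of the same operator with d = 1 and G = 1, so
     [twist_iter] covers them too. *)
  pose W s : 'M[fps E]_1 := ((1 + fps_pi) ^+ u s)%:M.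
  have WS s : W s.+1 = twist a 1%:M (W s).
    apply/matrixP => i' j'; rewrite /twist mul1mx !mxE !ord1 eqxx !mulr1n.
    by rewrite uS rmorphXn /= fps_sub_1pi exprD exprM mulrC.
  have := @twist_iter 1 a 1%:M (W 0%N) t _ _ ord0 ord0.
  rewrite -(fdiff_iter_orbit (@twistB _ _ _) WS) => /(_ _ _)/ppidealP[].
  - by move=> i' j'; rewrite subrr mxE rpred0.
  - by move=> i' j'; rewrite subrr mxE rpred0.
  move=> _ /(_ r); rewrite ltnS => h /h{}h; apply: (eq_in h).
  rewrite !mxE eqxx mulr1n fpsB fps_natXpi; congr (_ - _); rewrite /f.
  rewrite -(fdiff_iter_comp (h := fun X : 'M[fps E]_1 => X ord0 ord0 r)); last first.
    by move=> x y; rewrite !mxE.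
  congr (iter _ _ _ _); apply/funext => s.
  by rewrite mxE eqxx mulr1n fps_1piX.
have [a0 Oa'] := inv_Oint_coprime E p_prime a_coprime.
(* Since a is a unit at p, the common factor a^t can be removed. *)
suff: a%:R ^+ t * (newton_coef t t i j - (i == j)%:R) \in pideal E 1.
  move=> /(pidealMl (rpredX t Oa')); rewrite mulrA -exprMn mulVf //.
  by rewrite expr1n mul1r.
pose W s := V (u s).
have WS s : W s.+1 = twist a G (W s) by rewrite /W uS V_twist.
have h1 : iter t fdiff (fun s => W s i j t) 0%N - a%:R ^+ t * (i == j)%:R \in pideal
  E 1.
  have := @twist_iter d a G (W 0%N) t G_1 V0_1 i j.
  rewrite -(fdiff_iter_orbit (@twistB _ _ _) WS) => /ppidealP[_ /(_ t (ltnSn t)) h];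
    apply: (eq_in h).
  rewrite !mxE fpsB; congr (_ - _).
    rewrite -(fdiff_iter_comp (h := fun X : 'M[fps E]_d => X i j t)) //.
    by move=> x y; rewrite !mxE.
  case: eqP => _; rewrite ?mulr0n ?mulr0 // mulr1n.
  by rewrite fps_natXpi eqxx mul1r mulr1.
have h2 : iter t fdiff (fun s => W s i j t) 0%N =
    \sum_(m < t.+1) newton_coef t m i j * f t m.
  have -> : (fun s => W s i j t) =
      fun s => \sum_(m < t.+1) newton_coef t m i j * 'C(u s, m)%:R.
    by apply/funext => s; rewrite /W newton_coefE.
  rewrite fdiff_iter_sum; apply: eq_bigr => m _.
  by rewrite (fdiff_iter_comp (h := fun x => newton_coef t m i j * x)) //;
    exact: mulrBr.
(* The weights [f t m] vanish modulo p for m < t, so only the diagonal coefficient survives. *)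
have h3 : iter t fdiff (fun s => W s i j t) 0%N - a%:R ^+ t * newton_coef t t i j
    \in pideal E 1.
  have -> : a%:R ^+ t * newton_coef t t i j = \sum_(m < t.+1)
      newton_coef t m i j * ((m == t :> nat)%:R * a%:R ^+ t).
    rewrite big_ord_recr /= eqxx mul1r big1 ?add0r 1?mulrC // => m _.
    by rewrite ltn_eqF ?ltn_ord // mul0r mulr0.
  rewrite h2 -sumrB rpred_sum // => m _; rewrite -mulrBr.
  apply: pidealMl; first exact: newton_coef_Oint.
  by apply: fI; rewrite -ltnS ltn_ord.
by rewrite mulrBr; apply: (eq_in (rpredB h1 h3)); ring.
Qed.

End NewtonDiagonal.

(** * Measures on Z_p and their moments *)

Lemma big_ord_mul_split (V : nmodType) a b (f : nat -> V) :
  \sum_(x < b * a) f x = \sum_(z < a) \sum_(w < b) f (z + a * w)%N.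
Proof.
rewrite -(big_mkord xpredT f) big_nat_mul big_mkord exchange_big /=.
apply: eq_bigr => w _; rewrite -{1}[(w * a)%N]add0n big_addn mulSn addnK big_mkord.
by apply: eq_bigr => z _; rewrite mulnC.
Qed.

(** Differencing lowers the index of a binomial coefficient, so the j-th differences at 0 are dual
    to the functions C(-, m). *)
Lemma fdiff_iter_bin (R : pzRingType) j m :
  iter j fdiff (fun z => 'C(z, m)%:R : R) 0%N = (j == m)%:R.
Proof.
suff h i z : iter i fdiff (fun z => 'C(z, m)%:R : R) z =
    if (i <= m)%N then 'C(z, m - i)%:R else 0.
  by rewrite h bin0n subn_eq0; case: ltngtP.
elim: i z => [|i IHi] z; first by rewrite subn0.
rewrite /= {1}/fdiff !IHi; have [lt_im|le_mi] := ltnP i m.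
  by rewrite ltnW // -subSS subSn // binS natrD addrAC subrr add0r.
case: ltngtP le_mi => // [_|->] _; first exact: subrr.
by rewrite subnn !bin0 subrr.
Qed.

(** j C(p^n, j) is a multiple of p^n, so a binomial coefficient prime to p would force p^n to divide
    j. *)
Lemma prime_dvd_bin_pX p n j : prime p -> (0 < j < p ^ n)%N -> (p %| 'C(p ^ n, j))%N.
Proof.
move=> p_prime /andP[]; case: j => // j _ ltj.
apply: contraLR ltj => ndvd; rewrite -leqNgt dvdn_leq //.
have co : coprime (p ^ n) 'C(p ^ n, j.+1).
  by rewrite coprimeXl // prime_coprime.
by rewrite -(Gauss_dvdl _ co) -mul_bin_diag dvdn_mulr.
Qed.

Section Measures.
Variables (p : nat) (E : localField p).
Hypothesis p_prime : prime p.
Implicit Types (nu : nat -> nat -> E) (f l : nat -> E).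

Let pX_gt0 n : (0 < p ^ n)%N.
Proof. by rewrite expn_gt0 prime_gt0. Qed.

(** m! C(x, m) is a polynomial in x with integer coefficients, hence respects congruences; r is the
    loss from dividing by m!. *)
Lemma bin_pcontinuous m : exists r, forall n z w,
  'C(z + p ^ (n + r) * w, m)%:R - 'C(z, m)%:R \in pideal E n.
Proof.
have [r Or] := pX_mul_Oint p_prime ((m`!)%:R^-1 : E).
exists r => n z w.
have m0 : (m`!)%:R != 0 :> E by apply: pnat_neq0; exact: fact_gt0.
have binE x : 'C(x, m)%:R = (m`!)%:R^-1 * \prod_(i < m) (x%:R - i%:R) :> E.
  by rewrite -natr_ffact -bin_ffact natrM mulrC mulfK.
rewrite !binE -mulrBr -(@pideal_shift _ E p_prime r) mulrA.
apply: pidealMl => //.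
elim: m {m0 binE Or} => [|m IHm]; first by rewrite !big_ord0 subrr rpred0.
rewrite !big_ord_recr /=; set x := (_ + _)%N in IHm *.
set P := \prod_(_ < _) _ in IHm *; set Q := \prod_(_ < _) _ in IHm *.
have -> : P * (x%:R - m%:R) - Q * (z%:R - m%:R) =
   (P - Q) * (x%:R - m%:R) + Q * (x%:R - z%:R) by ring.
rewrite rpredD //; first by rewrite pidealMr // rpredB ?rpred_nat.
apply: pidealMl.
  by rewrite rpred_prod // => i _; rewrite rpredB ?rpred_nat.
have -> : x%:R - z%:R = (p ^ (n + r) * w)%:R :> E.
  by rewrite /x natrD [LHS]addrC addKr.
by rewrite addnC natrM natrX pideal_pXM ?rpred_nat.
Qed.

(* [nu n z] is the mass of z + p^n Z_p, meaningful for z < p^n only. *)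
Definition is_measure nu :=
  (forall n z, nu n z \in Oint E) /\
  (forall n z, (z < p ^ n)%N -> nu n z = \sum_(w < p) nu n.+1 (z + p ^ n * w)%N).

(* The Amice transform of the measure: its integrals against the functions C(-, m). *)
Definition moments nu l :=
  forall m, pconv (fun n => \sum_(z < p ^ n) nu n z * 'C(z, m)%:R) (l m).

(** Between levels n and n + 1, a Riemann sum changes only by the oscillation of f on classes modulo
    p^n. *)
Lemma measure_refine nu n f : is_measure nu ->
  \sum_(z < p ^ n.+1) nu n.+1 z * f z - \sum_(z < p ^ n) nu n z * f z =
  \sum_(z < p ^ n) \sum_(w < p) nu n.+1 (z + p ^ n * w)%N *
     (f (z + p ^ n * w)%N - f z).
Proof.
case=> _ nuS; rewrite expnS (big_ord_mul_split _ _ (fun z => nu n.+1 z * f z)).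
rewrite -sumrB; apply: eq_bigr => z _; rewrite nuS // mulr_suml -sumrB.
by apply: eq_bigr => w _; rewrite mulrBr.
Qed.

Lemma measure_moments nu : is_measure nu ->
  exists l, (forall m, l m \in Oint E) /\ moments nu l.
Proof.
move=> nuM; have mP m : exists c,
    pconv (fun n => \sum_(z < p ^ n) nu n z * 'C(z, m)%:R) c.
  apply: pcauchy => e; have [r rP] := bin_pcontinuous m.
  exists (e + r)%N => n le_n;
    rewrite (measure_refine n (fun z => 'C(z, m)%:R) nuM) rpred_sum // => z _.
  rewrite rpred_sum // => w _; apply: pidealMl; first by case: nuM.
  by have := rP (n - r)%N z w; rewrite subnK; [apply: pidealW => //|]; lia.
have [l lP] := choice mP; exists l; split=> // m.
apply: (pconv_Oint p_prime (lP m)) => n; rewrite rpred_sum // => z _.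
by rewrite rpredM ?rpred_nat //; case: nuM.
Qed.

Definition ball_ind n z : nat -> E := fun x => (x %% p ^ n == z)%N%:R.

Lemma ball_periodic n z x w : ball_ind n z (x + p ^ n * w)%N = ball_ind n z x.
Proof. by rewrite /ball_ind addnC mulnC modnMDl. Qed.

Lemma fdiff_periodic q f : (forall x, f (x + q)%N = f x) ->
  forall j x, iter j fdiff f (x + q)%N = iter j fdiff f x.
Proof.
move=> fq j x; elim: j x => [|j IHj] x; first exact: fq.
by rewrite /= /fdiff -addSn !IHj.
Qed.

Lemma fdiff_iter_pideal e f j x : (forall x, f x \in pideal E e) ->
  iter j fdiff f x \in pideal E e.
Proof. by move=> fe; elim: j x => [|j IHj] x //=; rewrite rpredB. Qed.

(* f(x + q) is the sum of the C(q, j) Delta^j f(x), whose terms with 0 < j < q are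
   divisible by p; for a q-periodic f this bounds Delta^q f. *)
Lemma fdiff_iter_period q e f x :
  (0 < q)%N -> (forall j, (0 < j < q)%N -> (p %| 'C(q, j))%N) ->
  (forall x, f (x + q)%N = f x) ->
  (forall x, f x \in pideal E e) -> iter q fdiff f x \in pideal E e.+1.
Proof.
case: q => // q _ pC fq fe; pose g y := f (x + y)%N.
have gE j y : iter j fdiff g y = iter j fdiff f (x + y)%N.
  by elim: j y => [|j IHj] y //=; rewrite /fdiff !IHj addnS.
have := @newton_sum _ g q.+2 q.+1 (ltnSn _).
rewrite big_ord_recr /= binn mulr1n -[fdiff _ 0%N]/(iter q.+1 fdiff g 0%N) gE.
rewrite addn0 {1}/g fq big_ord_recl bin0 mulr1n /= {1}/g addn0 -addrA.
move=> /eqP; rewrite -subr_eq0 opprD addrA subrr add0r oppr_eq0.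
rewrite addr_eq0 => /eqP sE; rewrite -rpredN -sE rpred_sum // => i _.
have /dvdnP[c ->] := pC i.+1 (ltn_ord i).
rewrite -mulr_natr natrM mulrA -addn1; apply: pidealM.
  apply: pidealMr; last exact: rpred_nat.
  by apply: (@fdiff_iter_pideal _ _ i.+1) => y; exact: fe.
exact: (pideal_pX E p_prime 1).
Qed.

(** Mahler coefficients of a locally constant function tend to 0: each block of p^n differences of a
    function of period p^n gains a factor p. *)
Lemma ball_coef_small n z e j : (e * p ^ n <= j)%N ->
  iter j fdiff (ball_ind n z) 0%N \in pideal E e.
Proof.
move=> /subnK <-; rewrite iterD; apply: fdiff_iter_pideal.
elim: e => [|e IHe] x; first by rewrite pideal0 /= rpred_nat.
rewrite mulSn iterD; apply: fdiff_iter_period => // [i|y];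
  first exact: prime_dvd_bin_pX.
by apply: fdiff_periodic => {}y; rewrite -[in LHS](muln1 (p ^ n)%N) ball_periodic.
Qed.

(** The indicator is constant on classes modulo p^n, so its Riemann sums are stationary from level n
    on. *)
Lemma measure_ball nu n z N : is_measure nu -> (z < p ^ n)%N -> (n <= N)%N ->
  nu n z = \sum_(x < p ^ N) nu N x * ball_ind n z x.
Proof.
move=> nuM ltz /subnKC <-; elim: (N - n)%N => [|d IHd].
  rewrite addn0 (bigD1 (Ordinal ltz)) //= /ball_ind modn_small // eqxx mulr1.
  rewrite big1 ?addr0 // => i ne_i;
    rewrite modn_small // (_ : _ == _ = false) ?mulr0 //.
  by apply: contraNF ne_i => /eqP iz; apply/eqP/val_inj.
rewrite IHd; apply/esym/eqP; rewrite -subr_eq0 addnS measure_refine //.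
apply/eqP; rewrite big1 // => x _; rewrite big1 // => w _.
have -> : (x + p ^ (n + d) * w = x + p ^ n * (p ^ d * w))%N by rewrite mulnA -expnD.
by rewrite ball_periodic subrr mulr0.
Qed.

(** Expand the indicator of a ball in binomials: its first e p^n Mahler coefficients meet Riemann
    sums that are small at a high level N, the others are divisible by p^e. *)
Lemma measure_moments0 nu : is_measure nu -> moments nu (fun=> 0) ->
  forall n z, (z < p ^ n)%N -> nu n z = 0.
Proof.
move=> nuM nu0 n z ltz; apply: (pideal_separated p_prime) => e.
pose J := (e * p ^ n)%N.
have [K KP] : exists K, forall N j, (K <= N)%N -> (j < J)%N ->
    \sum_(x < p ^ N) nu N x * 'C(x, j)%:R \in pideal E e.
  elim: J => [|J [K KP]]; first by exists 0%N.
  have [K' K'P] := nu0 J e; exists (maxn K K') => N j.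
  rewrite geq_max => /andP[leK leK']; rewrite ltnS leq_eqVlt => /predU1P[->|ltj].
    by rewrite -[X in X \in _]subr0; exact: K'P.
  exact: KP.
pose N := maxn n K.
rewrite (@measure_ball nu n z N) ?leq_maxl //.
under eq_bigr => x _.
  rewrite (newton_sum (ball_ind n z) (ltn_ord x)) big_distrr /=.
  under eq_bigr => j _ do rewrite -mulr_natr mulrCA.
  over.
rewrite exchange_big /= rpred_sum // => j _; rewrite -big_distrr /=.
have [ltj|lej] := ltnP j J.
  apply: pidealMl; last by apply: KP => //; exact: leq_maxr.
  by rewrite -pideal0; apply: ball_coef_small; rewrite mul0n.
apply: pidealMr; first exact: ball_coef_small.
by rewrite rpred_sum // => x _; rewrite rpredM ?rpred_nat //; case: nuM.
Qed.

Lemma measure_moments_inj nu nu' l : is_measure nu -> is_measure nu' ->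
  moments nu l -> moments nu' l ->
  forall n z, (z < p ^ n)%N -> nu n z = nu' n z.
Proof.
move=> [nuO nuS] [nu'O nu'S] nul nu'l n z ltz; apply/eqP; rewrite -subr_eq0.
apply/eqP; apply: (@measure_moments0 (fun n z => nu n z - nu' n z)) ltz.
  split=> [n' z'|n' z' ltz']; first exact: rpredB.
  by rewrite nuS // nu'S // -sumrB.
move=> m; have := pconvD (nul m) (pconvZ p_prime (-1) (nu'l m)).
rewrite mulN1r subrr; apply: pconv_eq => i.
by rewrite mulN1r -sumrB; apply: eq_bigr => x _; rewrite mulrBl.
Qed.

Lemma ball_refine n z x : (z < p ^ n)%N ->
  ball_ind n z x = \sum_(w < p) ball_ind n.+1 (z + p ^ n * w)%N x.
Proof.
move=> ltz; rewrite /ball_ind; set y := (x %% p ^ n.+1)%N.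
have xy : (x %% p ^ n = y %% p ^ n)%N by rewrite modn_dvdm // dvdn_exp2l.
have y0 : (y %/ p ^ n < p)%N by rewrite ltn_divLR // -expnS ltn_pmod.
rewrite (bigD1 (Ordinal y0)) //= big1 ?addr0 => [|w ne_w].
  have yE : y = (y %% p ^ n + p ^ n * (y %/ p ^ n))%N.
    by rewrite [LHS](divn_eq y (p ^ n)%N) addnC mulnC.
  by rewrite xy {2}yE eqn_add2r.
rewrite (_ : _ == _ = false) //; apply: contraNF ne_w => /eqP yE.
by apply/eqP/val_inj; rewrite /= yE addnC mulnC divnMDl // divn_small // addn0.
Qed.

(** The mass of a ball is defined as the sum of l_j times the j-th Mahler coefficient of its
    indicator; it converges by [ball_coef_small]. *)
Lemma moments_measure l : (forall m, l m \in Oint E) ->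
  exists nu, is_measure nu /\ moments nu l.
Proof.
move=> Ol.
have nuP n : exists nu : nat -> E, forall z,
    pconv (fun J => \sum_(j < J) l j * iter j fdiff (ball_ind n z) 0%N) (nu z).
  have h z : exists c : E,
      pconv (fun J => \sum_(j < J) l j * iter j fdiff (ball_ind n z) 0%N) c.
    apply: (pconv_series (u := fun j => l j * iter j fdiff (ball_ind n z) 0%N)) => e;
      exists (e * p ^ n)%N => j le_j.
    by apply: pidealMl => //; exact: ball_coef_small.
  by have [g gP] := choice h; exists g.
have {nuP}[nu nuP] := choice nuP; exists nu; split; first split=> [n z|n z ltz].
- apply: (pconv_Oint p_prime (nuP n z)) => J; rewrite rpred_sum // => j _.
  by rewrite rpredM // fdiff_iter_Oint // => x; exact: rpred_nat.
- apply: (pconv_unique p_prime (nuP n z)).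
  have := @pconv_sum _ E _ (index_enum 'I_p) _ _ (fun w : 'I_p => nuP n.+1 (z + p ^ n
    * w)%N).
  apply: pconv_eq => J; rewrite exchange_big; apply: eq_bigr => j _ /=.
  have -> : ball_ind n z = fun x => \sum_(w < p) ball_ind n.+1 (z + p ^ n * w)%N x.
    by apply/funext => x; rewrite -ball_refine.
  by rewrite fdiff_iter_sum big_distrr.
move=> m e; have [r rP] := bin_pcontinuous m; exists (e + r)%N => n le_n.
(* The level-n Riemann sum of C(-, m) is the integral of this step function, whose differences at 0
   agree with those of C(-, m) up to p^e. *)
pose f x : E := 'C(x %% p ^ n, m)%:R.
have fE : f = fun x => \sum_(z < p ^ n) 'C(z, m)%:R * ball_ind n z x.
  apply/funext => x; have ltx : (x %% p ^ n < p ^ n)%N by rewrite ltn_pmod.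
  rewrite (bigD1 (Ordinal ltx)) //= /ball_ind eqxx mulr1 big1 ?addr0 // => z ne_z.
  rewrite (_ : _ == _ = false) ?mulr0 //; apply: contraNF ne_z => /eqP zE.
  exact/eqP/val_inj.
have fC x : f x - 'C(x, m)%:R \in pideal E e.
  rewrite -rpredN opprB /f {1}(divn_eq x (p ^ n)%N) addnC mulnC.
  have := rP (n - r)%N (x %% p ^ n)%N (x %/ p ^ n)%N.
  by rewrite subnK; [apply: pidealW => //|]; lia.
have DfC j : iter j fdiff f 0%N - (j == m)%:R \in pideal E e.
  rewrite -(fdiff_iter_bin E) -mulN1r.
  rewrite -(fdiff_iter_comp (h := fun x => -1 * x)); last by move=> x y; rewrite mulrBr.
  by rewrite -fdiff_iterD; apply: fdiff_iter_pideal => x; rewrite mulN1r.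
have S : pconv (fun J => \sum_(j < J) l j * iter j fdiff f 0%N)
    (\sum_(z < p ^ n) nu n z * 'C(z, m)%:R).
  have := @pconv_sum _ E _ (index_enum 'I_(p ^ n)) _ _
    (fun z => pconvZ p_prime 'C(z, m)%:R (nuP n z)).
  under [X in pconv _ X -> _]eq_bigr do rewrite mulrC.
  apply: pconv_eq => J; rewrite [in RHS]fE.
  under [LHS]eq_bigr do rewrite big_distrr /=.
  rewrite exchange_big; apply: eq_bigr => j _ /=.
  rewrite fdiff_iter_sum big_distrr /=; apply: eq_bigr => z _.
  rewrite (fdiff_iter_comp (h := fun x => 'C(z, m)%:R * x)); first by rewrite mulrCA.
  by move=> x y; rewrite mulrBr.
(* Truncations with J > m contain the main term j = m. *)
apply: (pconv_pideal (K := m.+1) (pconvD S (pconv_cst (- l m)))) => J ltJ.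
rewrite (bigD1 (Ordinal ltJ)) //= addrAC rpredD //.
  by rewrite -[X in _ - X]mulr1 -mulrBr pidealMl //; have := DfC m; rewrite eqxx.
rewrite rpred_sum // => j ne_j; apply: pidealMl => //.
have := DfC j; rewrite (_ : _ == _ = false) ?subr0 //.
by apply: contraNF ne_j => /eqP jm; apply/eqP/val_inj.
Qed.

End Measures.

(** * Integers of the algebraic closure *)

Section RingOfIntegers.
Variables (p : nat) (E : localField p).

(** [integralOver] asks for a ring morphism, so the ring of integers becomes a ring type of its
    own. *)
Record Oring := MkOring { Oval :> E; OvalP : Oval \in Oint E }.
HB.instance Definition _ := [isSub for Oval].
HB.instance Definition _ := [Choice of Oring by <:].
HB.instance Definition _ := [SubChoice_isSubComNzRing of Oring by <:].

Variable K : closureData E.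

Definition Oemb : {rmorphism Oring -> K} := cl_emb K \o val.

Lemma cl_int_integral (x : K) : cl_int x <-> integralOver Oemb x.
Proof.
split=> [[P [P_mon PO Px]]|[P P_mon Px]].
  pose Q : {poly Oring} := \poly_(i < size P) insubd 0 P`_i.
  have QE : map_poly val Q = P.
    apply/polyP => i; rewrite coef_map coef_poly /=.
    case: ltnP => [_|le_i]; last by rewrite nth_default.
    by rewrite insubdK //; apply/OintE/PO.
  exists Q; last by rewrite map_poly_comp QE.
  by have := P_mon; rewrite -QE !monicE lead_coef_map_inj //.
exists (map_poly val P); split; last by rewrite -map_poly_comp.
  exact: monic_map.
by move=> i; rewrite coef_map; apply/OintE/OvalP.
Qed.

Definition Kint : {pred K} := fun x => `[< cl_int x >].

Lemma KintE (x : K) : (x \in Kint) <-> cl_int x.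
Proof. by split=> /asboolP. Qed.

Fact Kint_subring_closed : subring_closed Kint.
Proof.
split=> [|x y /KintE/cl_int_integral ix /KintE/cl_int_integral iy
         |x y /KintE/cl_int_integral ix /KintE/cl_int_integral iy];
  apply/KintE/cl_int_integral.
- exact: integral1.
- exact: integral_sub.
- exact: integral_mul.
Qed.
HB.instance Definition _ := GRing.isSubringClosed.Build K Kint
  Kint_subring_closed.

Lemma Kint_emb x : x \in Oint E -> cl_emb K x \in Kint.
Proof.
move=> Ox; apply/KintE/cl_int_integral.
exact: (integral_id Oemb (MkOring Ox)).
Qed.

Hypothesis p_prime : prime p.

(** O is integrally closed: if x is not integral, then x^-1 / w is, and dividing a monic equation of
    degree s by x^s w makes w^-1 integral. *)
Lemma Oint_of_Kint x : cl_emb K x \in Kint -> x \in Oint E.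
Proof.
move=> /KintE[P [P_mon PO]]; rewrite /root horner_map fmorph_eq0 => Px.
have [->|x0] := eqVneq x 0; first exact: rpred0.
have [w [Ow w0 Ow' Opw] wP] := uniformizer E p_prime.
have [[n|n] [u [Ou Ou' xE]]] := wP _ x0.
  by rewrite xE -exprnP rpredM ?rpredX.
have Oxw : x^-1 / w \in Oint E.
  by rewrite xE NegzE -exprnN invfM invrK exprSr mulrAC mulfK // rpredM ?rpredX.
have Ox' : x^-1 \in Oint E by rewrite -(divfK w0 x^-1) rpredM.
case/negP: Ow'; move: Px; rewrite horner_coef.
case sP : (size P) => [|s].
  by move: P_mon; rewrite monicE lead_coefE sP nth_default ?sP // eq_sym oner_eq0.
rewrite big_ord_recr /= (_ : P`_s = 1); last first.
  by move/monicP: P_mon; rewrite lead_coefE sP.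
rewrite mul1r addrC addr_eq0 => /eqP xs.
have -> : w^-1 = - \sum_(i < s) P`_i * (x^-1 ^+ (s - i.+1)%N * (x^-1 / w)).
  apply: (mulfI (expf_neq0 s x0)); rewrite {1}xs mulNr mulrN; congr (- _).
  rewrite mulr_suml mulr_sumr; apply: eq_bigr => i _.
  have -> : x ^+ s = x ^+ i * (x ^+ (s - i.+1) * x).
    by rewrite -exprSr -exprD; congr (_ ^+ _); have := ltn_ord i; lia.
  rewrite exprVn; have := expf_neq0 (s - i.+1) x0.
  by move: (x ^+ (s - i.+1)) => y y0; field; rewrite x0 y0 w0.
rewrite rpredN rpred_sum // => i _; apply: rpredM; first exact/OintE/PO.
by apply: rpredM => //; exact: rpredX.
Qed.

Definition Kpideal e : {pred K} := fun x => x / p%:R ^+ e \in Kint.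

Fact Kpideal_zmod_closed e : zmod_closed (Kpideal e).
Proof.
split=> [|x y]; rewrite !unfold_in; first by rewrite mul0r; exact: (rpred0 Kint).
by rewrite mulrBl => Ox Oy; exact: (@rpredB _ Kint).
Qed.
HB.instance Definition _ e := GRing.isZmodClosed.Build K (Kpideal e)
  (Kpideal_zmod_closed e).

Lemma Kp_neq0 : p%:R != 0 :> K.
Proof. by rewrite -(rmorph_nat (cl_emb K)) fmorph_eq0 (p_neq0 E p_prime). Qed.

Lemma Kpideal_emb e x : (cl_emb K x \in Kpideal e) = (x \in pideal E e).
Proof.
rewrite [LHS]unfold_in [RHS]unfold_in -(rmorph_nat (cl_emb K)) -rmorphXn -fmorphV
  -rmorphM.
by apply/idP/idP => [/Oint_of_Kint|/Kint_emb].
Qed.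

Lemma KpidealMl e x y : x \in Kint -> y \in Kpideal e -> x * y \in Kpideal e.
Proof.
by move=> Ox; rewrite !unfold_in -mulrA => Oy; exact: (@rpredM _ Kint).
Qed.

Lemma KpidealM d e x y : x \in Kpideal d -> y \in Kpideal e ->
  x * y \in Kpideal (d + e).
Proof.
move=> dx ey; rewrite unfold_in exprD invfM mulrACA.
exact: (@rpredM _ Kint).
Qed.

Lemma Kpideal0 x : (x \in Kpideal 0) = (x \in Kint).
Proof. by rewrite [LHS]unfold_in expr0 divr1. Qed.

End RingOfIntegers.

Arguments Kint {p E} K.
Arguments Kpideal {p E} K e.

(** * The operator psi *)

Section SeriesOfPoly.
Variable F : fieldType.

Definition fps_poly (P : {poly F}) : fps F := fun n => P`_n.

Fact fps_poly_zmod_morphism : zmod_morphism fps_poly.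
Proof. by move=> P Q; apply/funext => n; rewrite /fps_poly coefB. Qed.
Fact fps_poly_monoid_morphism : monoid_morphism fps_poly.
Proof.
split=> [|P Q]; apply/funext => n; first by rewrite /fps_poly coef1.
by rewrite /fps_poly coefM.
Qed.
HB.instance Definition _ := GRing.isZmodMorphism.Build {poly F} (fps F)
  fps_poly fps_poly_zmod_morphism.
HB.instance Definition _ := GRing.isMonoidMorphism.Build {poly F} (fps F)
  fps_poly fps_poly_monoid_morphism.

Lemma fps_polyX : fps_poly 'X = fps_pi.
Proof. by apply/funext => n; rewrite /fps_poly coefX. Qed.

Lemma fps_polyC c : fps_poly c%:P = fps_const c.
Proof. by apply/funext => n; rewrite /fps_poly coefC. Qed.

Lemma fps_mul_1pi_eq0 (G : fps F) : (1 + fps_pi) * G = 0 -> G = 0.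
Proof.
move=> G0; apply/funext; elim=> [|n IHn]; have := congr1 (@^~ _) G0.
  by move=> /(_ 0%N); rewrite mulrDl mul1r fpsD fps_piM addr0.
by move=> /(_ n.+1); rewrite mulrDl mul1r fpsD fps_piM IHn addr0.
Qed.

End SeriesOfPoly.

(** For q = p and x^p = 1 only the middle terms remain, and they are divisible by p. *)
Lemma exprB1_odd (R : comNzRingType) (x : R) q : odd q ->
  (x - 1) ^+ q = x ^+ q - 1 +
    \sum_(i < q.-1) ((-1) ^+ i.+1 * x ^+ (q - i.+1)) *+ 'C(q, i.+1).
Proof.
case: q => // q q_odd; rewrite exprBn big_ord_recr big_ord_recl /= !subn0 subnn.
rewrite !expr0 bin0 binn expr1n !mulr1 mul1r !mulr1n -signr_odd q_odd expr1.
rewrite addrAC; congr (_ + _); apply: eq_bigr => i _.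
by rewrite expr1n mulr1.
Qed.

Section Psi.
Variables (p : nat) (E : localField p) (K : closureData E).
Hypotheses (p_prime : prime p) (p_odd : odd p).

Let zeta := cl_zeta K 1.

Lemma zetaXp : zeta ^+ p = 1.
Proof. by rewrite /zeta cl_zetaS cl_zeta0. Qed.

Lemma zeta_Kint : zeta \in Kint K.
Proof.
apply/KintE; exists ('X^p - 1); split; first exact/monicXnsubC/prime_gt0.
  by move=> i; apply/OintE; rewrite coefB coefXn coef1 rpredB ?rpred_nat.
by rewrite /root rmorphB /= map_polyXn rmorph1 !hornerE zetaXp subrr.
Qed.

Lemma root1_sum a : (a < p)%N ->
  \sum_(i < p) (zeta ^+ i) ^+ a = (if a == 0%N then p else 0%N)%:R.
Proof.
case: a => [|a] lta.
  by rewrite (eq_bigr (fun=> 1)) ?sumr_const ?card_ord // => i _; rewrite expr0.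
have za : zeta ^+ a.+1 != 1.
  apply/negP => /eqP za; have /eqP := cl_zeta1 K; apply; rewrite -/zeta.
  have co : coprime a.+1 p.
    by rewrite coprime_sym prime_coprime // gtnNdvd.
  have [u v uE _] := egcdnP p (ltn0Sn a).
  have : zeta ^+ (u * a.+1) = 1 by rewrite mulnC exprM za expr1n.
  by rewrite uE (eqP co) exprD mulnC exprM zetaXp expr1n mul1r expr1.
apply: (mulfI (x := zeta ^+ a.+1 - 1)); first by rewrite subr_eq0.
under eq_bigr do rewrite -exprM mulnC exprM.
by rewrite -subrX1 -exprM mulnC exprM zetaXp expr1n subrr mulr0.
Qed.

(** Already (eta - 1)^p is divisible by p; this crude estimate is enough for convergence. *)
Lemma Kpideal_subr1X eta e n : eta \in Kint K -> eta ^+ p = 1 -> (p * e <= n)%N ->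
  (eta - 1) ^+ n \in Kpideal K e.
Proof.
move=> Oeta eta_p le_n.
have h1 : (eta - 1) ^+ p \in Kpideal K 1.
  rewrite exprB1_odd // eta_p subrr add0r rpred_sum // => i _.
  have /dvdnP[c ->] : (p %| 'C(p, i.+1))%N.
    by apply: prime_dvd_bin => //; have := ltn_ord i; have := prime_gt0 p_prime; lia.
  rewrite -mulr_natr natrM mulrA; apply: KpidealMl.
    by rewrite !rpredM ?rpredX ?rpredN ?rpred1 ?rpred_nat.
  by rewrite -(rmorph_nat (cl_emb K)) Kpideal_emb // (pideal_pX E p_prime 1).
rewrite -(subnK le_n) exprD; apply: KpidealMl.
  by rewrite rpredX // rpredB ?rpred1.
rewrite exprM; elim: e {le_n} => [|e IHe]; first by rewrite expr0 Kpideal0 rpred1.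
by rewrite exprSr -addn1; exact: KpidealM.
Qed.

(** eta (1 + X) - 1 = (eta - 1) + eta X, so X^m in its n-th power carries the factor (eta - 1)^(n -
    m). *)
Lemma Kpideal_eval_coef eta e n m : eta \in Kint K -> eta ^+ p = 1 ->
  (m + p * e <= n)%N -> ((eta *: (1 + 'X) - 1) ^+ n)`_m \in Kpideal K e.
Proof.
move=> Oeta eta_p le_n.
have -> : eta *: (1 + 'X) - 1 = (eta - 1)%:P + eta *: 'X :> {poly K}.
  by rewrite scalerDr polyCB addrAC alg_polyC.
rewrite exprDn coef_sum rpred_sum // => i _.
rewrite coefMn rpredMn // -rmorphXn /= coefCM exprZn coefZ coefXn.
case: eqP => [mi|_]; last by rewrite !mulr0 rpred0.
rewrite mulr1 mulrC; apply: KpidealMl; first exact: rpredX.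
by apply: Kpideal_subr1X => //; lia.
Qed.

Lemma is_psiD (F G F' G' : fps E) : is_psi K F G -> is_psi K F' G' ->
  is_psi K (F + F') (G + G').
Proof.
move=> FG F'G' m e; have [n1 h1] := FG m e; have [n2 h2] := F'G' m e.
exists (maxn n1 n2) => l; rewrite geq_max => /andP[/h1 /KintE k1 /h2 /KintE k2].
apply/KintE; apply: (eq_in (rpredD k1 k2)); rewrite -mulrDl; congr (_ / _).
rewrite addrACA -opprD -mulrDr -big_split /= fps_phiE rmorphD fpsD rmorphD.
congr (_ - _ * _); apply: eq_bigr => i _; rewrite -big_split /=.
by apply: eq_bigr => n _; rewrite fpsD rmorphD mulrDl.
Qed.

Lemma is_psi_unique (F G G' : fps E) : is_psi K F G -> is_psi K F G' -> G = G'.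
Proof.
move=> FG FG'; apply: (fps_sub_inj (@lf_char0 _ E) (prime_gt0 p_prime)).
apply/funext => m; apply/eqP; rewrite -subr_eq0; apply/eqP.
apply: (pideal_separated p_prime) => e.
have [n1 h1] := FG m e; have [n2 h2] := FG' m e.
have /KintE k1 := h1 _ (leq_maxl n1 n2); have /KintE k2 := h2 _ (leq_maxr n1 n2).
rewrite -(Kpideal_emb K p_prime) unfold_in; have := rpredB k1 k2.
by rewrite -mulrBl opprB addrA subrK -rmorphB.
Qed.

(** Cut A at degree D. On the polynomial part, evaluation at zeta^i (1 + X) - 1 is exact: it fixes
    the image of phi and multiplies (1 + pi)^a by zeta^(ia), so [root1_sum] decides. The rest starts
    in degree D, where the powers of zeta^i (1 + X) - 1 contribute little to coefficient m. *)
Lemma is_psi_term a (A : fps E) : (a < p)%N -> A \in Apl E ->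
  is_psi K ((1 + fps_pi) ^+ a * fps_phi p A) (if a == 0%N then A else 0).
Proof.
(* The bound of [Kpideal_eval_coef] for e + 1 digits, one of which is lost to the factor p^-1 in
   psi. *)
move=> lta /AplP AA m e; pose D := (m + p * e.+1)%N.
have ltmD : (m < D)%N by rewrite /D mulnS -[X in (X < _)%N]addn0 ltn_add2l addn_gt0
  prime_gt0.
pose T (R : nzRingType) (x : R) j := (x ^+ a * (x ^+ p - 1) ^+ j).
have TX (R S : nzRingType) (h : {rmorphism R -> S}) x j : h (T R x j) = T S (h x) j.
  by rewrite /T rmorphM !rmorphXn rmorphB rmorphXn rmorph1.
pose P : {poly E} := \sum_(j < D) A j *: T _ (1 + 'X) j.
pose F := (1 + fps_pi) ^+ a * fps_phi p A : fps E.
pose C : fps E := fun n => A (n + D)%N.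
pose F2 := fps_phi p (fps_pi ^+ D * C).
have phiD n : (n < D)%N -> F2 n = 0.
  move=> ltn; rewrite /F2 fps_phiE rmorphM rmorphXn /= fps_sub_pi fpsM big1 // => i _.
  by rewrite (fpsX_low (fps_1pi0 _ _)) ?mul0r //; have := ltn_ord i; lia.
have AE : A = \sum_(j < D) fps_const (A j) * fps_pi ^+ j + fps_pi ^+ D * C.
  apply/funext => n; rewrite fpsD fps_sum fps_piXM.
  under eq_bigr do rewrite fps_constM fps_piX.
  case: ltnP => [ltn|len].
    rewrite addr0 (bigD1 (Ordinal ltn)) //= eqxx mulr1 big1 ?addr0 // => i ne_i.
    rewrite (_ : _ == _ = false) ?mulr0 //; apply: contraNF ne_i => /eqP nE.
    exact/eqP/val_inj.
  rewrite /C subnK // big1 ?add0r // => i _.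
  by rewrite gtn_eqF ?mulr0 // (leq_trans (ltn_ord i)).
have FE : F = fps_poly P + (1 + fps_pi) ^+ a * F2.
  rewrite /F /F2 {1}AE !fps_phiE rmorphD mulrDr; congr (_ + _).
  rewrite !rmorph_sum mulr_sumr; apply: eq_bigr => j _.
  rewrite /T -mul_polyC !rmorphM !rmorphXn rmorphB rmorph1 rmorphXn rmorphD rmorph1.
  by rewrite /= fps_polyX fps_polyC fps_sub_const fps_sub_pi mulrCA.
(* From [size P] terms on, the truncated evaluation contains all of P. *)
exists (size P) => l le_l; apply/KintE.
have evalE i : \sum_(n < l) cl_emb K (F n) *
      ((zeta ^+ i *: (1 + 'X) - 1) ^+ n)`_m - (zeta ^+ i) ^+ a * cl_emb K P`_m
    \in Kpideal K e.+1.
  set eta := zeta ^+ i.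
  have Oeta : eta \in Kint K by rewrite rpredX // zeta_Kint.
  have eta_p : eta ^+ p = 1 by rewrite /eta -exprM mulnC exprM zetaXp expr1n.
  set rho := eta *: (1 + 'X) - 1.
  have PE : map_poly (cl_emb K) P \Po rho = eta ^+ a *: map_poly (cl_emb K) P.
    rewrite /P !rmorph_sum scaler_sumr; apply: eq_bigr => j _.
    rewrite /= map_polyZ linearZ /= !TX rmorphD rmorph1 /= map_polyX.
    rewrite comp_polyD comp_polyC comp_polyX /rho addrCA subrr addr0 /T.
    rewrite !exprZn eta_p scale1r -scalerAl !scalerA; congr (_ *: _).
    exact: mulrC.
  have -> : \sum_(n < l) cl_emb K (F n) * (rho ^+ n)`_m - eta ^+ a * cl_emb K P`_m =
      \sum_(n < l) cl_emb K (((1 + fps_pi) ^+ a * F2) n) * (rho ^+ n)`_m.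
    apply/eqP; rewrite subr_eq; apply/eqP.
    have -> : eta ^+ a * cl_emb K P`_m = \sum_(n < l) cl_emb K P`_n * (rho ^+ n)`_m.
      rewrite -coef_map -coefZ -PE comp_polyE coef_sum.
      rewrite (size_map_poly (cl_emb K)).
      rewrite (big_ord_widen _ (fun n => ((map_poly (cl_emb K) P)`_n *: rho ^+ n)`_m)
        le_l).
      rewrite [RHS](bigID (fun n : 'I_l => (n < size P)%N)) /= [X in _ = _ + X]big1.
        by rewrite addr0; apply: eq_bigr => n _; rewrite coefZ coef_map.
      by move=> n; rewrite -leqNgt => le_n; rewrite nth_default // rmorph0 mul0r.
    rewrite -big_split; apply: eq_bigr => n _ /=.
    by rewrite FE fpsD rmorphD mulrDl addrC.
  rewrite rpred_sum // => n _; have [ltn|len] := ltnP n D.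
    rewrite fpsM big1 ?rmorph0 ?mul0r ?rpred0 // => j _.
    by rewrite phiD ?mulr0 // (leq_ltn_trans (leq_subr _ _)).
  apply: KpidealMl; last exact: Kpideal_eval_coef.
  rewrite Kint_emb // fpsM rpred_sum // => j _.
  rewrite rpredM //; first by rewrite fps_1piX rpred_nat.
  apply: (AplP _ _); rewrite /F2 fps_phiE Apl_sub // rpredM ?rpredX ?Apl_pi //.
  by apply/AplP => n'; exact: AA.
set S := \sum_(i < p) _.
have SE : S - (if a == 0%N then p else 0%N)%:R * cl_emb K P`_m \in Kpideal K e.+1.
  by rewrite -(root1_sum lta) mulr_suml -sumrB rpred_sum.
have p0 := Kp_neq0 K p_prime.
have -> : cl_emb K (fps_phi p (if a == 0%N then A else 0) m) =
    p%:R^-1 * ((if a == 0%N then p else 0%N)%:R * cl_emb K P`_m).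
  case: eqP => [a0|_]; last by rewrite fps_phiE rmorph0 fps0 rmorph0 mul0r mulr0.
  rewrite mulKf //; have := congr1 (@^~ m) FE; rewrite /F a0 !mul1r fpsD.
  by rewrite phiD // addr0 => ->.
rewrite -mulrBr -opprB mulrN mulNr rpredN -mulrA.
by rewrite unfold_in exprS invfM mulrCA in SE.
Qed.

End Psi.

(** * Decomposition of A^+ into the pieces (1 + pi)^a phi(A^+) *)

Section PsiDecomposition.
Variables (p : nat) (E : localField p) (K : closureData E).
Hypotheses (p_prime : prime p) (p_odd : odd p).

Definition psi_sum (Y : nat -> fps E) : fps E :=
  \sum_(a < p) (1 + fps_pi) ^+ a * fps_phi p (Y a).

(** Divide c by p with remainder and absorb (1 + pi)^(p (c / p)) = phi((1 + pi)^(c / p)) into A. *)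
Lemma is_psi_mul c (A : fps E) : A \in Apl E ->
  is_psi K ((1 + fps_pi) ^+ c * fps_phi p A)
    (if (p %| c)%N then (1 + fps_pi) ^+ (c %/ p) * A else 0).
Proof.
move=> AA; have := @is_psi_term _ _ K p_prime p_odd (c %% p)%N
  ((1 + fps_pi) ^+ (c %/ p) * A).
rewrite ltn_pmod ?prime_gt0 // rpredM ?rpredX ?Apl_1pi // => /(_ isT isT).
rewrite fps_phiE rmorphM rmorphXn /= fps_sub_1pi mulrA -exprM -exprD.
by rewrite [(p * _)%N]mulnC addnC -divn_eq.
Qed.

Lemma is_psi0 : is_psi K 0 0.
Proof.
have := @is_psi_mul 0 0 (rpred0 _).
by rewrite fps_phiE rmorph0 !mulr0 dvdn0.
Qed.

Lemma is_psi_sum (I : Type) (s : seq I) (F G : I -> fps E) :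
  (forall i, is_psi K (F i) (G i)) ->
  is_psi K (\sum_(i <- s) F i) (\sum_(i <- s) G i).
Proof.
move=> FG; elim: s => [|i s IHs]; last by rewrite !big_cons; exact: is_psiD.
by rewrite !big_nil; exact: is_psi0.
Qed.

Lemma is_psi_psi_sum (Y : nat -> fps E) : (forall a, Y a \in Apl E) ->
  is_psi K (psi_sum Y) (Y 0%N).
Proof.
move=> AY; have p_gt0 := prime_gt0 p_prime.
have -> : Y 0%N = \sum_(a < p) if (a == 0 :> nat)%N then Y a else 0.
  rewrite (bigD1 (Ordinal p_gt0)) //= big1 ?addr0 // => a ne_a.
  by rewrite (_ : _ == _ = false) //; apply: contraNF ne_a => /eqP a0;
    apply/eqP/val_inj.
by apply: is_psi_sum => a; apply: is_psi_term.
Qed.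

(** Multiplying by (1 + pi)^(p - b) moves component b to exponent p, the only multiple of p among
    the p - b + a with a < p; psi then returns (1 + pi) Y_b. *)
Lemma psi_sum_eq0 (Y : nat -> fps E) : (forall a, Y a \in Apl E) ->
  psi_sum Y = 0 -> forall b, (b < p)%N -> Y b = 0.
Proof.
move=> AY Y0 b ltb; apply: fps_mul_1pi_eq0; apply: esym.
have p_gt0 := prime_gt0 p_prime.
have h : is_psi K 0 ((1 + fps_pi) * Y b).
  have -> : 0 = \sum_(a < p) (1 + fps_pi) ^+ (p - b + a) * fps_phi p (Y a).
    transitivity ((1 + fps_pi) ^+ (p - b) * psi_sum Y); first by rewrite Y0 mulr0.
    by rewrite mulr_sumr; apply: eq_bigr => a _; rewrite mulrA -exprD.
  have -> : (1 + fps_pi) * Y b = \sum_(a < p)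
      if (p %| p - b + a)%N then (1 + fps_pi) ^+ ((p - b + a) %/ p) * Y a else 0.
    rewrite (bigD1 (Ordinal ltb)) //= subnK 1?ltnW // dvdnn divnn p_gt0 expr1.
    rewrite big1 ?addr0 // => a ne_a; case: ifP => // /dvdnP[q qE].
    case/eqP: ne_a; apply/val_inj => /=; have := ltn_ord a.
    by case: q qE => [|[|q]]; nia.
  by apply: is_psi_sum => a; exact: is_psi_mul.
exact: (is_psi_unique p_prime is_psi0 h).
Qed.

Lemma psi_sumD (Y Z : nat -> fps E) :
  psi_sum (fun a => Y a + Z a) = psi_sum Y + psi_sum Z.
Proof.
rewrite /psi_sum -big_split; apply: eq_bigr => a _ /=.
by rewrite fps_phiE rmorphD mulrDr.
Qed.

Lemma psi_sumM (Y : nat -> fps E) (A : fps E) :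
  psi_sum (fun a => A * Y a) = fps_phi p A * psi_sum Y.
Proof.
rewrite /psi_sum mulr_sumr; apply: eq_bigr => a _.
by rewrite fps_phiE rmorphM mulrCA.
Qed.

Lemma Apl_psi_sum (Y : nat -> fps E) : (forall a, Y a \in Apl E) ->
  psi_sum Y \in Apl E.
Proof.
move=> AY; rewrite rpred_sum // => a _.
by rewrite rpredM ?rpredX ?Apl_1pi // fps_phiE Apl_sub.
Qed.

Let decomposable F := exists2 Y : nat -> fps E,
  forall a, Y a \in Apl E & F = psi_sum Y.

Let decD F G : decomposable F -> decomposable G -> decomposable (F + G).
Proof.
move=> [Y AY ->] [Z AZ ->]; exists (fun a => Y a + Z a); last by rewrite psi_sumD.
by move=> a; rewrite rpredD.
Qed.

Let decM F A : A \in Apl E -> decomposable F -> decomposable (fps_phi p A * F).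
Proof.
move=> AA [Y AY ->]; exists (fun a => A * Y a); last by rewrite psi_sumM.
by move=> a; rewrite rpredM.
Qed.

Let decN F : decomposable F -> decomposable (- F).
Proof.
move=> /(decM (_ : -1 \in Apl E)); rewrite fps_phiE rmorphN rmorph1 mulN1r; apply.
by rewrite rpredN rpred1.
Qed.

(** pi = (1 + pi) - 1 trades powers of pi for powers of 1 + pi, the exponents staying below p. *)
Let dec_piX a b : (a + b < p)%N -> decomposable (fps_pi ^+ a * (1 + fps_pi) ^+ b).
Proof.
elim: a b => [|a IHa] b.
  rewrite add0n mul1r => ltb; exists (fun c => (c == b)%:R).
    by move=> c; rewrite rpred_nat.
  rewrite /psi_sum (bigD1 (Ordinal ltb)) //= eqxx fps_phiE rmorph1 mulr1.
  rewrite big1 ?addr0 // => c ne_c; rewrite (_ : _ == _ = false) ?rmorph0 ?mulr0 //.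
  by apply: contraNF ne_c => /eqP cb; apply/eqP/val_inj.
move=> ltab.
have -> : fps_pi ^+ a.+1 * (1 + fps_pi) ^+ b =
    fps_pi ^+ a * (1 + fps_pi) ^+ b.+1 - fps_pi ^+ a * (1 + fps_pi) ^+ b :> fps E.
  rewrite exprSr [(1 + fps_pi) ^+ b.+1]exprS -mulrBr mulrDl mul1r addrAC subrr add0r.
  by rewrite mulrA.
apply: decD; last apply: decN; apply: IHa; lia.
Qed.

Lemma fps_phi_modp (H : fps E) t : H \in Apl E ->
  fps_phi p H t - (if (p %| t)%N then H (t %/ p)%N else 0) \in pideal E 1.
Proof.
move=> /AplP AH; have p_gt0 := prime_gt0 p_prime.
have hX m : fps_sub p fps_pi ^+ m - fps_pi ^+ (p * m) \in ppideal E t.+1.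
  elim: m => [|m IHm]; first by rewrite muln0 subrr rpred0.
  have -> : fps_sub p fps_pi ^+ m.+1 - fps_pi ^+ (p * m.+1) =
     fps_pi ^+ p * (fps_sub p fps_pi ^+ m - fps_pi ^+ (p * m)) +
     fps_sub p fps_pi ^+ m * (fps_sub p fps_pi - fps_pi ^+ p) :> fps E.
    by rewrite mulnS exprD exprSr; ring.
  rewrite rpredD //; apply: ppidealMl => //; rewrite ?rpredX ?Apl_sub ?Apl_pi //.
  by rewrite fps_sub_pi; exact: ppideal_1piX_prime.
rewrite fps_phiE /fps_sub (@fps_compE _ (t.+1)) ?fps_1pi0 //.
have -> : (if (p %| t)%N then H (t %/ p)%N else 0) =
    \sum_(m < t.+1) H m * (t == p * m)%N%:R.
  case: ifP => [/dvdnP[q ->]|ndvd].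
    have ltq : (q < (q * p).+1)%N by rewrite ltnS leq_pmulr.
    rewrite mulnK // (bigD1 (Ordinal ltq)) //= [(p * q)%N]mulnC eqxx mulr1 big1
      ?addr0 // => m ne_m.
    rewrite (_ : _ == _ = false) ?mulr0 //.
    apply: contraNF ne_m => /eqP qm; apply/eqP/val_inj/eqP => /=.
    by rewrite -(eqn_pmul2l p_gt0) -qm mulnC.
  rewrite big1 // => m _; rewrite (_ : _ == _ = false) ?mulr0 //.
  by apply: contraFF ndvd => /eqP ->; rewrite dvdn_mulr.
rewrite -sumrB rpred_sum // => m _; rewrite -mulrBr pidealMl //.
by rewrite -fps_sub_pi -fps_piX; have /ppidealP[_] := hX m; apply.
Qed.

(** Modulo p, F is the sum of the pi^a phi(H_a), where H_a collects the coefficients in degrees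
    congruent to a, because phi(H) is H(pi^p) modulo p. *)
Let dec_modp F : F \in Apl E -> exists Y G,
  [/\ forall a, Y a \in Apl E, G \in Apl E & F = psi_sum Y + p%:R * G].
Proof.
move=> /AplP AF; have p_gt0 := prime_gt0 p_prime.
pose H a : fps E := fun j => F (p * j + a)%N.
have AH a : H a \in Apl E by apply/AplP => t; exact: AF.
have [Y AY YE] : decomposable (\sum_(a < p) fps_phi p (H a) * (fps_pi ^+ a * (1 +
  fps_pi) ^+ 0)).
  elim/big_ind: _ => [||a _]; last 1 first.
  - by apply: decM => //; apply: dec_piX; rewrite addn0.
  - exists (fun=> 0); first by move=> a; rewrite rpred0.
    by rewrite /psi_sum big1 // => a _; rewrite fps_phiE rmorph0 mulr0.
  - exact: decD.
exists Y, (fun t => (F t - psi_sum Y t) / p%:R); split=> //.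
  apply/AplP => t; suff h : F t - psi_sum Y t \in pideal E 1 by exact: h.
  rewrite -YE fps_sum.
  have -> : F t = \sum_(a < p) if (a <= t)%N && (p %| t - a)%N then H a ((t - a) %/
    p)%N else 0.
    have ltr : (t %% p < p)%N by rewrite ltn_pmod.
    have tE := divn_eq t p.
    rewrite (bigD1 (Ordinal ltr)) //= leq_mod.
    have -> : (t - t %% p = p * (t %/ p))%N by rewrite {1}tE addnK mulnC.
    rewrite dvdn_mulr //= mulKn // /H mulnC -tE big1 ?addr0 // => a ne_a.
    case: ifP => // /andP[le_a dvd_a]; case/eqP: ne_a; apply/val_inj => /=.
    move/dvdnP: dvd_a => [q qE]; have -> : t = (q * p + a)%N by lia.
    by rewrite modnMDl modn_small.
  rewrite -sumrB rpred_sum // => a _; rewrite mulr1 mulrC fps_piXM.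
  case: ltnP => [_|_] /=; first by rewrite subrr rpred0.
  by rewrite -rpredN opprB; exact: fps_phi_modp.
apply/funext => t; rewrite fpsD fps_natM mulrC divfK ?(p_neq0 E p_prime) //.
by rewrite addrC subrK.
Qed.

Lemma psi_sum_coef e (Y : nat -> fps E) t :
  (forall a s, (a < p)%N -> (s <= t)%N -> Y a s \in pideal E e) ->
  psi_sum Y t \in pideal E e.
Proof.
move=> Ye; rewrite /psi_sum fps_sum rpred_sum // => a _.
rewrite fpsM rpred_sum // => i _; apply: pidealMl; first by rewrite fps_1piX rpred_nat.
rewrite fps_phiE rpred_sum // => m _; apply: pidealMr.
  by apply: Ye => //; have := ltn_ord m; lia.
apply: (AplP _ _); rewrite rpredX // rpredB ?rpred1 // rpredX //; exact: Apl_1pi.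
Qed.

(** Iterating [dec_modp] on the remainders gives p-adically convergent series for the components. *)
Lemma psi_sum_exists F : F \in Apl E ->
  exists2 Y : nat -> fps E, forall a, Y a \in Apl E & F = psi_sum Y.
Proof.
move=> AF.
have /choice[f fP] : forall F : fps E, exists YG : (nat -> fps E) * fps E,
    F \in Apl E -> [/\ forall a, YG.1 a \in Apl E, YG.2 \in Apl E
                     & F = psi_sum YG.1 + p%:R * YG.2].
  move=> G; have [AG|nAG] := boolP (G \in Apl E); last by exists (fun=> 0, 0).
  by have [Y [H h]] := dec_modp AG; exists (Y, H) => _; exact: h.
pose Fs k := iter k (fun G => (f G).2) F.
have AFs k : Fs k \in Apl E by elim: k => // k /fP[].
pose Z k := (f (Fs k)).1.
have AZ k a : Z k a \in Apl E by have [h _ _] := fP _ (AFs k); exact: h.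
have FS k : Fs k = psi_sum (Z k) + p%:R * Fs k.+1 by have [] := fP _ (AFs k).
pose Zs k a : fps E := \sum_(i < k) p%:R ^+ i * Z i a.
have FE k : F = psi_sum (Zs k) + p%:R ^+ k * Fs k.
  elim: k => [|k IHk].
    rewrite mul1r /psi_sum big1 ?add0r // => a _.
    by rewrite /Zs big_ord0 fps_phiE rmorph0 mulr0.
  rewrite IHk FS mulrDr addrA exprSr mulrA; congr (_ + _).
  rewrite (_ : Zs k.+1 = fun a => Zs k a + p%:R ^+ k * Z k a); last first.
    by apply/funext => a; rewrite /Zs big_ord_recr.
  by rewrite psi_sumD psi_sumM fps_phiE rmorphXn rmorph_nat.
have pZ i a t : (p%:R ^+ i * Z i a) t = p%:R ^+ i * Z i a t.
  by rewrite -!natrX fps_natM.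
have /choice[Y YP] : forall at_ : nat * nat, exists y : E,
    pconv (fun k => Zs k at_.1 at_.2) y.
  move=> [a t] /=.
  have [y yP] : exists y, pconv (fun k => \sum_(i < k) p%:R ^+ i * Z i a t) y.
    apply: (pconv_series (u := fun i => p%:R ^+ i * Z i a t)) => e;
      exists e => i le_e; apply: (pidealW p_prime le_e).
    by apply: pideal_pXM => //; apply: (AplP _ (AZ i a)).
  exists y; apply: pconv_eq yP => k; rewrite /Zs fps_sum.
  by apply: eq_bigr => i _; rewrite pZ.
pose Y' a : fps E := fun t => Y (a, t).
have YZ k a t : Y' a t - Zs k a t \in pideal E k.
  have h : pconv (fun k' => Zs k' a t - Zs k a t) (Y' a t - Zs k a t).
    exact: (pconvD (YP (a, t)) (pconv_cst (- Zs k a t))).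
  apply: (pconv_pideal (K := k) h) => k' le_k.
  rewrite -(subnKC le_k); elim: (k' - k)%N => [|d IHd].
    by rewrite addn0 subrr rpred0.
  rewrite addnS /Zs big_ord_recr /= fpsD addrAC rpredD // pZ.
  apply: (pidealW p_prime (leq_addr d k)); apply: pideal_pXM => //.
  by apply: (AplP _ (AZ _ _)).
exists Y' => [a|]; first by apply/AplP => t; have := YZ 0%N a t;
  rewrite /Zs big_ord0 subr0 pideal0.
apply/funext => t; apply/eqP; rewrite -subr_eq0; apply/eqP.
apply: (pideal_separated p_prime) => k.
have -> : F t - psi_sum Y' t =
    (p%:R ^+ k * Fs k) t - psi_sum (fun a => Y' a - Zs k a) t.
  have := psi_sumD (fun a => Y' a - Zs k a) (Zs k).
  rewrite (_ : (fun a => _ + _) = Y'); last by apply/funext => a; rewrite subrK.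
  by move=> ->; rewrite {1}(FE k) !fpsD; ring.
apply: rpredB; last by apply: psi_sum_coef => a t' _ _; exact: YZ.
by rewrite -natrX fps_natM natrX pideal_pXM //; apply: (AplP _ (AFs k)).
Qed.

End PsiDecomposition.

(** * The cocycle of Gamma *)

Lemma fps_mx1_coef (F : fieldType) d (i j : 'I_d) m :
  (1%:M : 'M[fps F]_d) i j m = if m == 0%N then (i == j)%:R else 0.
Proof.
by rewrite mxE; case: eqP => _; rewrite ?mulr1n ?mulr0n ?fps1 ?fps0; case: eqP.
Qed.

Section UnipotentMatrix.
Variables (F : fieldType) (d : nat) (M : 'M[fps F]_d).
Hypothesis M0 : forall i j, M i j 0%N = (i == j)%:R.

(** As M is the identity modulo pi, coefficient t of MX is that of X up to lower coefficients of X,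
    so equations in X can be treated recursively. *)
Lemma mulmx_fps_coef (X : 'M[fps F]_d) i j t :
  (M *m X) i j t = X i j t +
    \sum_l \sum_(s < t) M i l s.+1 * X l j (t - s.+1)%N.
Proof.
rewrite mxE fps_sum; under eq_bigr do rewrite fpsM big_ord_recl subn0 M0.
rewrite big_split /= (bigD1 i) //= eqxx mul1r big1 ?addr0 // => l ne_l.
by rewrite eq_sym (negPf ne_l) mul0r.
Qed.

Lemma mulmx_fps_inj (X Y : 'M[fps F]_d) : M *m X = M *m Y -> X = Y.
Proof.
move=> eqXY; apply/matrixP => i j; apply/funext => t.
elim/ltn_ind: t i j => t IHt i j.
have := congr1 (fun Z : 'M[fps F]_d => Z i j t) eqXY.
rewrite /= !mulmx_fps_coef => /eqP; rewrite -subr_eq0 opprD addrACA.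
rewrite -sumrB big1 ?addr0 ?subr_eq0; first by move/eqP.
move=> l _; rewrite -sumrB big1 // => s _; rewrite IHt ?subrr //.
by have := ltn_ord s; lia.
Qed.

End UnipotentMatrix.

(** * Expansion of the cocycle on a residue class modulo p *)

Section CocycleExpansion.
Variables (p : nat) (E : localField p) (d h : nat).
Hypotheses (p_prime : prime p) (p_odd : odd p) (h_ge2 : (2 <= h)%N).
Variables (M : 'M[fps E]_d) (G : nat -> 'M[fps E]_d).
Hypothesis M_cong : forall i j m, (m < h)%N -> M i j m = (1%:M : 'M[fps E]_d) i j m.
Hypothesis G_int : forall c i j, coprime p c -> G c i j \in Apl E.
Hypothesis MG : forall c, coprime p c -> M *m G c = map_mx (fps_sub c) M.

Let M0 i j : M i j 0%N = (i == j)%:R.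
Proof. by rewrite M_cong ?(leq_trans _ h_ge2) // fps_mx1_coef. Qed.

(** For t < h the coefficients of M in the correction terms vanish, so coefficient t of G_c is that
    of c(M). *)
Lemma cocycle_cong c i j t : coprime p c -> (t < h)%N ->
  G c i j t = (1%:M : 'M[fps E]_d) i j t.
Proof.
move=> co_pc; elim/ltn_ind: t i j => t IHt i j lth.
have := congr1 (fun Z : 'M[fps E]_d => Z i j t) (MG co_pc).
rewrite /= (mulmx_fps_coef M0) big1 ?addr0 => [->|l _].
  rewrite mxE /fps_sub /fps_comp.
  rewrite big_ord_recl /= M_cong ?expr0 ?(leq_trans _ h_ge2) // big1 => [|m _].
    rewrite addr0 !fps_mx1_coef eqxx fps1.
    by case: (t == 0%N); rewrite ?mulr1 ?mulr0.
  have ltm : (bump 0 m < h)%N by rewrite (leq_ltn_trans _ lth) //= ltn_ord.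
  by rewrite M_cong // fps_mx1_coef mul0r.
rewrite big1 // => s _; rewrite M_cong;
  last by rewrite (leq_ltn_trans _ lth) // ltn_ord.
by rewrite fps_mx1_coef mul0r.
Qed.

Lemma cocycle_ppideal c i j : coprime p c -> (G c - 1%:M) i j \in ppideal E 2.
Proof.
move=> co_pc; apply/ppidealP; split=> [|t lt2].
  rewrite !mxE rpredB ?G_int //.
  by case: eqP => _; rewrite ?mulr1n ?mulr0n ?rpred0 ?rpred1.
rewrite !mxE fpsB cocycle_cong ?(leq_trans lt2) // mxE subrr; exact: rpred0.
Qed.

(** Both sides have product (ec)(M) with M, which can be cancelled. *)
Lemma cocycle_mul c e : coprime p c -> coprime p e ->
  G (e * c) = G e *m map_mx (fps_sub e) (G c).
Proof.
move=> co_pc co_pe; apply: (mulmx_fps_inj M0).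
rewrite mulmxA (MG co_pe) -map_mxM (MG co_pc) MG ?coprimeMr ?co_pc ?co_pe //.
by apply/matrixP => i j; rewrite !mxE /= fps_sub_comp.
Qed.

(** Coefficient r of (1 + pi)^(a + pz) - 1 has degree at most r in z, and in a product the indices
    add up to t. *)
Lemma fps_sub_fdeg a (A : fps E) t : fdeg t (fun z => fps_sub (a + p * z) A t).
Proof.
apply: fdeg_sum => m.
apply: (@fdegM _ 0 t (fun=> A m)) => //.
have h1 r : fdeg r (fun z => ((1 + fps_pi : fps E) ^+ (a + p * z) - 1) r).
  rewrite (_ : (fun _ => _) = fun z => 'C(a + p * z, r)%:R + - (1 : fps E) r).
    by apply: fdegD; [exact: fdeg_bin|apply: (@fdegW _ 0)].
  by apply/funext => z; rewrite fpsB fps_1piX.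
move: (nat_of_ord m) => {}m; elim: m t => [|m IHm] t; first exact: (@fdegW _ 0).
rewrite (_ : (fun _ => _) = fun z => \sum_(i < t.+1)
   ((1 + fps_pi : fps E) ^+ (a + p * z) - 1) i *
   (((1 + fps_pi : fps E) ^+ (a + p * z) - 1) ^+ m) (t - i)%N).
  apply: fdeg_sum => i; apply: (@fdegW _ (i + (t - i))%N).
    by have := ltn_ord i; lia.
  exact: (fdegM (h1 i) (IHm (t - i)%N)).
by apply/funext => z; rewrite exprS fpsM.
Qed.

Variable a : nat.
Hypothesis a_coprime : coprime p a.

Let co_a z : coprime p (a + p * z).
Proof. by rewrite addnC mulnC /coprime gcdnMDl. Qed.

(** Coefficient t of M G_c = c(M) expresses that of G_c through c(M) and lower coefficients of G_c;
    denominators of M do not affect degrees. *)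
Lemma cocycle_fdeg i j t : fdeg t (fun z => G (a + p * z) i j t).
Proof.
elim/ltn_ind: t i j => t IHt i j.
rewrite (_ : (fun _ => _) = fun z => fps_sub (a + p * z) (M i j) t +
   - \sum_l \sum_(s < t) M i l s.+1 * G (a + p * z) l j (t - s.+1)%N).
  apply: fdegD; first exact: fps_sub_fdeg.
  apply: fdegN; apply: fdeg_sum => l; apply: fdeg_sum => s.
  apply: (@fdegM _ 0 t (fun=> _)) => //.
  by apply: (@fdegW _ (t - s.+1)); [|apply: IHt]; have := ltn_ord s; lia.
apply/funext => z; have := congr1 (fun Z : 'M[fps E]_d => Z i j t) (MG (co_a z)).
by rewrite /= (mulmx_fps_coef M0) mxE => <-; rewrite addrK.
Qed.

(* With [c = a + p z], the element of Gamma of character c sends (1 + pi) phi(n_i) to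
   (1 + pi)^a phi(y), where y is the combination of n_1, n_2 with coefficients the
   i-th column of [orbit_matrix z]. *)
Definition orbit_matrix z : 'M[fps E]_d := (1 + fps_pi) ^+ z *: G (a + p * z).

Lemma orbit_matrix_int z i j : orbit_matrix z i j \in Apl E.
Proof. by rewrite mxE rpredM ?rpredX ?Apl_1pi ?G_int. Qed.

Lemma orbit_matrix_fdeg i j t : fdeg t (fun z => orbit_matrix z i j t).
Proof.
rewrite (_ : (fun _ => _) = fun z => \sum_(s < t.+1)
    'C(0 + 1 * z, s)%:R * G (a + p * z) i j (t - s)%N).
  apply: fdeg_sum => s; apply: (@fdegW _ (s + (t - s))%N).
    by have := ltn_ord s; lia.
  apply: fdegM; [exact: fdeg_bin|exact: cocycle_fdeg].
by apply/funext => z; rewrite mxE fpsM; apply: eq_bigr => s _; rewrite fps_1piX mul1n.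
Qed.

Lemma orbit_matrix0 i j : (orbit_matrix 0 - 1%:M) i j \in ppideal E 1.
Proof.
rewrite /orbit_matrix muln0 addn0 expr0 scale1r.
by apply: ppidealW (cocycle_ppideal i j a_coprime).
Qed.

Let co_p1 : coprime p p.+1. Proof. exact: coprimenS. Qed.

(** The cocycle relation for gamma = 1 + p, with gamma((1 + pi)^z) = (1 + pi)^z (1 + pi)^(pz). *)
Lemma orbit_matrix_twist z :
  orbit_matrix (p.+1 * z + a) = twist a (G p.+1) (orbit_matrix z).
Proof.
rewrite /orbit_matrix /twist.
have -> : (a + p * (p.+1 * z + a) = p.+1 * (a + p * z))%N by lia.
rewrite cocycle_mul //; apply/matrixP => i j; rewrite !mxE !mulr_sumr.
apply: eq_bigr => l _; rewrite !mxE rmorphM rmorphXn /= fps_sub_1pi.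
by rewrite exprD exprM; ring.
Qed.

Definition orbit_coef := newton_coef orbit_matrix.

Lemma orbit_coef_Oint t m i j : orbit_coef t m i j \in Oint E.
Proof. exact/newton_coef_Oint/orbit_matrix_int. Qed.

Lemma orbit_coefE z i j t :
  orbit_matrix z i j t = \sum_(m < t.+1) orbit_coef t m i j * 'C(z, m)%:R.
Proof. exact/newton_coefE/orbit_matrix_fdeg. Qed.

Lemma orbit_coef_diag t i j : orbit_coef t t i j - (i == j)%:R \in pideal E 1.
Proof.
apply: (newton_coef_diag (G := G p.+1) p_prime p_odd a_coprime) => //.
- by move=> i' j'; exact: cocycle_ppideal.
- exact: orbit_matrix_int.
- exact: orbit_matrix0.
- exact: orbit_matrix_fdeg.
- exact: orbit_matrix_twist.
Qed.

End CocycleExpansion.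

(** * Triangular systems with diagonal 1 modulo p *)

Section TriangularSystem.
Variables (p : nat) (E : localField p).
Hypothesis p_prime : prime p.

(** The determinant is 1 modulo p, hence a unit of O, and the adjugate is integral. *)
Lemma unit_mod_p (A : 'M[E]_2) : (forall i j, A i j - (i == j)%:R \in pideal E 1) ->
  A \in unitmx /\ forall i j, invmx A i j \in Oint E.
Proof.
move=> A1.
have OA i j : A i j \in Oint E.
  rewrite -(subrK (i == j)%:R (A i j)) rpredD ?rpred_nat //.
  exact: (pideal_Oint p_prime (A1 i j)).
have det1 : \det A - 1 \in pideal E 1.
  have -> : \det A = A 0 0 * A 1 1 - A 0 1 * A 1 0.
    rewrite (expand_det_row A 0) !big_ord_recl big_ord0 addr0 /cofactor !det_mx11.
    rewrite !mxE /= expr0 expr1 mul1r mulN1r mulrN.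
    by congr (_ * A _ _ - A _ _ * A _ _); apply/val_inj.
  have -> : A 0 0 * A 1 1 - A 0 1 * A 1 0 - 1 =
     (A 0 0 - 1) * A 1 1 + (A 1 1 - 1) - A 0 1 * A 1 0 by ring.
  have h00 := A1 0 0; have h11 := A1 1 1; have h01 := A1 0 1.
  apply: rpredB; first by apply: rpredD => //; exact: pidealMr.
  by apply: pidealMr => //; rewrite -[X in X \in _]subr0; exact: h01.
have [det0 Odet] := inv_Oint_1Dp p_prime det1.
have uA : A \in unitmx by rewrite unitmxE unitfE.
split=> // i j; rewrite /invmx uA !mxE rpredM //.
rewrite /cofactor rpredM ?rpredX ?rpredN ?rpred1 //.
rewrite /determinant rpred_sum // => s _.
rewrite rpredM ?rpredX ?rpredN ?rpred1 // rpred_prod // => l _.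
by rewrite !mxE.
Qed.

Variable v : nat -> nat -> 'M[E]_2.
Hypothesis v_int : forall t m i j, v t m i j \in Oint E.
Hypothesis v_diag : forall t i j, v t t i j - (i == j)%:R \in pideal E 1.

Lemma triangular_solve (y : nat -> 'cV[E]_2) : (forall t i, y t i 0 \in Oint E) ->
  exists2 l : nat -> 'cV[E]_2, forall m i, l m i 0 \in Oint E &
    forall t, y t = \sum_(m < t.+1) v t m *m l m.
Proof.
move=> Oy.
pose next T (l : nat -> 'cV[E]_2) :=
  invmx (v T T) *m (y T - \sum_(m < T) v T m *m l m).
(* [L T] holds the first T values and 0 beyond; each new value is found by forward substitution. *)
pose L := fix L T : nat -> 'cV[E]_2 :=
  if T is T'.+1 then fun m => if m == T' then next T' (L T') else L T' m
  else fun=> 0.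
pose l m := L m.+1 m.
have LE T m : (m < T)%N -> L T m = l m.
  elim: T => // T IHT; rewrite ltnS leq_eqVlt => /predU1P[-> //|ltm] /=.
  by rewrite ltn_eqF // IHT.
have lE t : l t = next t l.
  rewrite {1}/l /= eqxx /next; congr (_ *m (_ - _)).
  by apply: eq_bigr => m _; rewrite LE.
exists l => [|t].
  elim/ltn_ind => t IHt i; rewrite lE mxE rpred_sum // => j _.
  rewrite rpredM //; first by have [_] := unit_mod_p (v_diag t).
  rewrite !mxE rpredB // summxE rpred_sum // => m _.
  by rewrite mxE rpred_sum // => s _; rewrite rpredM // IHt.
have [u _] := unit_mod_p (v_diag t).
by rewrite big_ord_recr /= lE /next mulKVmx // addrC subrK.
Qed.

Lemma triangular_unique (l : nat -> 'cV[E]_2) :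
  (forall t, \sum_(m < t.+1) v t m *m l m = 0) -> forall m, l m = 0.
Proof.
move=> l0; elim/ltn_ind => t IHt; have [u _] := unit_mod_p (v_diag t).
have := l0 t; rewrite big_ord_recr /= big1 ?add0r => [vl|m _].
  by rewrite -(mulKmx u (l t)) vl mulmx0.
by rewrite IHt ?mulmx0.
Qed.

End TriangularSystem.

(** * Coordinates on the Wach module *)

Section PeriodRingEvaluation.
Variables (p : nat) (E : localField p) (K : closureData E) (B : periodRing K).
Implicit Types (F G : fps E).

(** [ao_ev] is specified as a ring map on A^+ only, so each rule carries integrality conditions. *)
Lemma evB F G : F \in Apl E -> G \in Apl E -> ao_ev B (F - G) = ao_ev B F - ao_ev B G.
Proof. by move=> /AplE AF /AplE AG; exact: ao_evB. Qed.

Lemma evM F G : F \in Apl E -> G \in Apl E -> ao_ev B (F * G) = ao_ev B F * ao_ev B G.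
Proof. by move=> /AplE AF /AplE AG; exact: ao_evM. Qed.

Lemma ev0 : ao_ev B 0 = 0.
Proof. by rewrite -(subrr (0 : fps E)) evB ?subrr ?rpred0. Qed.

Lemma evD F G : F \in Apl E -> G \in Apl E -> ao_ev B (F + G) = ao_ev B F + ao_ev B G.
Proof.
move=> AF AG; rewrite -{1}(opprK G) evB ?rpredN // -[- G]sub0r evB ?rpred0 //.
by rewrite ev0 sub0r opprK.
Qed.

Lemma ev_const c : c \in Oint E -> ao_ev B (fps_const c) = ao_O B c.
Proof. by move=> /OintE Oc; exact: ao_ev_const. Qed.

Lemma ev1 : ao_ev B 1 = 1.
Proof. by rewrite -fps_const1 ev_const ?rpred1 // ao_O1. Qed.

Lemma ev_sum (I : Type) (s : seq I) (P : pred I) (F : I -> fps E) :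
  (forall i, F i \in Apl E) ->
  ao_ev B (\sum_(i <- s | P i) F i) = \sum_(i <- s | P i) ao_ev B (F i).
Proof.
move=> AF; elim: s => [|i s IHs]; first by rewrite !big_nil ev0.
rewrite !big_cons; case: ifP => // _.
by rewrite evD ?IHs // rpred_sum.
Qed.

Lemma evX F m : F \in Apl E -> ao_ev B (F ^+ m) = ao_ev B F ^+ m.
Proof.
move=> AF; elim: m => [|m IHm]; first by rewrite ev1.
by rewrite !exprS evM ?IHm // rpredX.
Qed.

Lemma ev_nat m : ao_ev B m%:R = m%:R.
Proof.
elim: m => [|m IHm]; first by rewrite ev0.
by rewrite !mulrS evD ?IHm ?ev1 ?rpred1 ?rpred_nat.
Qed.

Lemma lin_combD r (a b : 'I_r -> fps E) (u : 'I_r -> 'cV[B]_2) :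
  (forall i, a i \in Apl E) -> (forall i, b i \in Apl E) ->
  lin_comb (fun i => a i + b i) u = lin_comb a u + lin_comb b u.
Proof.
move=> Aa Ab; rewrite /lin_comb -big_split; apply: eq_bigr => i _.
by rewrite evD // scalerDl.
Qed.

Lemma lin_combB r (a b : 'I_r -> fps E) (u : 'I_r -> 'cV[B]_2) :
  (forall i, a i \in Apl E) -> (forall i, b i \in Apl E) ->
  lin_comb (fun i => a i - b i) u = lin_comb a u - lin_comb b u.
Proof.
move=> Aa Ab; rewrite /lin_comb -sumrB; apply: eq_bigr => i _.
by rewrite evB // scalerBl.
Qed.

Lemma lin_combZ r F (a : 'I_r -> fps E) (u : 'I_r -> 'cV[B]_2) :
  F \in Apl E -> (forall i, a i \in Apl E) ->
  lin_comb (fun i => F * a i) u = ao_ev B F *: lin_comb a u.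
Proof.
move=> AF Aa; rewrite /lin_comb scaler_sumr; apply: eq_bigr => i _.
by rewrite evM // scalerA.
Qed.

Lemma lin_comb0 r (u : 'I_r -> 'cV[B]_2) : lin_comb (fun=> 0) u = 0.
Proof. by rewrite /lin_comb big1 // => i _; rewrite ev0 scale0r. Qed.

Lemma lin_comb_sum r (I : Type) (s : seq I) (P : pred I) (a : I -> 'I_r -> fps E)
    (u : 'I_r -> 'cV[B]_2) :
  (forall x i, a x i \in Apl E) ->
  lin_comb (fun i => \sum_(x <- s | P x) a x i) u = \sum_(x <- s | P x) lin_comb (a
    x) u.
Proof.
move=> Aa; rewrite /lin_comb exchange_big; apply: eq_bigr => i _ /=.
by rewrite ev_sum // scaler_suml.
Qed.

Lemma lin_comb_delta r (i : 'I_r) (u : 'I_r -> 'cV[B]_2) :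
  lin_comb (fun j => (j == i)%:R) u = u i.
Proof.
rewrite /lin_comb (bigD1 i) //= eqxx ev1 scale1r big1 ?addr0 // => j ne_j.
by rewrite (negPf ne_j) ev0 scale0r.
Qed.

Lemma tAD (x y : 'cV[B]_2) : tA (x + y) = tA x + tA y.
Proof. by apply/matrixP => i j; rewrite !mxE rmorphD. Qed.

Lemma tA_ev F (x : 'cV[B]_2) : F \in Apl E ->
  tA (ao_ev B F *: x) = ao_ev B (fps_phi p F) *: tA x.
Proof.
by move=> /AplE AF; apply/matrixP => i j; rewrite !mxE rmorphM /= ao_ev_frob.
Qed.

Lemma tA_lin_comb r (a : 'I_r -> fps E) (u : 'I_r -> 'cV[B]_2) :
  (forall i, a i \in Apl E) ->
  tA (lin_comb a u) = lin_comb (fun i => fps_phi p (a i)) (fun i => tA (u i)).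
Proof.
move=> Aa; rewrite /lin_comb (big_morph (@tA _ _ _ B) tAD (_ : tA 0 = 0)).
  by apply: eq_bigr => i _; rewrite tA_ev.
by apply/matrixP => i j; rewrite !mxE rmorph0.
Qed.

End PeriodRingEvaluation.

(** * Semilinearity of the Galois action *)

Section GaloisAction.
Variables (p : nat) (E : localField p) (K : closureData E) (B : periodRing K).
Variables (k : nat) (rho : {rmorphism algC -> algC} -> 'M[E]_2).
Hypothesis p_prime : prime p.

Lemma gact_ev g F (x : 'cV[B]_2) : cl_GQp K g -> F \in Apl E ->
  gact k rho g (ao_ev B F *: x) =
  ao_ev B (fps_gamma (cl_chi g) F) *: gact k rho g x.
Proof.
move=> Gg /AplE AF; rewrite /gact.
have -> : map_mx (ao_gal B g) (ao_ev B F *: x) =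
    ao_ev B (fps_gamma (cl_chi g) F) *: map_mx (ao_gal B g) x.
  by apply/matrixP => i j; rewrite !mxE rmorphM /= ao_ev_gal.
by rewrite -scalemxAr !scalerA mulrC.
Qed.

Lemma chi_Oint g : cl_GQp K g -> cl_chi g \in Oint E.
Proof.
move=> /cl_chi_unit[/(_ 0%N)[m /OintE]]; rewrite expr0 divr1 => Om _ _.
by rewrite -(subrK m%:R (cl_chi g)) rpredD ?rpred_nat.
Qed.

Hypothesis rho_int : forall s i j, lf_int (rho s i j).

Lemma gact_tA g (x : 'cV[B]_2) : cl_GQp K g -> gact k rho g (tA x) = tA (gact k rho g
  x).
Proof.
move=> Gg; apply/matrixP => i j; rewrite !mxE rmorphM /=; congr (_ * _).
  by rewrite ao_frobO //; apply/OintE; rewrite rpredX // chi_Oint.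
rewrite rmorph_sum; apply: eq_bigr => l _.
by rewrite !mxE rmorphM /= ao_frobO // ao_gal_frob.
Qed.

Lemma nat_Zp_unit c : coprime p c -> is_Zp_unit (c%:R : E).
Proof.
move=> co; have [c0 /OintE Oc] := inv_Oint_coprime E p_prime co.
split=> // m; exists c; rewrite subrr mul0r; exact/OintE/rpred0.
Qed.

Lemma Gact_ev c F (x : 'cV[B]_2) : coprime p c -> F \in Apl E ->
  Gact k rho c%:R (ao_ev B F *: x) = ao_ev B (fps_sub c F) *: Gact k rho c%:R x.
Proof.
move=> co AF; have [Gg chi_c] := cl_liftP K (nat_Zp_unit co).
by rewrite /Gact gact_ev // chi_c (fps_gamma_nat (@lf_char0 _ E)).
Qed.

Lemma Gact_tA c (x : 'cV[B]_2) : coprime p c ->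
  Gact k rho c%:R (tA x) = tA (Gact k rho c%:R x).
Proof. by move=> co; apply: gact_tA; have [] := cl_liftP K (nat_Zp_unit co). Qed.

End GaloisAction.

(** * The module phi^*N and its psi-kernel in coordinates *)

Section WachCoordinates.
Variables (p : nat) (E : localField p) (K : closureData E) (B : periodRing K).
Variables (k : nat) (rho : {rmorphism algC -> algC} -> 'M[E]_2).
Variables (NT : 'cV[B]_2 -> Prop) (n : 'I_2 -> 'cV[B]_2).
Hypotheses (p_prime : prime p) (p_odd : odd p).
Hypothesis NT_Wach : is_Wach_module k rho NT.
Hypothesis n_basis : is_Aplus_basis NT n.

Lemma NT_lin_comb x : NT x <->
  exists2 a, forall i, a i \in Apl E & x = lin_comb a n.
Proof.
rewrite (n_basis.1 x); split=> [[a [Aa ->]]|[a Aa ->]]; exists a => //.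
  by move=> i; apply/AplE.
by split=> // i; apply/AplE.
Qed.

Lemma NT_basis i : NT (n i).
Proof.
apply/NT_lin_comb; exists (fun j => (j == i)%:R); last by rewrite lin_comb_delta.
by move=> j; rewrite rpred_nat.
Qed.

Lemma NT_lin_combP r (a : 'I_r -> fps E) (u : 'I_r -> 'cV[B]_2) :
  (forall i, a i \in Apl E) -> (forall i, NT (u i)) -> NT (lin_comb a u).
Proof.
move=> Aa Nu; have /choice[c cP] : forall i, exists c : 'I_2 -> fps E,
    (forall j, c j \in Apl E) /\ u i = lin_comb c n.
  by move=> i; have /NT_lin_comb[c Ac uE] := Nu i; exists c.
apply/NT_lin_comb; exists (fun j => \sum_(i < r) a i * c i j) => [j|].
  by rewrite rpred_sum // => i _; rewrite rpredM //; case: (cP i).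
rewrite (@lin_comb_sum _ _ _ _ _ _ _ _ (fun i j => a i * c i j)); last first.
  by move=> i j; rewrite rpredM //; case: (cP i).
by apply: eq_bigr => i _; have [Ac ->] := cP i; rewrite lin_combZ.
Qed.

Definition tn i : 'cV[B]_2 := tA (n i).

(* The matrix of the [tn i] is the image under Frobenius of an invertible one. *)
Lemma lin_comb_tn_eq0 F : (forall i, F i \in Apl E) -> lin_comb F tn = 0 ->
  forall i, F i = 0.
Proof.
move=> AF F0 i.
have [[m [mE m_free] [D mD]]] := NT_Wach; move=> _ _ _ _.
have mN j : exists2 a, forall i, a i \in Apl E & m j = lin_comb a n.
  apply/NT_lin_comb/mE; exists (fun i => (i == j)%:R); rewrite lin_comb_delta.
  by split=> // l; apply/AplE; rewrite rpred_nat.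
have /choice[c cP] : forall j, exists c : 'I_2 -> fps E,
    (forall j, c j \in Apl E) /\ m j = lin_comb c n.
  by move=> j; have [c Ac mjE] := mN j; exists c.
pose Nm : 'M[B]_2 := \matrix_(i, j) n j i 0.
(* Invertibility is given for some basis m of N; C expresses m through n and transfers it to n. *)
pose C : 'M[B]_2 := \matrix_(i, j) ao_ev B (c j i).
have NC : Nm *m C = \matrix_(i, j) m j i 0.
  apply/matrixP => r s; rewrite !mxE (cP s).2 summxE; apply: eq_bigr => l _.
  by rewrite !mxE mulrC.
pose Cm := C *m D.
have NCm : Nm *m Cm = 1%:M by rewrite mulmxA NC.
have CmN := mulmx1C NCm.
pose f : 'cV[B]_2 := \col_i ao_ev B (F i).
have tf : map_mx (ao_frob B) Nm *m f = 0.
  rewrite -F0; apply/matrixP => r s; rewrite !mxE summxE; apply: eq_bigr => l _.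
  by rewrite !mxE !ord1 mulrC.
have f0 : f = 0.
  have : map_mx (ao_frob B) Cm *m (map_mx (ao_frob B) Nm *m f) = 0 by rewrite tf mulmx0.
  by rewrite mulmxA -map_mxM CmN map_mx1 mul1mx.
have evF : ao_ev B (F i) = 0.
  by have := congr1 (fun Z : 'cV[B]_2 => Z i 0) f0; rewrite !mxE.
(* Injectivity of [ao_ev] on A^+ comes from the freeness of n, applied with both coefficients equal
   to [F i]. *)
apply: (n_basis.2 (fun=> F i) _ _ 0) => [_|]; first exact/AplE.
by rewrite /lin_comb big1 // => j _; rewrite evF scale0r.
Qed.

Lemma lin_comb_tn_inj F F' : (forall i, F i \in Apl E) -> (forall i, F' i \in Apl E) ->
  lin_comb F tn = lin_comb F' tn -> forall i, F i = F' i.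
Proof.
move=> AF AF' eqF i; apply/eqP; rewrite -subr_eq0; apply/eqP.
apply: (@lin_comb_tn_eq0 (fun i => F i - F' i) _ _ i) => [j|]; first by rewrite rpredB.
by rewrite lin_combB // eqF subrr.
Qed.

Lemma lin_comb_n_eq0 F : (forall i, F i \in Apl E) -> lin_comb F n = 0 ->
  forall i, F i = 0.
Proof. by move=> AF F0; apply: n_basis.2 => // i; apply/AplE. Qed.

Lemma phi_pullbackP x : phi_pullback NT x <->
  exists2 F, forall i, F i \in Apl E & x = lin_comb F tn.
Proof.
split=> [[r [a [u [auP ->]]]]|[F AF ->]]; last first.
  by exists 2%N, F, n; split=> // i; split; [apply/AplE|exact: NT_basis].
have Aa i : a i \in Apl E by have [/AplE] := auP i.
have /choice[c cP] : forall i, exists c : 'I_2 -> fps E,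
    (forall j, c j \in Apl E) /\ u i = lin_comb c n.
  by move=> i; have [_ /NT_lin_comb[c Ac uE]] := auP i; exists c.
have Aphi i j : fps_phi p (c i j) \in Apl E.
  by rewrite fps_phiE Apl_sub //; case: (cP i).
exists (fun j => \sum_(i < r) a i * fps_phi p (c i j)) => [j|].
  by rewrite rpred_sum // => i _; rewrite rpredM.
rewrite (@lin_comb_sum _ _ _ _ _ _ _ _ (fun i j => a i * fps_phi p (c i j)));
  last first.
  by move=> i j; rewrite rpredM.
apply: eq_bigr => i _; have [Ac ->] := cP i.
by rewrite tA_lin_comb // (lin_combZ _ (Aa i)) //.
Qed.

(** The vectors witnessing psi(x) = 0 are arbitrary; they are expanded over n and their coefficients
    along psi. Uniqueness of psi on series and freeness of n then make the components of index 0
    vanish. *)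
Lemma pullback_psi0P x : pullback_psi0 NT x <->
  exists Y : 'I_2 -> nat -> fps E, (forall i a, Y i a \in Apl E) /\
    ((forall i, Y i 0%N = 0) /\ x = lin_comb (fun i => psi_sum (Y i)) tn).
Proof.
split=> [[_ [r [a [b [u [auP xE bE]]]]]]|[Y [AY [Y0 ->]]]]; last first.
  have AS i : psi_sum (Y i) \in Apl E by exact: Apl_psi_sum.
  split; first by apply/phi_pullbackP; exists (fun i => psi_sum (Y i)).
  exists 2%N, (fun i => psi_sum (Y i)), (fun=> 0), n; split=> //.
    move=> i; split; [exact/AplE|exact/AplE/rpred0| |exact: NT_basis].
    by rewrite -(Y0 i); exact: is_psi_psi_sum.
  by rewrite lin_comb0.
have Aa i : a i \in Apl E by have [/AplE] := auP i.
have Ab i : b i \in Apl E by have [_ /AplE] := auP i.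
have /choice[c cP] : forall i, exists c : 'I_2 -> fps E,
    (forall j, c j \in Apl E) /\ u i = lin_comb c n.
  by move=> i; have [_ _ _ /NT_lin_comb[c Ac uE]] := auP i; exists c.
have /choice[A AP] : forall i, exists A : nat -> fps E,
    (forall m, A m \in Apl E) /\ a i = psi_sum A.
  by move=> i; have [A h1 h2] := psi_sum_exists p_prime p_odd (Aa i); exists A.
have bA i : b i = A i 0%N.
  have [_ _ ab _] := auP i; apply: (is_psi_unique p_prime ab).
  by rewrite (AP i).2; apply: is_psi_psi_sum => //; case: (AP i).
exists (fun j m => \sum_(i < r) c i j * A i m); split; last split.
- move=> j m; rewrite rpred_sum // => i _.
  by rewrite rpredM //; [case: (cP i)|case: (AP i)].
- apply: lin_comb_n_eq0.
    move=> j; rewrite rpred_sum // => i _.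
    by rewrite rpredM //; [case: (cP i)|case: (AP i)].
  rewrite (@lin_comb_sum _ _ _ _ _ _ _ _ (fun i j => c i j * A i 0%N)); last first.
    by move=> i j; rewrite rpredM //; [case: (cP i)|case: (AP i)].
  rewrite [RHS]bE; apply: eq_bigr => i _; have [Ac ->] := cP i.
  rewrite -lin_combZ // bA; congr lin_comb.
  by apply/funext => j; rewrite mulrC.
rewrite xE.
transitivity (lin_comb (fun j => \sum_(i < r) fps_phi p (c i j) * a i) tn).
  rewrite (@lin_comb_sum _ _ _ _ _ _ _ _ (fun i j => fps_phi p (c i j) * a i));
    last first.
    by move=> i j; rewrite rpredM // fps_phiE Apl_sub //; case: (cP i).
  apply: eq_bigr => i _; have [Ac ->] := cP i; rewrite tA_lin_comb //.
  rewrite -lin_combZ //; last by move=> j; rewrite fps_phiE Apl_sub.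
  by congr lin_comb; apply/funext => j; rewrite mulrC.
congr lin_comb; apply/funext => j.
under eq_bigr => i _ do rewrite (AP i).2 -psi_sumM.
rewrite /psi_sum exchange_big; apply: eq_bigr => m _ /=.
by rewrite fps_phiE rmorph_sum mulr_sumr.
Qed.

End WachCoordinates.

(** * The Iwasawa algebra *)

Section UnitsModPrimePower.
Variable p : nat.
Hypothesis p_prime : prime p.

Local Notation U n := {unit 'Z_(p ^ n.+1)}.

Let q_gt1 n : (1 < p ^ n.+1)%N.
Proof. by rewrite -(expn0 p) ltn_exp2l // prime_gt1. Qed.

Definition Zunit n (x : nat) : U n := insubd (1%g : U n) (x%:R : 'Z_(p ^ n.+1)).

Lemma val_Zunit n x : coprime p x -> (val (Zunit n x) : nat) = (x %% p ^ n.+1)%N.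
Proof.
move=> co; rewrite /Zunit insubdK; first by rewrite val_Zp_nat.
by rewrite unfold_in /= unitZpE // coprimeXl.
Qed.

Lemma unit_ltn n (c : U n) : (val c < p ^ n.+1)%N.
Proof. by rewrite -[X in (_ < X)%N](Zp_cast (q_gt1 n)) ltn_ord. Qed.

Lemma unit_coprime n (c : U n) : coprime p (val c).
Proof.
have := valP c; rewrite -[X in X \is a _]natr_Zp unitZpE //.
by rewrite coprime_pexpl.
Qed.

Lemma Zunit_val n (c : U n) : Zunit n (val c) = c.
Proof. by apply/val_inj/val_inj;
  rewrite /= val_Zunit ?unit_coprime // modn_small ?unit_ltn. Qed.

Lemma coprime_affine a z : (0 < a < p)%N -> coprime p (a + p * z).
Proof.
move=> /andP[a_gt0 lta]; rewrite addnC mulnC /coprime gcdnMDl.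
by rewrite -/(coprime p a) prime_coprime // gtnNdvd.
Qed.

Lemma affine_lt n a z : (a < p)%N -> (z < p ^ n)%N -> (a + p * z < p ^ n.+1)%N.
Proof.
move=> lta ltz; rewrite expnS (@leq_trans (p * z.+1)) ?leq_mul2l ?ltz ?orbT //.
by rewrite mulnS ltn_add2r.
Qed.

Lemma val_Zunit_affine n a z : (0 < a < p)%N -> (z < p ^ n)%N ->
  (val (Zunit n (a + p * z)) : nat) = (a + p * z)%N.
Proof.
move=> a_p ltz; rewrite val_Zunit ?coprime_affine // modn_small // affine_lt //.
by case/andP: a_p.
Qed.

Lemma sum_units (V : nmodType) n (f : U n -> V) :
  \sum_c f c = \sum_(a < p | (0 < a)%N) \sum_(z < p ^ n) f (Zunit n (a + p * z)).
Proof.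
have p_gt0 := prime_gt0 p_prime.
have lt1 (c : U n) : (val c %% p < p)%N by rewrite ltn_pmod.
have lt2 (c : U n) : (val c %/ p < p ^ n)%N.
  by rewrite ltn_divLR // mulnC -expnS unit_ltn.
pose h' c : 'I_p * 'I_(p ^ n) := (Ordinal (lt1 c), Ordinal (lt2 c)).
pose h (u : 'I_p * 'I_(p ^ n)) := Zunit n (u.1 + p * u.2).
rewrite (pair_big_dep (fun a : 'I_p => (0 < a)%N) (fun _ (_ : 'I_(p ^ n)) => true)
  (fun a z => f (Zunit n (a + p * z)))) /= (reindex_onto h h') /=; last first.
  by move=> c _; rewrite /h /= addnC mulnC -divn_eq Zunit_val.
apply: eq_bigl => -[a z]; rewrite andbT /=;
  apply/eqP/idP => [/(congr1 (fun u => val u.1)) /= aE|a_gt0].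
  (* Even for a = 0 the class [h (a, z)] is a unit, by its default value, so its residue modulo p is
     not 0. *)
  rewrite lt0n; apply/eqP => a0; move/eqP: aE; rewrite a0.
  by apply/negP; have := unit_coprime (h (a, z)); rewrite prime_coprime.
have a_p : (0 < a < p)%N by rewrite a_gt0 ltn_ord.
by congr pair; apply/val_inj; rewrite /= val_Zunit_affine // addnC mulnC
  ?modnMDl ?divnMDl // ?modn_small // divn_small // addn0.
Qed.

Lemma affine_inj a z b y : (a < p)%N -> (b < p)%N ->
  (a + p * z == b + p * y)%N = (a == b) && (z == y).
Proof.
move=> lta ltb; have p_gt0 := prime_gt0 p_prime.
apply/eqP/andP => [e|[/eqP-> /eqP->] //].
have ab : a = b.
  have := congr1 (modn^~ p) e; rewrite addnC mulnC modnMDl modn_small //.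
  by rewrite addnC mulnC modnMDl modn_small.
by move/eqP: e; rewrite ab eqn_add2l eqn_pmul2l // => /eqP ->.
Qed.

(** The lifts of a + pz modulo p^(n+2) are the a + p(z + p^n w), so compatibility in Lambda becomes
    additivity of each branch. *)
Lemma sum_units_fiber (V : nmodType) n (f : U n.+1 -> V) a z :
  (0 < a < p)%N -> (z < p ^ n)%N ->
  \sum_(d : U n.+1 | ((val d : nat) == (val (Zunit n (a + p * z)) : nat)
                      %[mod p ^ n.+1])%N) f d =
  \sum_(w < p) f (Zunit n.+1 (a + p * (z + p ^ n * w))%N).
Proof.
move=> a_p ltz; have /andP[a_gt0 lta] := a_p.
rewrite val_Zunit_affine // big_mkcond sum_units.
rewrite (bigD1 (Ordinal lta)) //= expnS.
rewrite (big_ord_mul_split _ _ (fun y => if ((val (Zunit n.+1 (a + p * y)) : nat) ==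
  (a + p * z)%N %[mod p * p ^ n])%N then f (Zunit n.+1 (a + p * y)) else 0)).
have ltw (y : 'I_(p ^ n)) (w : 'I_p) : (y + p ^ n * w < p ^ n.+1)%N.
  rewrite expnSr (@leq_trans (p ^ n * w.+1)) ?leq_mul2l ?ltn_ord ?orbT //.
  by rewrite mulnS ltn_add2r.
have modE b (y : 'I_(p ^ n)) (w : 'I_p) : (0 < b < p)%N ->
    ((val (Zunit n.+1 (b + p * (y + p ^ n * w))) : nat) ==
     (a + p * z)%N %[mod p * p ^ n])%N = (b == a) && (y == z :> nat).
  move=> b_p; have /andP[b_gt0 ltb] := b_p.
  rewrite val_Zunit_affine // mulnDr mulnA addnA [(p * p ^ n * w)%N]mulnC addnC modnMDl.
  by rewrite -expnS !modn_small ?affine_lt ?ltn_ord // affine_inj.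
rewrite (bigD1 (Ordinal ltz)) //= [X in _ + X + _]big1 ?addr0; last first.
  move=> y ne_y; rewrite big1 // => w _; rewrite modE // eqxx /=.
  by rewrite (_ : _ == _ = false) //; apply: contraNF ne_y => /eqP yz;
    apply/eqP/val_inj.
rewrite [X in _ + X]big1 ?addr0.
  by apply: eq_bigr => w _; rewrite (modE a (Ordinal ltz)) // !eqxx.
move=> b /andP[b_gt0 ne_b].
rewrite (big_ord_mul_split _ _ (fun y => if ((val (Zunit n.+1 (b + p * y)) : nat) ==
  (a + p * z)%N %[mod p * p ^ n])%N then f (Zunit n.+1 (b + p * y)) else 0)).
rewrite big1 // => y _; rewrite big1 // => w _; rewrite modE ?b_gt0 ?ltn_ord //.
rewrite (_ : _ == _ = false) //; apply: contraNF ne_b => /eqP ba; exact/eqP/val_inj.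
Qed.

Variable E : localField p.

(* The restriction of the measure [lam] to a + p Z_p, seen as a measure on Z_p. *)
Definition branch (lam : iwasawa_seq E) a n z : E := lam n (Zunit n (a + p * z)).

Lemma branch_measure lam a : (0 < a < p)%N -> is_Lambda lam -> is_measure (branch lam
  a).
Proof.
move=> a_p [lamO lamS]; split=> [n z|n z ltz]; first exact/OintE/lamO.
by rewrite /branch lamS sum_units_fiber.
Qed.

Lemma branch_inj lam lam' :
  (forall a n z, (0 < a < p)%N -> (z < p ^ n)%N -> branch lam a n z = branch lam' a n
    z) ->
  lam = lam'.
Proof.
move=> eq_lam; apply/functional_extensionality_dep => n; apply/ffunP => c.
have p_gt0 := prime_gt0 p_prime.
have := eq_lam (val c %% p)%N n (val c %/ p)%N.
rewrite /branch addnC mulnC -divn_eq Zunit_val; apply; last first.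
  by rewrite ltn_divLR // mulnC -expnS unit_ltn.
rewrite ltn_pmod // andbT lt0n; have := unit_coprime c.
by rewrite prime_coprime.
Qed.

(** Measures on the residue classes glue: c modulo p selects the branch and c / p the point in
    it. *)
Lemma branch_exists (nu : nat -> nat -> nat -> E) :
  (forall a, is_measure (nu a)) -> exists2 lam, is_Lambda lam &
  forall a n z, (0 < a < p)%N -> (z < p ^ n)%N -> branch lam a n z = nu a n z.
Proof.
move=> nuM; have p_gt0 := prime_gt0 p_prime.
pose lam : iwasawa_seq E := fun n =>
  [ffun c : U n => nu (val c %% p)%N n (val c %/ p)%N].
have lamE a n z : (0 < a < p)%N -> (z < p ^ n)%N -> branch lam a n z = nu a n z.
  move=> a_p ltz; rewrite /branch ffunE val_Zunit_affine // addnC mulnC modnMDl.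
  have /andP[_ lta] := a_p.
  by rewrite divnMDl // modn_small // divn_small // addn0.
exists lam => //; split=> [n c|n c].
  by apply/OintE; rewrite ffunE; case: (nuM (val c %% p)%N).
pose a := (val c %% p)%N; pose z := (val c %/ p)%N.
have cE : c = Zunit n (a + p * z) by rewrite addnC mulnC -divn_eq Zunit_val.
have a_p : (0 < a < p)%N.
  by rewrite ltn_pmod // andbT lt0n; have := unit_coprime c; rewrite prime_coprime.
have ltz : (z < p ^ n)%N by rewrite ltn_divLR // mulnC -expnS unit_ltn.
rewrite cE sum_units_fiber // -[LHS]/(branch lam a n z) lamE //.
have [_ ->] := nuM a; rewrite //; apply: eq_bigr => w _.
rewrite -[RHS]/(branch lam a n.+1 _) lamE // expnSr.
rewrite (@leq_trans (p ^ n * w.+1)) ?leq_mul2l ?ltn_ord ?orbT //.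
by rewrite mulnS ltn_add2r.
Qed.

End UnitsModPrimePower.

(** * The Lambda-basis *)

Section LambdaBasis.
Variables (p : nat) (E : localField p) (K : closureData E) (B : periodRing K).
Variables (k : nat) (rho : {rmorphism algC -> algC} -> 'M[E]_2).
Variables (NT : 'cV[B]_2 -> Prop) (n : 'I_2 -> 'cV[B]_2).
Hypotheses (p_prime : prime p) (p_odd : odd p).
Hypothesis rho_int : forall s i j, lf_int (rho s i j).
Hypothesis NT_Wach : is_Wach_module k rho NT.
Hypothesis n_basis : is_Aplus_basis NT n.

Local Notation b i := (ao_ev B (1 + fps_pi) *: tA (n i)).
Local Notation tn := (tn n).

Lemma psi_sum_sum (I : Type) (s : seq I) (Y : I -> nat -> fps E) :
  psi_sum (fun a => \sum_(i <- s) Y i a) = \sum_(i <- s) psi_sum (Y i).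
Proof.
rewrite /psi_sum exchange_big; apply: eq_bigr => a _.
by rewrite fps_phiE rmorph_sum mulr_sumr.
Qed.

(** U takes the first m coefficients divided by p^m and W the tail, so the ideal (p^m, pi^m) is
    visible on coefficients. *)
Lemma Apl_decomp m (Z : fps E) : Z \in Apl E ->
  (forall t, (t < m)%N -> Z t \in pideal E m) <->
  exists U W, [/\ U \in Apl E, W \in Apl E & Z = p%:R ^+ m * U + fps_pi ^+ m * W].
Proof.
move=> /AplP AZ; split=> [Zm|[U [W [/AplP AU AW ->]]] t ltm]; last first.
  by rewrite fpsD fps_piXM ltm addr0 -natrX fps_natM natrX pideal_pXM.
exists (fun t => if (t < m)%N then Z t / p%:R ^+ m else 0), (fun t => Z (t + m)%N).
split; first by apply/AplP => t; case: ifP => [/Zm //|_]; rewrite rpred0.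
  by apply/AplP.
apply/funext => t; rewrite fpsD -natrX fps_natM natrX fps_piXM.
case: ltnP => [_|le_m]; last by rewrite subnK // mulr0 add0r.
by rewrite mulrC divfK ?pX_neq0 // addr0.
Qed.

(** Translates the topology of [Lambda_act] into coordinates along phi(n_1), phi(n_2). *)
Lemma lin_comb_small m (Z : 'I_2 -> fps E) : (forall j, Z j \in Apl E) ->
  (forall j t, (t < m)%N -> Z j t \in pideal E m) <->
  exists u w, [/\ phi_pullback NT u, phi_pullback NT w
    & lin_comb Z tn = p%:R ^+ m *: u + ao_ev B (fps_pi ^+ m) *: w].
Proof.
move=> AZ; have ApX : (p%:R ^+ m : fps E) \in Apl E by rewrite rpredX ?rpred_nat.
have ApiX : (fps_pi ^+ m : fps E) \in Apl E by rewrite rpredX ?Apl_pi.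
have evp : ao_ev B (p%:R ^+ m) = p%:R ^+ m by rewrite evX ?rpred_nat // ev_nat.
split=> [Zm|[u [w [/(phi_pullbackP n_basis)[U AU ->]
                   /(phi_pullbackP n_basis)[W AW ->]]]]].
  have /choice[UW UWP] : forall j, exists UW : fps E * fps E,
      [/\ UW.1 \in Apl E, UW.2 \in Apl E
        & Z j = p%:R ^+ m * UW.1 + fps_pi ^+ m * UW.2].
    by move=> j; have /(Apl_decomp _ (AZ j))[U [W h]] := Zm j; exists (U, W).
  have AU j : (UW j).1 \in Apl E by case: (UWP j).
  have AW j : (UW j).2 \in Apl E by case: (UWP j).
  exists (lin_comb (fun j => (UW j).1) tn), (lin_comb (fun j => (UW j).2) tn).
  split; [by apply/phi_pullbackP; [exact: n_basis|exists (fun j => (UW j).1)]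
         |by apply/phi_pullbackP; [exact: n_basis|exists (fun j => (UW j).2)]|].
  rewrite -{1}evp -!lin_combZ // -lin_combD; try by move=> j; rewrite rpredM.
  by congr lin_comb; apply/funext => j; case: (UWP j).
rewrite -{1}evp -!lin_combZ // -lin_combD; try by move=> j; rewrite rpredM.
move=> /(lin_comb_tn_inj NT_Wach n_basis) ZE j.
apply/(Apl_decomp _ (AZ j)); exists (U j), (W j); split=> //.
by apply: ZE => // i; rewrite rpredD ?rpredM.
Qed.

Lemma Lambda_act_unique lam x y y' :
  Lambda_act k rho NT lam x y -> Lambda_act k rho NT lam x y' -> y = y'.
Proof.
move=> hy hy'.
have D m : exists u w, [/\ phi_pullback NT u, phi_pullback NT w
    & y' - y = p%:R ^+ m *: u + ao_ev B (fps_pi ^+ m) *: w].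
  have [n1 h1] := hy m; have [n2 h2] := hy' m.
  have [u1 [w1 [/(phi_pullbackP n_basis)[U1 AU1 ->] /(phi_pullbackP n_basis)[W1 AW1
    ->] e1]]] :=
    h1 _ (leq_maxl n1 n2).
  have [u2 [w2 [/(phi_pullbackP n_basis)[U2 AU2 ->] /(phi_pullbackP n_basis)[W2 AW2
    ->] e2]]] :=
    h2 _ (leq_maxr n1 n2).
  exists (lin_comb (fun j => U1 j - U2 j) tn), (lin_comb (fun j => W1 j - W2 j) tn).
  split; [apply/(phi_pullbackP n_basis)|apply/(phi_pullbackP n_basis)|].
  - by exists (fun j => U1 j - U2 j) => // j; rewrite rpredB.
  - by exists (fun j => W1 j - W2 j) => // j; rewrite rpredB.
  rewrite !lin_combB // !scalerBr addrACA -opprD -e1 -e2.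
  by rewrite opprB addrC addrA subrK.
have [Z AZ ZE] : exists2 Z, forall j, Z j \in Apl E & y' - y = lin_comb Z tn.
  have [u [w [/(phi_pullbackP n_basis)[U AU ->] /(phi_pullbackP n_basis)[W AW ->]
    ->]]] := D 0%N.
  exists (fun j => U j + W j) => [j|]; first by rewrite rpredD.
  by rewrite lin_combD // !expr0 ev1 !scale1r.
suff Z0 j : Z j = 0.
  apply/esym/eqP; rewrite -subr_eq0 ZE (_ : Z = fun=> 0) ?lin_comb0 //.
  exact/funext.
apply/funext => t; apply: (pideal_separated p_prime) => e.
(* The exponent must exceed t to reach coefficient t, and be at least e for its divisibility. *)
have [u [w [Nu Nw eq_uw]]] := D (maxn e t.+1).
have /(lin_comb_small _ AZ) h : exists u w, [/\ phi_pullback NT u, phi_pullback NT w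
    & lin_comb Z tn = p%:R ^+ (maxn e t.+1) *: u + ao_ev B (fps_pi ^+ (maxn e t.+1))
      *: w].
  by exists u, w; rewrite -ZE.
by apply: (pidealW p_prime (leq_maxl e t.+1)); apply: h; exact: leq_maxr.
Qed.

Variable G : nat -> 'M[fps E]_2.
Hypothesis G_int : forall c i j, coprime p c -> G c i j \in Apl E.
Hypothesis Gact_n : forall c j, coprime p c ->
  Gact k rho c%:R (n j) = lin_comb (fun i => G c i j) n.

Variable v : nat -> nat -> nat -> 'M[E]_2.
Hypothesis v_int : forall a t m i j, (0 < a < p)%N -> v a t m i j \in Oint E.
Hypothesis v_diag : forall a t i j, (0 < a < p)%N ->
  v a t t i j - (i == j)%:R \in pideal E 1.
Hypothesis v_orbit : forall a z i j t, (0 < a < p)%N ->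
  orbit_matrix G a z i j t = \sum_(m < t.+1) v a t m i j * 'C(z, m)%:R.

Lemma Gact_b a z i : (0 < a < p)%N ->
  Gact k rho (a + p * z)%:R (b i) =
  lin_comb (fun j => (1 + fps_pi) ^+ a * fps_phi p (orbit_matrix G a z j i)) tn.
Proof.
move=> a_p; have co := coprime_affine p_prime z a_p.
rewrite Gact_ev ?Apl_1pi // fps_sub_1pi Gact_tA // Gact_n // tA_lin_comb; last first.
  by move=> j; exact: G_int.
rewrite -lin_combZ ?rpredX ?Apl_1pi //; last first.
  by move=> j; rewrite fps_phiE Apl_sub // G_int.
congr lin_comb; apply/funext => j;
  rewrite mxE !fps_phiE rmorphM rmorphXn /= fps_sub_1pi.
by rewrite exprD exprM mulrA.
Qed.

(** Component a, in coordinate j, of the level-r sum for lam acting on b_i: a Riemann sum of V_a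
    against branch a of lam. *)
Definition act_partial (lam : iwasawa_seq E) r i j a : fps E :=
  if (0 < a < p)%N then
    \sum_(z < p ^ r) fps_const (branch lam a r z) * orbit_matrix G a z j i
  else 0.

(** The limit of this component in terms of the moments l. The value 0 at a = 0 encodes psi = 0. *)
Definition act_limit (l : nat -> nat -> E) i j a : fps E :=
  if (0 < a < p)%N then fun t => \sum_(m < t.+1) v a t m j i * l a m else 0.

Let orbit_int a z i j : (0 < a < p)%N -> orbit_matrix G a z i j \in Apl E.
Proof.
move=> a_p; apply: orbit_matrix_int => //.
by have := coprime_affine p_prime 0 a_p; rewrite muln0 addn0.
Qed.

Lemma act_partial_int lam r i j a : is_Lambda lam -> act_partial lam r i j a \in Apl E.
Proof.
move=> [lamO _]; rewrite /act_partial; case: ifP => a_p; last exact: rpred0.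
rewrite rpred_sum // => z _; rewrite rpredM ?orbit_int //.
exact/Apl_const/OintE/lamO.
Qed.

Lemma act_limit_int l i j a : (forall a m, (0 < a < p)%N -> l a m \in Oint E) ->
  act_limit l i j a \in Apl E.
Proof.
move=> Ol; rewrite /act_limit; case: ifP => a_p; last exact: rpred0.
by apply/AplP => t; rewrite rpred_sum // => m _; rewrite rpredM ?v_int ?Ol.
Qed.

Lemma Lambda_partial lam r i : is_Lambda lam ->
  \sum_(c : {unit 'Z_(p ^ r.+1)}) ao_O B (lam r c) *: Gact k rho (val c : nat)%:R (b
    i) =
  lin_comb (fun j => psi_sum (act_partial lam r i j)) tn.
Proof.
move=> lamL; have [lamO _] := lamL; rewrite sum_units //.
transitivity (\sum_(a < p | (0 < a)%N) \sum_(z < p ^ r) lin_comb (fun j =>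
    fps_const (branch lam a r z) *
      ((1 + fps_pi) ^+ a * fps_phi p (orbit_matrix G a z j i))) tn).
  apply: eq_bigr => a a_gt0; apply: eq_bigr => z _.
  have a_p : (0 < a < p)%N by rewrite a_gt0 ltn_ord.
  rewrite val_Zunit_affine // Gact_b // -ev_const; last exact/OintE/lamO.
  rewrite -lin_combZ //; first by apply: Apl_const; exact/OintE/lamO.
  by move=> j; rewrite rpredM ?rpredX ?Apl_1pi // fps_phiE Apl_sub // orbit_int.
have A1 a z j : (0 < a < p)%N -> fps_const (branch lam a r z) *
      ((1 + fps_pi) ^+ a * fps_phi p (orbit_matrix G a z j i)) \in Apl E.
  move=> a_p; rewrite !rpredM ?rpredX ?Apl_1pi // ?fps_phiE ?Apl_sub ?orbit_int //.
  by apply: Apl_const; exact/OintE/lamO.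
transitivity (\sum_(a < p | (0 < a)%N) lin_comb (fun j =>
   (1 + fps_pi) ^+ a * fps_phi p (act_partial lam r i j a)) tn).
  apply: eq_bigr => a a_gt0; have a_p : (0 < a < p)%N by rewrite a_gt0 ltn_ord.
  rewrite -(lin_comb_sum _ _ (a := fun (z : 'I_(p ^ r)) j => fps_const (branch lam a
    r z) *
      ((1 + fps_pi) ^+ a * fps_phi p (orbit_matrix G a z j i)))); last first.
    by move=> z j; exact: A1.
  congr lin_comb; apply/funext => j;
    rewrite /act_partial a_p fps_phiE rmorph_sum mulr_sumr.
  by apply: eq_bigr => z _; rewrite rmorphM /= fps_sub_const mulrCA.
have A2 a j : (1 + fps_pi) ^+ a * fps_phi p (act_partial lam r i j a) \in Apl E.
  by rewrite rpredM ?rpredX ?Apl_1pi // fps_phiE Apl_sub // act_partial_int.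
rewrite -(lin_comb_sum _ _ (a := fun (a : 'I_p) j =>
  (1 + fps_pi) ^+ a * fps_phi p (act_partial lam r i j a))) //.
congr lin_comb; apply/funext => j; rewrite /psi_sum big_mkcond.
apply: eq_bigr => a _; case: ifP => // a_gt0.
by rewrite /act_partial a_gt0 /= fps_phiE rmorph0 mulr0.
Qed.

(** By [v_orbit], coefficient t of a partial component is a finite combination of Riemann sums of
    C(-, m), m <= t, which tend to the moments. *)
Lemma Lambda_act_limit lam l i : is_Lambda lam ->
  (forall a m, (0 < a < p)%N -> l a m \in Oint E) ->
  (forall a, (0 < a < p)%N -> moments (branch lam a) (l a)) ->
  Lambda_act k rho NT lam (b i) (lin_comb (fun j => psi_sum (act_limit l i j)) tn).
Proof.
move=> lamL Ol lamM m.
have conv : exists r0, forall r, (r0 <= r)%N -> forall j a s, (a < p)%N -> (s < m)%N ->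
    (act_partial lam r i j a - act_limit l i j a) s \in pideal E m.
  have conv1 j a s : exists r0, forall r, (r0 <= r)%N ->
      (act_partial lam r i j a - act_limit l i j a) s \in pideal E m.
    rewrite /act_partial /act_limit; case: ifP => a_p; last first.
      by exists 0%N => r _; rewrite subrr fps0 rpred0.
    have h : pconv (fun r => \sum_(m < s.+1) v a s m j i *
        \sum_(z < p ^ r) branch lam a r z * 'C(z, m)%:R)
        (\sum_(m < s.+1) v a s m j i * l a m).
      by apply: pconv_sum => m'; apply: pconvZ => //; exact: lamM.
    have [r0 r0P] := h m; exists r0 => r /r0P hr; apply: (eq_in hr).
    rewrite fpsB; congr (_ - _); rewrite fps_sum.
    under eq_bigr do rewrite mulr_sumr.
    rewrite exchange_big; apply: eq_bigr => z _ /=.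
    rewrite fps_constM v_orbit // mulr_sumr; apply: eq_bigr => m' _.
    by rewrite mulrCA.
  (* Modulo (p^m, pi^m) only finitely many triples (j, a, s) matter, so one level serves them
     all. *)
  have bound (T : finType) (Q : T -> nat -> Prop) :
      (forall x, exists r0, forall r, (r0 <= r)%N -> Q x r) ->
      exists r0, forall r, (r0 <= r)%N -> forall x, Q x r.
    move=> /choice[r0 r0P]; exists (\max_x r0 x)%N => r le_r x.
    by apply: r0P; apply: leq_trans le_r; exact: leq_bigmax.
  have [r0 r0P] := bound ('I_2 * 'I_p * 'I_m)%type
    (fun x r => (act_partial lam r i x.1.1 x.1.2 - act_limit l i x.1.1 x.1.2) x.2
       \in pideal E m) (fun x => conv1 x.1.1 x.1.2 x.2).
  exists r0 => r le_r j a s lta lts.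
  exact: (r0P r le_r (j, Ordinal lta, Ordinal lts)).
have [r0 r0P] := conv; exists r0 => r le_r.
have AP j a : act_partial lam r i j a \in Apl E by exact: act_partial_int.
have AL j a : act_limit l i j a \in Apl E by exact: act_limit_int.
rewrite Lambda_partial // -lin_combB => [|j|j]; try exact: Apl_psi_sum.
apply/(lin_comb_small m) => [j|j t ltm]; first by rewrite rpredB ?Apl_psi_sum.
have -> : psi_sum (act_partial lam r i j) - psi_sum (act_limit l i j) =
    psi_sum (fun a => act_partial lam r i j a - act_limit l i j a).
  apply/eqP; rewrite subr_eq -psi_sumD; apply/eqP; congr psi_sum.
  by apply/funext => a; rewrite subrK.
apply: (psi_sum_coef p_prime p_odd) => a s lta les; apply: r0P => //.
exact: leq_ltn_trans ltm.
Qed.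

Lemma Lambda_moments lam : is_Lambda lam -> exists l : nat -> nat -> E,
  (forall a m, (0 < a < p)%N -> l a m \in Oint E) /\
  (forall a, (0 < a < p)%N -> moments (branch lam a) (l a)).
Proof.
move=> lamL.
have /choice[l lP] : forall a, exists l : nat -> E, (0 < a < p)%N ->
    (forall m, l m \in Oint E) /\ moments (branch lam a) l.
  move=> a; case: (boolP (0 < a < p)%N) => a_p; last by exists (fun=> 0).
  by have [l lP] := measure_moments p_prime (branch_measure p_prime a_p lamL); exists l.
by exists l; split=> a; [move=> m|]; move=> /lP[].
Qed.

Lemma act_limit_sum (l : 'I_2 -> nat -> nat -> E) :
  (forall i a m, (0 < a < p)%N -> l i a m \in Oint E) ->
  \sum_i lin_comb (fun j => psi_sum (act_limit (l i) i j)) tn =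
  lin_comb (fun j => psi_sum (fun a => \sum_i act_limit (l i) i j a)) tn.
Proof.
move=> Ol; rewrite -(lin_comb_sum _ _ (a := fun i j => psi_sum (act_limit (l i) i j))).
  by congr lin_comb; apply/funext => j; rewrite psi_sum_sum.
by move=> i j; apply: Apl_psi_sum => a; exact: act_limit_int (Ol i).
Qed.

Lemma act_limit_sum_coef (l : 'I_2 -> nat -> nat -> E) j a t : (0 < a < p)%N ->
  (\sum_i act_limit (l i) i j a) t =
  (\sum_(m < t.+1) v a t m *m \col_i l i a m) j 0.
Proof.
move=> a_p; rewrite fps_sum summxE.
under [RHS]eq_bigr do rewrite mxE.
rewrite exchange_big; apply: eq_bigr => i _; rewrite /act_limit a_p /=.
by apply: eq_bigr => m _; rewrite mxE.
Qed.

Lemma Lambda_basis_phi_pullback : is_Lambda_basis k rho NT (fun i => b i).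
Proof.
split=> [i|lam lamL|x].
- apply/(pullback_psi0P p_prime p_odd n_basis).
  (* b_i has the single component y_1 = n_i. *)
  exists (fun j a => ((a == 1%N) && (j == i))%:R); split; last split => [j //|].
    by move=> j a; rewrite rpred_nat.
  rewrite -[tA (n i)]/(tn i) -(lin_comb_delta i tn) -lin_combZ ?Apl_1pi //; last first.
    by move=> j; rewrite rpred_nat.
  congr lin_comb; apply/funext => j; rewrite /psi_sum.
  rewrite (bigD1 (Ordinal (prime_gt1 p_prime))) //= fps_phiE rmorph_nat expr1.
  rewrite big1 ?addr0 // => a ne_a; rewrite (_ : (_ == _) = false) ?rmorph0 ?mulr0 //.
  by apply: contraNF ne_a => /eqP a1; apply/eqP/val_inj.
- have /choice[l lP] : forall i, exists l : nat -> nat -> E,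
    (forall a m, (0 < a < p)%N -> l a m \in Oint E) /\
    (forall a, (0 < a < p)%N -> moments (branch (lam i) a) (l a)).
    by move=> i; exact: Lambda_moments.
  have Ol i a m : (0 < a < p)%N -> l i a m \in Oint E by move=> ?; apply: (lP i).1.
  pose y i := lin_comb (fun j => psi_sum (act_limit (l i) i j)) tn.
  have yP i : Lambda_act k rho NT (lam i) (b i) (y i).
    by apply: Lambda_act_limit => //; [exact: Ol|exact: (lP i).2].
  exists (\sum_i y i); split; last first.
    move=> x [_ [y' y'P ->]]; apply: eq_bigr => i _.
    exact: Lambda_act_unique (yP i) (y'P i).
  split; last by exists y.
  apply/(pullback_psi0P p_prime p_odd n_basis).
  exists (fun j a => \sum_i act_limit (l i) i j a); split; last split.
  + by move=> j a; rewrite rpred_sum // => i _; apply: act_limit_int; exact: Ol.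
  + by move=> j; rewrite big1.
  + exact: act_limit_sum.
move=> /(pullback_psi0P p_prime p_odd n_basis)[Y [AY [Y0 xE]]].
have /choice[L LP] : forall a, exists L : nat -> 'cV[E]_2,
    (forall m i, L m i 0 \in Oint E) /\ ((0 < a < p)%N ->
     forall t, \col_j Y j a t = \sum_(m < t.+1) v a t m *m L m).
  move=> a; case: (boolP (0 < a < p)%N) => a_p; last first.
    by exists (fun=> 0); split=> // m i; rewrite mxE rpred0.
  have v_int' t m i j : v a t m i j \in Oint E by exact: v_int.
  have v_diag' t i j : v a t t i j - (i == j)%:R \in pideal E 1 by exact: v_diag.
  have OY t i : (\col_j Y j a t) i 0 \in Oint E.
    by rewrite mxE; apply: (AplP _ (AY i a)).
  by have [L OL LE] := triangular_solve p_prime v_int' v_diag' OY; exists L.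
pose l i a m := L a m i 0.
have /choice[lam lamP] : forall i, exists lam : iwasawa_seq E, is_Lambda lam /\
    forall a, (0 < a < p)%N -> moments (branch lam a) (l i a).
  move=> i; have /choice[nu nuP] : forall a, exists nu : nat -> nat -> E,
      is_measure nu /\ moments nu (l i a).
    by move=> a; apply: moments_measure => // m; exact: (LP a).1.
  have [lam lamL lamE] := branch_exists p_prime (fun a => (nuP a).1).
  exists lam; split=> // a a_p m; have := (nuP a).2 m; apply: pconv_eq => r.
  by apply: eq_bigr => z _; rewrite lamE.
have Ol i a m : (0 < a < p)%N -> l i a m \in Oint E by move=> _; exact: (LP a).1.
(* Components in phi^*N are unique, so x is the combination with moments l' exactly when the
   components agree; at a = 0 both are 0. *)
have xlim (l' : 'I_2 -> nat -> nat -> E) :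
    (forall i a m, (0 < a < p)%N -> l' i a m \in Oint E) ->
    x = \sum_i lin_comb (fun j => psi_sum (act_limit (l' i) i j)) tn <->
    forall j a, (0 < a < p)%N -> Y j a = \sum_i act_limit (l' i) i j a.
  move=> Ol'; rewrite act_limit_sum // xE.
  have A' j a : \sum_i act_limit (l' i) i j a \in Apl E.
    by rewrite rpred_sum // => i _; apply: act_limit_int; exact: Ol'.
  split=> [/(lin_comb_tn_inj NT_Wach n_basis) eqY j a a_p|eqY].
    have {}eqY : psi_sum (Y j) = psi_sum (fun a => \sum_i act_limit (l' i) i j a).
      by apply: eqY => j'; exact: Apl_psi_sum.
    apply/eqP; rewrite -subr_eq0; apply/eqP.
    apply: (@psi_sum_eq0 _ _ K p_prime p_odd
      (fun a => Y j a - \sum_i act_limit (l' i) i j a)).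
    - by move=> a'; rewrite rpredB.
    - have := psi_sumD (fun a => Y j a - \sum_i act_limit (l' i) i j a)
        (fun a => \sum_i act_limit (l' i) i j a).
      rewrite (_ : (fun a => _ + _) = Y j); last by apply/funext => a'; rewrite subrK.
      by rewrite eqY => /(canLR (addrK _)); rewrite subrr.
    - by case/andP: a_p.
  congr lin_comb; apply/funext => j; rewrite /psi_sum; apply: eq_bigr => a _.
  case: (posnP a) => [-> |a_gt0].
    by rewrite Y0 big1.
  by rewrite eqY // a_gt0 ltn_ord.
exists lam; split.
  split=> [i|]; first by case: (lamP i).
  exists (fun i => lin_comb (fun j => psi_sum (act_limit (l i) i j)) tn).
    by move=> i; have [? ?] := lamP i; apply: Lambda_act_limit => //; exact: Ol.
  apply/xlim => // j a a_p; apply/funext => t.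
  rewrite act_limit_sum_coef //; have := (LP a).2 a_p t => /matrixP/(_ j 0).
  rewrite mxE => ->; congr fun_of_matrix; apply: eq_bigr => m _; congr (_ *m _).
  by apply/colP => i; rewrite mxE.
move=> lam' [lam'L [y' y'P xE']].
have /choice[l' l'P] : forall i, exists l : nat -> nat -> E,
    (forall a m, (0 < a < p)%N -> l a m \in Oint E) /\
    (forall a, (0 < a < p)%N -> moments (branch (lam' i) a) (l a)).
  by move=> i; exact: Lambda_moments.
have Ol' i a m : (0 < a < p)%N -> l' i a m \in Oint E by move=> ?; apply: (l'P i).1.
have Yl' : forall j a, (0 < a < p)%N -> Y j a = \sum_i act_limit (l' i) i j a.
  apply/xlim => //; rewrite xE'; apply: eq_bigr => i _.
  apply: (Lambda_act_unique (y'P i)); apply: Lambda_act_limit => //.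
    exact: Ol'.
  exact: (l'P i).2.
(* The difference of two families of moments solves the homogeneous triangular system. *)
have ll' i a m : (0 < a < p)%N -> l i a m = l' i a m.
  move=> a_p; have v0 : \col_i l i a m - \col_i l' i a m = 0.
    have v_diag' t i' j : v a t t i' j - (i' == j)%:R \in pideal E 1 by exact: v_diag.
    apply: (@triangular_unique _ E p_prime (v a) v_diag'
      (fun m => \col_i l i a m - \col_i l' i a m)) => t.
     apply/colP => j; rewrite [RHS]mxE.
    transitivity ((\sum_(m < t.+1) v a t m *m \col_i l i a m) j 0 -
                  (\sum_(m < t.+1) v a t m *m \col_i l' i a m) j 0).
      rewrite !summxE -sumrB; apply: eq_bigr => m' _.
      by rewrite mulmxBr !mxE.
    rewrite -!act_limit_sum_coef // -Yl' //; apply/eqP; rewrite subr_eq0; apply/eqP.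
    rewrite act_limit_sum_coef //; have := (LP a).2 a_p t => /matrixP/(_ j 0).
    rewrite mxE => ->; congr fun_of_matrix; apply: eq_bigr => m' _; congr (_ *m _).
    by apply/colP => i'; rewrite mxE.
  by move/colP/(_ i)/eqP: v0; rewrite !mxE subr_eq0 => /eqP.
apply/funext => i; apply: (branch_inj p_prime) => a r z a_p ltz.
have [lamL lamM] := lamP i.
apply: (measure_moments_inj p_prime (l := l i a)) => //; try exact: branch_measure.
  exact: lamM.
by move=> m; rewrite ll' //; apply: (l'P i).2.
Qed.

End LambdaBasis.

(** * The cocycle attached to the Wach module *)

Theorem theorem3p3 (R : realType) (p k N : nat)
    (eps : int -> R[i]) (f : R[i] -> R[i]) (a : nat -> R[i])
    (E : localField p) (iota : R[i] -> E) (K : closureData E)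
    (rho : {rmorphism algC -> algC} -> 'M[E]_2) (B : periodRing K)
    (NT : 'cV[B]_2 -> Prop) (n : 'I_2 -> 'cV[B]_2)
    (J : 'cV[B]_2 -> 'cV[fps E]_2) (M : 'M[fps E]_2)
    (p_prime : prime p) (p_odd : odd p) (k_ge3 : (3 <= k)%N) (k_le : (k <= p)%N)
    (N_prime_to_p : coprime N p)
    (f_newform : newform N k eps f a)
    (E_completion : is_completion a iota)
    (f_non_ordinary : non_ordinary a iota)
    (rho_lattice : lattice_rep rho)
    (rho_f : attached_to N k eps a iota rho)
    (NT_Wach : is_Wach_module k rho NT)
    (n_basis : is_Aplus_basis NT n)
    (v1_Fil0 : Fil0_cris NT (n 0))
    (v2_phi_v1 : phi_cris k NT (n 0) (n 1))
    (J_embedding : is_cris_embedding k rho NT n J)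
    (M_def : forall i j, M i j = J (n j) i 0)
    (M_cong : forall i j m, (m < k.-1)%N -> M i j m = (1%:M : 'M[fps E]_2) i j m) :
  is_Lambda_basis k rho NT (fun i => ao_ev B (1 + fps_pi) *: tA (n i)).
Proof.
have rho_int : forall s i j, lf_int (rho s i j) by case: rho_lattice.
have NT_gact : forall g x, cl_GQp K g -> NT x -> NT (gact k rho g x).
  by move=> g x Gg Nx; case: NT_Wach => _ _ h _ _; case: (h g x Gg Nx).
(* Column j of G_c holds the coordinates of c n_j; for c divisible by p the matrix is set to 0. *)
have /choice[G GP] : forall c, exists Gc : 'M[fps E]_2, coprime p c ->
    (forall i j, Gc i j \in Apl E) /\
    forall j, Gact k rho c%:R (n j) = lin_comb (fun i => Gc i j) n.
  move=> c; have [co|nco] := boolP (coprime p c); last by exists 0.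
  have /choice[g gP] : forall j, exists g : 'I_2 -> fps E,
      (forall i, g i \in Apl E) /\ Gact k rho c%:R (n j) = lin_comb g n.
    move=> j; have [Gg _] := cl_liftP K (nat_Zp_unit E p_prime co).
    have /(NT_lin_comb n_basis)[g Ag gE] := NT_gact _ _ Gg (NT_basis n_basis j).
    by exists g.
  exists (\matrix_(i, j) g j i) => _; split=> [i j|j].
    by rewrite mxE; exact: (gP j).1.
  by rewrite (gP j).2; congr lin_comb; apply/funext => i; rewrite mxE.
have G_int c i j : coprime p c -> G c i j \in Apl E by move=> co; exact: (GP c co).1.
have Gact_n c j : coprime p c -> Gact k rho c%:R (n j) = lin_comb (fun i => G c i j) n.
  by move=> co; exact: (GP c co).2.
(* J is additive, A^+-linear and commutes with Gamma; apply it to the expansion of c n_j. *)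
have MG c : coprime p c -> M *m G c = map_mx (fps_sub c) M.
  move=> co; case: J_embedding => P [_ _ [JD JZ] [Jg _] _].
  have Nev F i : F \in Apl E -> NT (ao_ev B F *: n i).
    move=> AF; have : NT (lin_comb (fun=> F) (fun _ : 'I_1 => n i)).
      by apply: (NT_lin_combP n_basis) => // _; exact: (NT_basis n_basis).
    by rewrite /lin_comb big_ord1.
  apply/matrixP => s j; rewrite !mxE.
  have -> : fps_sub c (M s j) = J (Gact k rho c%:R (n j)) s 0.
    rewrite (Jg _ _ (nat_Zp_unit E p_prime co) (NT_basis n_basis j)) mxE M_def.
    by rewrite (fps_gamma_nat (@lf_char0 _ E)).
  rewrite Gact_n // /lin_comb !big_ord_recl !big_ord0 !addr0.
  have Ag i : G c i j \in Apl E by exact: G_int.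
  have AplG i : Aplus (G c i j) by apply/AplE.
  rewrite JD ?JZ //; try exact: Nev; try exact: (NT_basis n_basis).
  by rewrite !mxE !M_def !(mulrC (J _ _ _)).
(* From k >= 3, M and hence every G_c is the identity modulo pi^2, the precision that [twist_step]
   asks for. *)
have h_ge2 : (2 <= k.-1)%N by lia.
have co_a a0 : (0 < a0 < p)%N -> coprime p a0.
  by move=> /(coprime_affine p_prime 0); rewrite muln0 addn0.
apply: (Lambda_basis_phi_pullback p_prime p_odd rho_int NT_Wach n_basis G_int Gact_n
  (v := fun a0 t m => \matrix_(i, j) orbit_coef G a0 t m i j)).
- by move=> a0 t m i j /co_a co; rewrite mxE; exact: orbit_coef_Oint.
- move=> a0 t i j /co_a co; rewrite mxE.
  exact: (orbit_coef_diag p_prime p_odd h_ge2 M_cong G_int MG co).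
move=> a0 z i j t /co_a co.
rewrite (orbit_coefE p_prime p_odd h_ge2 M_cong MG co).
by apply: eq_bigr => m _; rewrite mxE.
Qed.
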